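(* Let $\Omega\subset\mathbb{C}^d$ be a $\mathbb{C}$-proper convex open set. Suppose that for every sequence $u_n\in\Omega$ there exist a subsequence $n_k\to\infty$, complex affine maps $A_k\in\mathrm{Aff}(\mathbb{C}^d)$, a number $m>0$ and a $\mathbb{C}$-proper convex open set $\widehat{\Omega}$ such that (1) $A_k\Omega\to\widehat\Omega$ in the local Hausdorff topology, (2) $A_ku_{n_k}\to u_\infty$ for some $u_\infty\in\widehat\Omega$, (3) $(A_k\Omega)_{k\in\mathbb{N}}$ is a locally $m$-convex sequence, and (4) every geodesic of $(\widehat\Omega,d_{\widehat\Omega})$ is well behaved. Then $(\Omega,d_\Omega)$ is Gromov hyperbolic.
   Context: $\mathbb{C}$-proper: contains no complex affine line. $d_\Omega$ is the Kobayashi distance. Local Hausdorff topology: open convex $A_n\to A$ iff $d_H(\overline{A_n}\cap\overline{B_R(0)},\overline{A}\cap\overline{B_R(0)})\to0$ for all $R>0$. For an open set $\Omega$, $p\in\Omega$ and $v\neq0$, $\delta_\Omega(p)=\inf\{\|q-p\|:q\notin\Omega\}$ and $\delta_\Omega(p;v)=\inf\{\|q-p\|: q\in(p+\mathbb{C}v)\setminus\Omega\}$. A sequence $(\Omega_n)$ of $\mathbb{C}$-proper convex open sets is a locally $m$-convex sequence if for every $R>0$ there are $N,C>0$ with $\delta_{\Omega_n}(p;v)\le C\delta_{\Omega_n}(p)^{1/m}$ for all $n>N$, $p\in\Omega_n\cap B_R(0)$ and nonzero $v\in\mathbb{C}^d$. A geodesic $\sigma:\mathbb{R}\to\widehat\Omega$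 (i.e. $d_{\widehat\Omega}(\sigma(s),\sigma(t))=|s-t|$) is well behaved if $\lim_{t\to-\infty}\sigma(t)$ and $\lim_{t\to+\infty}\sigma(t)$ both exist in the one-point compactification $\mathbb{C}^d\cup\{\infty\}$ and are distinct. *)

(* Defs.v *)
From HB Require Import structures.
From mathcomp Require Import all_boot all_order all_algebra.
From mathcomp Require Import complex.
From mathcomp Require Import boolp classical_sets reals constructive_ereal ereal exp.
Set Implicit Arguments. Unset Strict Implicit. Unset Printing Implicit Defensive.
Import Order.TTheory GRing.Theory Num.Theory.
Local Open Scope ring_scope.
Local Open Scope classical_set_scope.

Section Defs.
Variable R : realType.
Local Notation C := (R[i]).
Variable d : nat.
Local Notation pt := 'rV[C]_d.

Definition cabs (z : C) : R := let: Complex a b := z in Num.sqrt (a ^+ 2 + b ^+ 2).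

Definition vnorm (z : pt) : R := Num.sqrt (\sum_(i < d) cabs (z 0 i) ^+ 2).

Definition is_open (O : set pt) : Prop :=
  forall p, O p -> exists e : R, 0 < e /\ forall q, vnorm (q - p) < e -> O q.

Definition is_convex (O : set pt) : Prop :=
  forall x y, O x -> O y -> forall t : R, 0 <= t <= 1 ->
    O (((1 - t)%:C)%C *: x + ((t%:C)%C) *: y).

Definition C_proper (O : set pt) : Prop :=
  ~ exists (p v : pt), v != 0 /\ forall l : C, O (p + l *: v).

Definition closure_set (O : set pt) : set pt :=
  [set p | forall e : R, 0 < e -> exists q, O q /\ vnorm (p - q) < e].

Definition closed_ball (r : R) : set pt := [set p | vnorm p <= r].

Definition in_nbhd (e : R) (X Y : set pt) : Prop :=
  forall x, X x -> exists y, Y y /\ vnorm (x - y) <= e.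

(* Hausdorff distance d_H(X,Y) (extended real; +oo if no e works) *)
Definition hausdorff_dist (X Y : set pt) : \bar R :=
  ereal_inf [set (e%:E)%E | e in [set e : R | 0 <= e /\ in_nbhd e X Y /\ in_nbhd e Y X]].

Definition local_hausdorff_cvg (An : nat -> set pt) (A : set pt) : Prop :=
  forall r : R, 0 < r -> forall e : R, 0 < e -> exists N, forall n, (N <= n)%N ->
    (hausdorff_dist (closure_set (An n) `&` closed_ball r)
                    (closure_set A `&` closed_ball r) <= e%:E)%E.

Definition bdist (O : set pt) (p : pt) : R := inf [set vnorm (q - p) | q in ~` O].
Definition bdist_dir (O : set pt) (p v : pt) : R :=
  inf [set vnorm (q - p) | q in [set p + l *: v | l in [set: C]] `&` ~` O].

Definition locally_m_convex_seq (On : nat -> set pt) (m : R) : Prop :=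
  (forall n, C_proper (On n) /\ is_convex (On n) /\ is_open (On n)) /\
  forall r : R, 0 < r -> exists (N : nat) (K : R), 0 < K /\
    forall n, (N < n)%N -> forall p, On n p -> vnorm p < r -> forall v : pt, v != 0 ->
      bdist_dir (On n) p v <= K * powR (bdist (On n) p) (1 / m).

Definition unit_disc : set C := [set z | cabs z < 1].

Definition cdiff_at (f : C -> pt) (z : C) : Prop :=
  exists L : pt, forall e : R, 0 < e -> exists r : R, 0 < r /\
    forall h : C, 0 < cabs h < r -> vnorm (h^-1 *: (f (z + h) - f z) - L) < e.

Definition holo_disc (O : set pt) (f : C -> pt) : Prop :=
  forall z, unit_disc z -> O (f z) /\ cdiff_at f z.

(* Poincare distance from 0 to t in the unit disc *)
Definition poincare0 (t : C) : R := 2^-1 * ln ((1 + cabs t) / (1 - cabs t)).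

Definition kob (O : set pt) (x y : pt) : R :=
  inf [set s : R | exists (n : nat) (p : nat -> pt) (t : nat -> C) (f : nat -> C -> pt),
    p 0%N = x /\ p n = y /\
    (forall i, (i < n)%N -> holo_disc O (f i) /\ unit_disc (t i) /\
                 f i 0 = p i /\ f i (t i) = p i.+1) /\
    s = \sum_(i < n) poincare0 (t i)].

Definition gromov_prod (O : set pt) (w x y : pt) : R :=
  2^-1 * (kob O x w + kob O y w - kob O x y).

Definition gromov_hyperbolic (O : set pt) : Prop :=
  exists delta : R, 0 <= delta /\ forall x y z w, O x -> O y -> O z -> O w ->
    Num.min (gromov_prod O w x y) (gromov_prod O w y z) - delta <= gromov_prod O w x z.

(* limits at +-oo in the one-point compactification; None stands for oo *)
Definition lim_pinfty (s : R -> pt) (l : option pt) : Prop :=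
  match l with
  | Some x => forall e : R, 0 < e -> exists T : R, forall t, T <= t -> vnorm (s t - x) < e
  | None => forall M : R, exists T : R, forall t, T <= t -> M < vnorm (s t)
  end.
Definition lim_minfty (s : R -> pt) (l : option pt) : Prop :=
  lim_pinfty (fun t => s (- t)) l.

Definition geodesic (O : set pt) (s : R -> pt) : Prop :=
  (forall t, O (s t)) /\ forall a b, kob O (s a) (s b) = `|a - b|.

Definition well_behaved (s : R -> pt) : Prop :=
  exists lm lp : option pt, lim_minfty s lm /\ lim_pinfty s lp /\ lm <> lp.

Definition aff (M : 'M[C]_d) (b : pt) (z : pt) : pt := z *m M + b.

End Defs.

(* Main.v *)
(* The Kobayashi distance is a length distance, so any two points are joined by
   a path which is geodesic up to a given error, and it suffices to show that
   triangles of such paths are uniformly slim. Otherwise there are triangles of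
   errors tending to 0 with a point u_n of one side at distance at least n from
   the other two sides. Rescaling by the affine maps given for (u_n) and taking
   limits along an ultrafilter (no subsequence is ever extracted), the side
   through u_n converges to a geodesic of the limit domain.
   Comparison with supporting half-planes bounds the Euclidean length of a unit
   step at p by the distance to the boundary along its complex direction, hence
   by a power of the distance to the boundary; the latter decays exponentially
   in the distance to u_n. So a path far from u_n has small Euclidean diameter
   as long as it stays in a bounded set. Therefore the two ends of the limit
   geodesic are the limits of the vertices of its side, and the two other
   sides, which are far from u_n, force these to agree in the one-point
   compactification, although the geodesic is well behaved.
   Discs are only assumed complex differentiable at each point, so the
   half-plane estimate rests on Goursat's theorem, proved on polar rectangles
   with antiderivatives in place of integrals. *)

Require Import Defs.
From HB Require Import structures.
From mathcomp Require Import all_boot all_order all_algebra.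
From mathcomp Require Import complex.
From mathcomp Require Import all_classical all_reals all_analysis.
From mathcomp Require Import ring lra.
Set Implicit Arguments. Unset Strict Implicit. Unset Printing Implicit Defensive.
Import Order.TTheory GRing.Theory Num.Theory.
Import numFieldNormedType.Exports.
Local Open Scope ring_scope.
Local Open Scope classical_set_scope.
Local Open Scope complex_scope.

(** * Moduli and Euclidean norms *)

(** Geodesics of the given domain are never constructed. Almost-geodesic sides suffice because their
    errors tend to 0: the limit of a side is then an exact geodesic, to which the hypothesis
    applies. The ultrafilter gives a limit at all times of a side at once, where Arzela-Ascoli would
    need a diagonal extraction. That the limit exists and is isometric rests on two facts: Kobayashi
    balls of fixed radius about the base points stay bounded and away from the boundary uniformly in
    n, and discs shrunk by a factor near 1 stay in such balls, so that nearby domains have nearby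
    distances. Behind the first fact is a single lower bound for [kob]: the real part of a complex
    affine form that is positive on the domain changes at most by a factor exp(2s) along a chain of
    length s. Displacements are summed over unit steps, without speeds or arc length. The obstacle
    there is that m-convexity is uniform only on bounded sets: a step may be estimated only where
    the path is already known to be bounded, and the sum of the previous estimates has to guarantee
    this. *)

Section ComplexModulus.
Context {R : realType}.
Local Notation C := (R[i]).
Implicit Types (x y z : C) (a b : R).

Lemma cabsE z : `|z| = (cabs z)%:C.
Proof. by rewrite normc_def; case: z. Qed.

Lemma cabs_ge0 z : 0 <= cabs z.
Proof. by case: z => a b; exact: sqrtr_ge0. Qed.

Lemma cabs_sq z : cabs z ^+ 2 = complex.Re z ^+ 2 + complex.Im z ^+ 2.
Proof. by case: z => a b; rewrite sqr_sqrtr// addr_ge0// sqr_ge0. Qed.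

Lemma cabs0 : cabs (0 : C) = 0.
Proof. by apply: (@complexI R); rewrite -cabsE normr0. Qed.

Lemma cabs_eq0 z : (cabs z == 0) = (z == 0).
Proof. by rewrite -(inj_eq (@complexI R)) -cabsE normr_eq0. Qed.

Lemma cabs_gt0 z : (0 < cabs z) = (z != 0).
Proof. by rewrite lt_def cabs_ge0 andbT cabs_eq0. Qed.

Lemma cabsM x y : cabs (x * y) = cabs x * cabs y.
Proof. by apply: (@complexI R); rewrite rmorphM -!cabsE normrM. Qed.

Lemma cabsV x : cabs x^-1 = (cabs x)^-1.
Proof. by apply: (@complexI R); rewrite fmorphV -!cabsE normfV. Qed.

Lemma cabsN x : cabs (- x) = cabs x.
Proof. by apply: (@complexI R); rewrite -!cabsE normrN. Qed.

Lemma cabsD x y : cabs (x + y) <= cabs x + cabs y.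
Proof. by rewrite -lecR rmorphD -!cabsE ler_normD. Qed.

Lemma cabsB x y : cabs (x - y) <= cabs x + cabs y.
Proof. by rewrite (le_trans (cabsD _ _))// cabsN. Qed.

Lemma cabs_distC x y : cabs (x - y) = cabs (y - x).
Proof. by rewrite -cabsN opprB. Qed.

Lemma cabs_real a : cabs a%:C = `|a|.
Proof. by rewrite /= expr0n addr0 sqrtr_sqr. Qed.

Lemma cabs1 : cabs (1 : C) = 1.
Proof. by rewrite (cabs_real 1) normr1. Qed.

Lemma cabs_conj z : cabs (conjc z) = cabs z.
Proof. by case: z => a b /=; rewrite sqrrN. Qed.

Lemma mul_conj z : z * conjc z = (cabs z ^+ 2)%:C.
Proof.
case: z => a b; rewrite cabs_sq /=; apply/eqP; rewrite eq_complex /=.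
by apply/andP; split; apply/eqP; ring.
Qed.

Lemma cReD x y : complex.Re (x + y) = complex.Re x + complex.Re y.
Proof. by case: x; case: y. Qed.

Lemma cReN x : complex.Re (- x) = - complex.Re x.
Proof. by case: x. Qed.

Lemma cReMr a x : complex.Re (a%:C * x) = a * complex.Re x.
Proof. by case: x => u v /=; rewrite mul0r subr0. Qed.

Lemma cReMl a x : complex.Re (x * a%:C) = complex.Re x * a.
Proof. by case: x => u v /=; rewrite mulr0 subr0. Qed.

Lemma cImMl a x : complex.Im (x * a%:C) = complex.Im x * a.
Proof. by case: x => u v /=; rewrite mulr0 add0r. Qed.

Lemma cImD x y : complex.Im (x + y) = complex.Im x + complex.Im y.
Proof. by case: x; case: y. Qed.

Lemma cImN x : complex.Im (- x) = - complex.Im x.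
Proof. by case: x. Qed.

Lemma cImMr a x : complex.Im (a%:C * x) = a * complex.Im x.
Proof. by case: x => u v /=; rewrite mul0r addr0. Qed.

Lemma Re_le_cabs z : `|complex.Re z| <= cabs z.
Proof.
by rewrite -ler_sqr ?nnegrE ?cabs_ge0// cabs_sq real_normK ?num_real// lerDl sqr_ge0.
Qed.

Lemma Im_le_cabs z : `|complex.Im z| <= cabs z.
Proof.
by rewrite -ler_sqr ?nnegrE ?cabs_ge0// cabs_sq real_normK ?num_real// lerDr sqr_ge0.
Qed.

Lemma cabs_le_ReIm z : cabs z <= `|complex.Re z| + `|complex.Im z|.
Proof.
rewrite -ler_sqr ?nnegrE ?cabs_ge0 ?addr_ge0// cabs_sq.
rewrite -(real_normK (num_real (complex.Re z))) -(real_normK (num_real (complex.Im z))).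
have := normr_ge0 (complex.Re z); have := normr_ge0 (complex.Im z); nra.
Qed.

(** Reduces a bound on a modulus to one on a real part, so that real mean value arguments reach
    complex-valued curves. *)
Lemma rotate_pos z : exists2 e : C, cabs e = 1 & complex.Re (e * z) = cabs z.
Proof.
have [->|z0] := eqVneq z 0.
  by exists 1; rewrite ?cabs1// mulr0 cabs0.
have cz : cabs z != 0 by rewrite cabs_eq0.
exists ((cabs z)^-1%:C * conjc z).
  by rewrite cabsM cabs_real cabs_conj ger0_norm ?invr_ge0 ?cabs_ge0// mulVf.
by rewrite -mulrA (mulrC _ z) mul_conj cReMr /= expr2 mulKf.
Qed.

End ComplexModulus.

Section VectorNorm.
Context {R : realType} {d : nat}.
Local Notation C := (R[i]).
Local Notation pt := 'rV[C]_d.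
Implicit Types (x y z : pt) (a : R).

(** The Euclidean inner product of the underlying real space of dimension 2d, that is, the real part
    of the Hermitian product: nearest points of convex sets yield real hyperplanes. *)
Definition rdot x y : R :=
  \sum_(i < d) (complex.Re (x 0 i) * complex.Re (y 0 i) +
                complex.Im (x 0 i) * complex.Im (y 0 i)).

Lemma rdotC x y : rdot x y = rdot y x.
Proof. by apply: eq_bigr => i _; rewrite mulrC [X in _ + X]mulrC. Qed.

Lemma rdotDl x y z : rdot (x + y) z = rdot x z + rdot y z.
Proof.
rewrite -big_split; apply: eq_bigr => i _.
by rewrite !mxE cReD cImD !mulrDl addrACA.
Qed.

Lemma rdotZl a x y : rdot (a%:C *: x) y = a * rdot x y.
Proof.
rewrite mulr_sumr; apply: eq_bigr => i _.
by rewrite !mxE cReMr cImMr mulrDr !mulrA.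
Qed.

Lemma scaleN1 x : - x = (-1)%:C *: x.
Proof. by rewrite rmorphN1 scaleN1r. Qed.

Lemma rdotNl x y : rdot (- x) y = - rdot x y.
Proof. by rewrite scaleN1 rdotZl mulN1r. Qed.

Lemma rdotDr x y z : rdot x (y + z) = rdot x y + rdot x z.
Proof. by rewrite rdotC rdotDl !(rdotC x). Qed.

Lemma rdotNr x y : rdot x (- y) = - rdot x y.
Proof. by rewrite rdotC rdotNl rdotC. Qed.

Lemma rdotZr a x y : rdot x (a%:C *: y) = a * rdot x y.
Proof. by rewrite rdotC rdotZl rdotC. Qed.

Lemma rdot_ge0 x : 0 <= rdot x x.
Proof. by apply: sumr_ge0 => i _; rewrite addr_ge0// -expr2 sqr_ge0. Qed.

Lemma vnormE x : vnorm x = Num.sqrt (rdot x x).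
Proof. by congr Num.sqrt; apply: eq_bigr => i _; rewrite cabs_sq !expr2. Qed.

Lemma vnorm_ge0 x : 0 <= vnorm x.
Proof. exact: sqrtr_ge0. Qed.

Lemma vnorm_sq x : vnorm x ^+ 2 = rdot x x.
Proof. by rewrite vnormE sqr_sqrtr// rdot_ge0. Qed.

Lemma coord_le_vnorm x i : cabs (x 0 i) <= vnorm x.
Proof.
rewrite -ler_sqr ?nnegrE ?cabs_ge0 ?vnorm_ge0// /vnorm sqr_sqrtr; last first.
  by apply: sumr_ge0 => j _; rewrite sqr_ge0.
by rewrite (bigD1 i)//= lerDl; apply: sumr_ge0 => j _; rewrite sqr_ge0.
Qed.

Lemma vnorm_eq0 x : (vnorm x == 0) = (x == 0).
Proof.
apply/eqP/eqP => [x0|->].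
  apply/rowP => i; rewrite mxE; apply/eqP; rewrite -cabs_eq0 eq_le cabs_ge0 andbT.
  by rewrite -x0 coord_le_vnorm.
by apply/eqP; rewrite -sqrf_eq0 vnorm_sq; apply/eqP/big1 => i _; rewrite mxE /= mul0r addr0.
Qed.

Lemma vnorm0 : vnorm (0 : pt) = 0.
Proof. by apply/eqP; rewrite vnorm_eq0. Qed.

Lemma vnorm_gt0 x : (0 < vnorm x) = (x != 0).
Proof. by rewrite lt_def vnorm_ge0 andbT vnorm_eq0. Qed.

Lemma vnormZ (l : C) x : vnorm (l *: x) = cabs l * vnorm x.
Proof.
apply: (@pexpIrn _ 2) => //; rewrite ?nnegrE ?mulr_ge0 ?cabs_ge0 ?vnorm_ge0//.
rewrite exprMn /vnorm !sqr_sqrtr; try by apply: sumr_ge0 => j _; rewrite sqr_ge0.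
by rewrite mulr_sumr; apply: eq_bigr => i _; rewrite mxE cabsM exprMn.
Qed.

Lemma vnormZr a x : vnorm (a%:C *: x) = `|a| * vnorm x.
Proof. by rewrite vnormZ cabs_real. Qed.

Lemma vnormN x : vnorm (- x) = vnorm x.
Proof. by rewrite scaleN1 vnormZr normrN1 mul1r. Qed.

Lemma rdot_le x y : rdot x y <= vnorm x * vnorm y.
Proof.
have [y0|y0] := eqVneq y 0.
  rewrite y0 vnorm0 mulr0 -[0](scale0r (0 : pt)) -(rmorph0 (real_complex R)).
  by rewrite rdotZr mul0r.
have ny : 0 < vnorm y by rewrite vnorm_gt0.
have := rdot_ge0 ((vnorm y)%:C *: x - (vnorm x)%:C *: y).
rewrite !(rdotDl, rdotDr, rdotNl, rdotNr, rdotZl, rdotZr) (rdotC y x) -!vnorm_sq.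
have [x0|nx] := leP (vnorm x) 0.
  have -> : vnorm x = 0 by apply/eqP; rewrite eq_le x0 vnorm_ge0.
  move=> _; have /eqP : vnorm x = 0 by apply/eqP; rewrite eq_le x0 vnorm_ge0.
  rewrite vnorm_eq0 => /eqP ->; rewrite mul0r -[0](scale0r (0 : pt)) -(rmorph0 (real_complex R)).
  by rewrite rdotZl mul0r.
set a := vnorm x; set b := vnorm y; set r := rdot x y => H.
have ab : 0 < a * b by rewrite mulr_gt0.
rewrite -(ler_pM2l ab); nra.
Qed.

Lemma vnormD x y : vnorm (x + y) <= vnorm x + vnorm y.
Proof.
rewrite -ler_sqr ?nnegrE ?addr_ge0 ?vnorm_ge0// vnorm_sq rdotDl !rdotDr -!vnorm_sq.
rewrite (rdotC y x); have := rdot_le x y; nra.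
Qed.

Lemma vnormB x y : vnorm (x - y) <= vnorm x + vnorm y.
Proof. by rewrite (le_trans (vnormD _ _))// vnormN. Qed.

Lemma vdistC x y : vnorm (x - y) = vnorm (y - x).
Proof. by rewrite -vnormN opprB. Qed.

Lemma vdistD z x y : vnorm (x - y) <= vnorm (x - z) + vnorm (z - y).
Proof. by rewrite -[x - y](subrKA z) vnormD. Qed.

(** The factor is cruder than the square root of d but stays positive for d = 0, so that it can be
    divided by. *)
Lemma vnorm_le_coord x a : 0 <= a ->
  (forall i, cabs (x 0 i) <= a) -> vnorm x <= d.+1%:R * a.
Proof.
move=> a0 xa; rewrite -ler_sqr ?nnegrE ?vnorm_ge0 ?mulr_ge0 ?ler0n//.
rewrite /vnorm sqr_sqrtr; last by apply: sumr_ge0 => j _; rewrite sqr_ge0.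
apply: (@le_trans _ _ (\sum_(i < d) a ^+ 2)).
  by apply: ler_sum => i _; rewrite ler_sqr ?nnegrE ?cabs_ge0.
rewrite sumr_const card_ord exprMn -[leLHS]mulr_natl ler_wpM2r ?sqr_ge0//.
by rewrite -natrX ler_nat expnS expn1 (leq_trans (leqnSn _))// leq_pmulr.
Qed.

End VectorNorm.
(** * Pointwise derivatives *)

Section Derivative.
Context {R : realType}.
Local Notation C := (R[i]).

(* Derivatives along [iota : K -> C]: complex ones for [iota = id], those of
   curves for [iota] the inclusion of the reals. *)
Definition der (K : zmodType) (iota : K -> C) (f : K -> C) (x : K) (L : C) :=
  forall e : R, 0 < e -> exists2 r : R, 0 < r &
    forall h, cabs (iota h) < r ->
      cabs (f (x + h) - f x - L * iota h) <= e * cabs (iota h).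

Definition cder := @der C id.
Definition rder := @der R (real_complex R).

Section Rules.
Context {K : zmodType} {iota : K -> C}.
Implicit Types (f g : K -> C) (x : K) (L M : C).
Local Notation der := (@der K iota).

Lemma der_affine f x L : (forall h, f (x + h) = f x + L * iota h) -> der f x L.
Proof.
move=> fE e e0; exists 1 => // h _.
by rewrite fE (addrC (f x)) addrK subrr cabs0 mulr_ge0 ?cabs_ge0// ltW.
Qed.

Lemma der_cst (c : C) x : der (fun=> c) x 0.
Proof. by apply: der_affine => h; rewrite mul0r addr0. Qed.

Lemma der_incr f x L : der f x L -> exists2 r : R, 0 < r &
  forall h, cabs (iota h) < r -> cabs (f (x + h) - f x) <= (cabs L + 1) * cabs (iota h).
Proof.
move=> /(_ 1 ltr01)[r r0 H]; exists r => // h /H.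
rewrite mul1r mulrDl mul1r -cabsM => Hh.
rewrite -[f _ - _](subrK (L * iota h)) (le_trans (cabsD _ _))//.
by rewrite addrC lerD2l.
Qed.

Lemma derD f g x L M : der f x L -> der g x M -> der (fun y => f y + g y) x (L + M).
Proof.
move=> df dg e e0; have e2 : 0 < e / 2 by rewrite divr_gt0.
have [r r0 fr] := df _ e2; have [s s0 gs] := dg _ e2.
exists (Num.min r s) => [|h]; first by rewrite lt_min r0.
rewrite lt_min => /andP[/fr hf /gs hg].
have -> : f (x + h) + g (x + h) - (f x + g x) - (L + M) * iota h =
  (f (x + h) - f x - L * iota h) + (g (x + h) - g x - M * iota h) by ring.
by rewrite (le_trans (cabsD _ _))// (le_trans (lerD hf hg))// -mulrDl -splitr.
Qed.

Lemma derM f g x L M :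
  der f x L -> der g x M -> der (fun y => f y * g y) x (L * g x + f x * M).
Proof.
move=> df dg e e0.
set A := (cabs L + 1) * (cabs M + 1); set B := cabs (f x) + cabs (g x) + 1.
have A0 : 0 < A by rewrite mulr_gt0// ltr_wpDl ?cabs_ge0.
have B0 : 0 < B by rewrite ltr_wpDl ?addr_ge0 ?cabs_ge0.
have eB : 0 < e / 2 / B by rewrite !divr_gt0.
have [r1 r10 f1] := der_incr df; have [s1 s10 g1] := der_incr dg.
have [r r0 fr] := df _ eB; have [s s0 gs] := dg _ eB.
exists (Num.min (Num.min r s) (Num.min (Num.min r1 s1) (e / 2 / A))) => [|h].
  by rewrite !lt_min r0 s0 r10 s10 !divr_gt0.
rewrite !lt_min => /andP[/andP[/fr hf /gs hg]] /andP[/andP[/f1 kf /g1 kg] hA].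
have -> : f (x + h) * g (x + h) - f x * g x - (L * g x + f x * M) * iota h =
  (f (x + h) - f x) * (g (x + h) - g x) +
  (g x * (f (x + h) - f x - L * iota h) + f x * (g (x + h) - g x - M * iota h)).
  by ring.
set k := cabs (iota h) in hf hg kf kg hA *.
have k0 : 0 <= k by rewrite cabs_ge0.
have h1 : cabs ((f (x + h) - f x) * (g (x + h) - g x)) <= e / 2 * k.
  rewrite cabsM (le_trans (ler_pM (cabs_ge0 _) (cabs_ge0 _) kf kg))//.
  have -> : (cabs L + 1) * k * ((cabs M + 1) * k) = (A * k) * k by rewrite /A; ring.
  by rewrite ler_wpM2r// mulrC -ler_pdivlMr// ltW.
have h2 : cabs (g x * (f (x + h) - f x - L * iota h) +
   f x * (g (x + h) - g x - M * iota h)) <= e / 2 * k.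
  rewrite (le_trans (cabsD _ _))// !cabsM.
  apply: (@le_trans _ _ ((cabs (g x) + cabs (f x)) * (e / 2 / B * k))).
    by rewrite mulrDl lerD// ler_wpM2l// cabs_ge0.
  rewrite mulrA ler_wpM2r// mulrC -ler_pdivlMl ?divr_gt0// invf_div invf_div.
  have -> : B * (2 / e) * (e / 2) = B by field; rewrite lt0r_neq0.
  by rewrite /B; lra.
by rewrite (le_trans (cabsD _ _))// (le_trans (lerD h1 h2))// -mulrDl -splitr.
Qed.

Lemma der_comp f x L (g : C -> C) M :
  der f x L -> cder g (f x) M -> der (g \o f) x (M * L).
Proof.
move=> df dg e e0.
set A := cabs L + 1; set B := cabs M + 1.
have A0 : 0 < A by rewrite ltr_wpDl ?cabs_ge0.
have B0 : 0 < B by rewrite ltr_wpDl ?cabs_ge0.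
have eA : 0 < e / 2 / A by rewrite !divr_gt0.
have eB : 0 < e / 2 / B by rewrite !divr_gt0.
have [r1 r10 f1] := der_incr df.
have [r r0 fr] := df _ eB; have [s s0 gs] := dg _ eA.
exists (Num.min r (Num.min r1 (s / A))) => [|h].
  by rewrite !lt_min r0 r10 divr_gt0.
rewrite !lt_min => /and3P[/fr hf /f1 kf hA].
set k := cabs (iota h) in hf kf hA *.
have k0 : 0 <= k by rewrite cabs_ge0.
have /gs /= hg : cabs (f (x + h) - f x) < s.
  by rewrite (le_lt_trans kf)// mulrC -ltr_pdivlMr.
have E : f x + (f (x + h) - f x) = f (x + h) by ring.
rewrite E in hg.
rewrite /comp.
have -> : g (f (x + h)) - g (f x) - M * L * iota h =
   (g (f (x + h)) - g (f x) - M * (f (x + h) - f x)) +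
   M * (f (x + h) - f x - L * iota h) by ring.
rewrite (le_trans (cabsD _ _))// cabsM [leRHS](_ : _ = e / 2 * k + e / 2 * k); last by field.
apply: lerD.
  rewrite (le_trans hg)// (le_trans (ler_wpM2l (ltW eA) kf))//.
  by rewrite mulrA divfK ?lt0r_neq0.
rewrite (le_trans (ler_wpM2l (cabs_ge0 _) hf))// mulrA ler_wpM2r//.
by rewrite mulrA ler_pdivrMr// mulrC ler_wpM2l ?ltW ?divr_gt0// ltrDl.
Qed.

End Rules.

Lemma cder_id z : cder id z 1.
Proof. by apply: der_affine => h; rewrite mul1r. Qed.

Lemma cderV z : z != 0 -> cder (fun w => w^-1) z (- z^-2).
Proof.
move=> z0 e e0; set k := cabs z; have k0 : 0 < k by rewrite cabs_gt0.
exists (Num.min (k / 2) (e * k ^+ 3 / 2)) => [|h].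
  by rewrite lt_min !divr_gt0// mulr_gt0// exprn_gt0.
rewrite lt_min => /andP[h1 h2].
have zh : k / 2 <= cabs (z + h).
  have := cabsB (z + h) h; rewrite addrK -/k; move: h1; lra.
have zh0 : z + h != 0 by rewrite -cabs_gt0 (lt_le_trans _ zh)// divr_gt0.
have -> : (z + h)^-1 - z^-1 - - z^-2 * h = h ^+ 2 * ((z + h)^-1 * z^-1 * z^-1).
  by field; rewrite zh0 z0.
have zhV : (cabs (z + h))^-1 <= 2 / k.
  by rewrite -[2 / k]invf_div lef_pV2 ?posrE// ?cabs_gt0// divr_gt0.
rewrite !cabsM !cabsV -/k -expr2.
have -> : cabs h ^+ 2 * ((cabs (z + h))^-1 / k / k) =
  cabs h * (cabs h * ((cabs (z + h))^-1 / k / k)) by ring.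
rewrite mulrC ler_wpM2r ?cabs_ge0//.
have h0 := cabs_ge0 h; have kV : 0 <= k^-1 by rewrite invr_ge0 ltW.
rewrite (le_trans (ler_pM h0 _ (ltW h2) (ler_wpM2r kV (ler_wpM2r kV zhV))))//.
  by rewrite !mulr_ge0// invr_ge0 cabs_ge0.
by rewrite [leLHS](_ : _ = e)//; field; rewrite lt0r_neq0.
Qed.

(** Translates the difference quotient on a punctured neighbourhood into the product form of [der],
    which gives access to the mean value theorem and the fundamental theorem of calculus. *)
Lemma is_derive_epsP (f : R -> R) (x l : R) : is_derive x 1 f l <->
  forall e : R, 0 < e -> exists2 r : R, 0 < r &
    forall h, `|h| < r -> `|f (x + h) - f x - l * h| <= e * `|h|.
Proof.
split=> [df e e0|H].
  have : (fun h : R => h^-1 *: ((f \o shift x) (h *: 1) - f x)) @ 0^' --> l.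
    by have := @ex_derive _ _ _ _ _ _ _ df; rewrite /derivable -(@derive_val _ _ _ _ _ _ _ df).
  move=> /cvgrPdist_le/(_ _ e0); rewrite /= near_withinE => /nbhs_ballP[r /= r0 hr].
  exists r => // h; have [->|h0] := eqVneq h 0.
    by rewrite addr0 subrr mulr0 subr0 normr0 mulr0.
  move=> hlt; have := hr h; rewrite /ball /= sub0r normrN => /(_ hlt h0).
  rewrite -[l - _]opprB normrN (_ : h *: 1 = h :> R); last by rewrite /GRing.scale /= mulr1.
  rewrite /shift /GRing.scale /= (addrC h) => H.
  have -> : f (x + h) - f x - l * h = h * (h^-1 * (f (x + h) - f x) - l) by field.
  by rewrite normrM mulrC ler_wpM2r.
have cv : (fun h : R => h^-1 *: ((f \o shift x) (h *: 1) - f x)) @ 0^' --> l.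
  apply/cvgrPdist_le => e /H[r r0 hr]; rewrite /= near_withinE.
  apply/nbhs_ballP; exists r => // h; rewrite /ball /= sub0r normrN => /hr H1 h0.
  rewrite -[l - _]opprB normrN (_ : h *: 1 = h :> R); last by rewrite /GRing.scale /= mulr1.
  rewrite /shift /GRing.scale /= (addrC h).
  have nh : 0 < `|h| by rewrite normr_gt0.
  rewrite -(ler_pM2r nh) -normrM; apply: le_trans H1.
  by rewrite [leLHS](_ : _ = `|f (x + h) - f x - l * h|)//; congr `|_|; field.
by split; [apply/cvg_ex; exists l|apply/cvg_lim].
Qed.

Implicit Types (g P : R -> C) (a b x k : R).

Lemma rder_Re g x L : rder g x L -> is_derive x 1 (fun y => complex.Re (g y)) (complex.Re L).
Proof.
move=> dg; apply/is_derive_epsP => e /dg[r r0 H]; exists r => // h hr.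
have := H h; rewrite cabs_real => /(_ hr); apply: le_trans.
have := Re_le_cabs (g (x + h) - g x - L * h%:C); by rewrite !cReD !cReN cReMl.
Qed.

Lemma rder_Im g x L : rder g x L -> is_derive x 1 (fun y => complex.Im (g y)) (complex.Im L).
Proof.
move=> dg; apply/is_derive_epsP => e /dg[r r0 H]; exists r => // h hr.
have := H h; rewrite cabs_real => /(_ hr); apply: le_trans.
have := Im_le_cabs (g (x + h) - g x - L * h%:C); by rewrite !cImD !cImN cImMl.
Qed.

Lemma is_derive_rder (u v : R -> R) x (l m : R) :
  is_derive x 1 u l -> is_derive x 1 v m -> rder (fun y => u y +i* v y) x (l +i* m).
Proof.
move=> /is_derive_epsP du /is_derive_epsP dv e e0.
have e2 : 0 < e / 2 by rewrite divr_gt0.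
have [r r0 ur] := du _ e2; have [s s0 vs] := dv _ e2.
exists (Num.min r s) => [|h]; first by rewrite lt_min r0.
rewrite cabs_real lt_min => /andP[/ur hu /vs hv].
rewrite (le_trans (cabs_le_ReIm _))//=.
rewrite !mulr0 subr0 add0r [e]splitr mulrDl lerD//.
Qed.

Lemma rderZ g x L (c : C) : rder g x L -> rder (fun y => c * g y) x (c * L).
Proof.
by move=> dg; have := derM (der_cst c x) dg; rewrite mul0r add0r.
Qed.

Lemma is_derive_mvt (u v : R -> R) a b : a <= b ->
  (forall x, a <= x <= b -> is_derive x 1 u (v x)) ->
  exists2 c, a <= c <= b & u b - u a = v c * (b - a).
Proof.
move=> ab du; have [||c] := @MVT_segment R u v a b ab.
- by move=> x; rewrite in_itv /= => /andP[/ltW ax /ltW xb]; apply: du; rewrite ax.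
- apply: continuous_in_subspaceT => x; rewrite inE /= in_itv /= => xab.
  by apply: differentiable_continuous; apply/derivable1_diffP; have [] := du x xab.
by rewrite in_itv /=; exists c.
Qed.

(** With e rotating g b - g a onto the positive axis, k - Re (e * g) has a nonnegative
    derivative. *)
Lemma rder_mvt_gen g (D : R -> C) (k k' : R -> R) a b : a <= b ->
  (forall x, a <= x <= b -> rder g x (D x)) ->
  (forall x, a <= x <= b -> is_derive x 1 k (k' x)) ->
  (forall x, a <= x <= b -> cabs (D x) <= k' x) -> cabs (g b - g a) <= k b - k a.
Proof.
move=> ab dg dk Dk.
have [e e1 <-] := rotate_pos (g b - g a).
pose u x := k x - complex.Re (e * g x).
have [x xab|c cab] := @is_derive_mvt u (fun x => k' x - complex.Re (e * D x)) a b ab.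
  exact: is_deriveB (dk x xab) (rder_Re (rderZ e (dg x xab))).
move=> E; rewrite mulrBr cReD cReN; rewrite /u in E.
suff : 0 <= (k' c - complex.Re (e * D c)) * (b - a) by rewrite -E; lra.
rewrite mulr_ge0 ?subr_ge0// (le_trans _ (Dk _ cab))// (le_trans (ler_norm _))//.
by rewrite (le_trans (Re_le_cabs _))// cabsM e1 mul1r.
Qed.

Lemma rder_mvt g (D : R -> C) a b k : a <= b ->
  (forall x, a <= x <= b -> rder g x (D x)) ->
  (forall x, a <= x <= b -> cabs (D x) <= k) -> cabs (g b - g a) <= k * (b - a).
Proof.
move=> ab dg Dk; rewrite mulrBr.
apply: (@rder_mvt_gen g D (fun x => k * x) (fun=> k)) => // x _.
apply/is_derive_epsP => e e0; exists 1 => // h _.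
by rewrite [X in `|X|](_ : _ = 0) ?normr0 ?mulr_ge0// ?(ltW e0)//; ring.
Qed.

Lemma antiderivative (f : R -> R) al a b be : al < a -> a <= b -> b < be ->
  (forall x, al < x < be -> {for x, continuous f}) ->
  exists F : R -> R, forall x, a <= x <= b -> is_derive x 1 F (f x).
Proof.
move=> ala ab bbe fc.
(* The integral starts strictly before a and the integrand is integrable strictly beyond b, so every
   point of [a, b] is interior and the derivative there is two-sided. *)
pose a1 := (al + a) / 2; pose u := (b + be) / 2.
exists (fun x => \int[lebesgue_measure]_(t in [set` `[a1, x]]) f t)%R => x /andP[ax xb].
have fi : lebesgue_measure.-integrable `[a1, u] (EFin \o f).
  apply: continuous_compact_integrable; first exact: segment_compact.
  apply: continuous_in_subspaceT => y; rewrite inE /= in_itv /= => /andP[h1 h2].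
  apply: fc; rewrite /a1 /u in h1 h2; lra.
have xu : x < u by rewrite /u; lra.
have a1x : a1 < x by rewrite /a1; lra.
have [|h1 h2] := continuous_FTC1_closed xu fi a1x.
  by apply: fc; rewrite (lt_le_trans ala ax) (le_lt_trans xb bbe).
by apply: DeriveDef; [exact: h1|rewrite -derive1E].
Qed.

Lemma rder_antiderivative g al a b be : al < a -> a <= b -> b < be ->
  (forall x, al < x < be -> exists L, rder g x L) ->
  exists P, forall x, a <= x <= b -> rder P x (g x).
Proof.
move=> ala ab bbe dg.
have cont (u l : R -> R) (x : R) : is_derive x 1 u (l x) -> {for x, continuous u}.
  by move=> [du _]; apply: differentiable_continuous; apply/derivable1_diffP.
have [|u du] := @antiderivative (fun y => complex.Re (g y)) _ _ _ _ ala ab bbe.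
  by move=> x /dg[L /rder_Re dx]; exact: (cont _ (fun=> complex.Re L)).
have [|v dv] := @antiderivative (fun y => complex.Im (g y)) _ _ _ _ ala ab bbe.
  by move=> x /dg[L /rder_Im dx]; exact: (cont _ (fun=> complex.Im L)).
exists (fun y => u y +i* v y) => x xab; have := is_derive_rder (du _ xab) (dv _ xab).
by case: (g x).
Qed.

End Derivative.
(** * Goursat's theorem on polar rectangles *)

Section Goursat.
Context {R : realType}.
Local Notation C := (R[i]).
Implicit Types (r s t u : R) (z : C).

Definition cis t : C := cos t +i* sin t.
Definition polar r t : C := r%:C * cis t.

Lemma cabs_cis t : cabs (cis t) = 1.
Proof. by rewrite /= cos2Dsin2 sqrtr1. Qed.

Lemma cabs_polar r t : cabs (polar r t) = `|r|.
Proof. by rewrite cabsM cabs_real cabs_cis mulr1. Qed.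

Lemma cis2pi : cis (2 * pi) = cis 0.
Proof. by rewrite /cis mulr_natl cos2pi sin2pi cos0 sin0. Qed.

Lemma rder_cis t : rder cis t ('i * cis t).
Proof.
have := is_derive_rder (is_derive_cos t) (is_derive_sin t).
by rewrite (_ : - sin t +i* cos t = 'i * cis t)// /cis; simpc.
Qed.

Lemma rder_polar_arg r t : rder (polar r) t ('i * polar r t).
Proof. by rewrite /polar mulrCA; apply: rderZ; exact: rder_cis. Qed.

Lemma rder_polar_mod r t : rder (polar^~ t) r (cis t).
Proof. by apply: der_affine => h; rewrite /polar rmorphD mulrDl (mulrC (cis t)). Qed.

Lemma polar_dist r s t u : cabs (polar r t - polar s u) <= `|r - s| + `|s| * `|t - u|.
Proof.
have cis_lip t' u' : cabs (cis t' - cis u') <= `|t' - u'|.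
  wlog tu : t' u' / u' <= t'.
    by move=> H; have [/H//|/ltW /H] := leP u' t'; rewrite cabs_distC distrC.
  rewrite ger0_norm ?subr_ge0// -[leRHS]mul1r.
  apply: (rder_mvt tu (D := fun x => 'i * cis x)) => x _; first exact: rder_cis.
  by rewrite cabsM cabs_cis mulr1 /= expr0n expr1n add0r sqrtr1.
have -> : polar r t - polar s u = (r%:C - s%:C) * cis t + s%:C * (cis t - cis u).
  by rewrite /polar; ring.
rewrite (le_trans (cabsD _ _))// !cabsM cabs_cis mulr1 cabs_real -rmorphB cabs_real.
by rewrite lerD2l ler_wpM2l.
Qed.

Lemma nested_point (x w : nat -> R) : (forall n, x n <= x n.+1) -> (forall n, 0 <= w n) ->
  (forall n, x n.+1 + w n.+1 <= x n + w n) ->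
  exists c, forall n, x n <= c <= x n + w n.
Proof.
move=> xi w0 xw.
have xle n k : x n <= x (n + k)%N.
  by elim: k => [|k ih]; rewrite ?addn0// addnS (le_trans ih).
have wle n k : x (n + k)%N + w (n + k)%N <= x n + w n.
  by elim: k => [|k ih]; rewrite ?addn0// addnS (le_trans (xw _)).
have xub n m : x m <= x n + w n.
  rewrite (le_trans (xle m n))// addnC (le_trans _ (wle n m))// lerDl//.
have hs : has_sup (range x).
  by split; [exists (x 0%N); exists 0%N|exists (x 0%N + w 0%N) => _ [m _ <-]].
exists (sup (range x)) => n; apply/andP; split.
  by apply: (ub_le_sup hs.2); exists n.
by apply: ge_sup; [exact: hs.1|move=> _ [m _ <-]].
Qed.

(** The integral of g dz around a polar rectangle, when [H t] is an antiderivative of g along the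
    ray of angle t and [V r] one along the circle of radius r. Additivity under subdivision becomes
    a ring identity. *)
Definition loop (H V : R -> R -> C) r r' t t' : C :=
  (H t r' - H t r) + (V r' t' - V r' t) - (H t' r' - H t' r) - (V r t' - V r t).

Lemma loop_small (g : C -> C) (H V : R -> R -> C) r r' t t' z0 L e :
  r <= r' -> t <= t' -> 0 <= e ->
  (forall s u, r <= s <= r' -> t <= u <= t' -> `|s| <= 1 /\
     [/\ rder (H u) s (g (polar s u) * cis u),
         rder (V s) u (g (polar s u) * ('i * polar s u)) &
         cabs (g (polar s u) - g z0 - L * (polar s u - z0)) <= e]) ->
  cabs (loop H V r r' t t') <= 2 * e * ((r' - r) + (t' - t)).
Proof.
move=> rr tt e0 HH.
(* P is an antiderivative of the first order Taylor polynomial of g at z0. Its boundary sum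
   vanishes, so it may be subtracted, leaving integrands of modulus at most e. *)
pose P z := (g z0 - L * z0) * z + (L / 2) * (z * z).
have dP z : cder P z (g z0 + L * (z - z0)).
  have := derD (derM (der_cst (g z0 - L * z0) z) (cder_id z))
    (derM (der_cst (L / 2) z) (derM (cder_id z) (cder_id z))).
  rewrite (_ : 0 * id z + _ + _ = g z0 + L * (z - z0))//.
  by rewrite /=; field.
have c1 (c x : C) : cabs x = 1 -> cabs c <= e -> cabs (c * x) <= e.
  by move=> x1 ce; rewrite cabsM x1 mulr1.
have hH u : t <= u <= t' ->
    cabs ((H u r' - P (polar r' u)) - (H u r - P (polar r u))) <= e * (r' - r).
  move=> ut; apply: (rder_mvt (g := fun s => H u s - P (polar s u)) (D := fun s =>
     (g (polar s u) - g z0 - L * (polar s u - z0)) * cis u) rr) => s sr.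
    have [_ [d1 _ _]] := HH _ _ sr ut.
    have := derD d1 (rderZ (-1) (der_comp (rder_polar_mod s u) (dP (polar s u)))).
    rewrite (_ : (fun y => _ + _) = (fun y => H u y - P (polar y u))); last first.
      by apply/funext => y; rewrite mulN1r.
    by congr rder; ring.
  have [_ [_ _ h]] := HH _ _ sr ut.
  by apply: c1 => //; exact: cabs_cis.
have hV s : r <= s <= r' ->
    cabs ((V s t' - P (polar s t')) - (V s t - P (polar s t))) <= e * (t' - t).
  move=> sr; apply: (rder_mvt (g := fun u => V s u - P (polar s u)) (D := fun u =>
     (g (polar s u) - g z0 - L * (polar s u - z0)) * ('i * polar s u)) tt) => u ut.
    have [_ [_ d1 _]] := HH _ _ sr ut.
    have := derD d1 (rderZ (-1) (der_comp (rder_polar_arg s u) (dP (polar s u)))).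
    rewrite (_ : (fun y => _ + _) = (fun y => V s y - P (polar s y))); last first.
      by apply/funext => y; rewrite mulN1r.
    by congr rder; ring.
  have [s1 [_ _ h]] := HH _ _ sr ut.
  rewrite cabsM (le_trans _ h)// ler_piMr ?cabs_ge0// cabsM cabs_polar.
  by rewrite [cabs 'i](_ : _ = 1) ?mul1r//= expr0n expr1n add0r sqrtr1.
have rI : r <= r <= r' by rewrite lexx.
have rI' : r <= r' <= r' by rewrite lexx andbT.
have tI : t <= t <= t' by rewrite lexx.
have tI' : t <= t' <= t' by rewrite lexx andbT.
have -> : loop H V r r' t t' =
  ((H t r' - P (polar r' t)) - (H t r - P (polar r t))) +
  ((V r' t' - P (polar r' t')) - (V r' t - P (polar r' t))) +
  - ((H t' r' - P (polar r' t')) - (H t' r - P (polar r t'))) +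
  - ((V r t' - P (polar r t')) - (V r t - P (polar r t))).
  by rewrite /loop; ring.
rewrite (_ : 2 * e * _ = e * (r' - r) + e * (t' - t) + e * (r' - r) + e * (t' - t)); last by ring.
apply: (le_trans (cabsD _ _)); apply: lerD; last by rewrite cabsN hV.
apply: (le_trans (cabsD _ _)); apply: lerD; last by rewrite cabsN hH.
by apply: (le_trans (cabsD _ _)); apply: lerD; [exact: hH|exact: hV].
Qed.

Lemma goursat_polar (g : C -> C) (H V : R -> R -> C) a b s t :
  0 <= a -> a <= b -> b <= 1 -> s <= t ->
  (forall r u, a <= r <= b -> s <= u <= t ->
    [/\ exists L, cder g (polar r u) L, rder (H u) r (g (polar r u) * cis u) &
        rder (V r) u (g (polar r u) * ('i * polar r u))]) ->
  loop H V a b s t = 0.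
Proof.
move=> a0 ab b1 st HH; apply/eqP; rewrite -cabs_eq0 eq_le cabs_ge0 andbT leNgt.
apply/negP; set E := cabs _ => E0.
have [q qE] : exists q : nat -> R, forall n, q n = 2^-1 ^+ n by eexists.
have [A AE] : exists A, A = b - a by eexists.
have [B BE] : exists B, B = t - s by eexists.
have A0 : 0 <= A by rewrite AE subr_ge0.
have B0 : 0 <= B by rewrite BE subr_ge0.
have q0 n : 0 < q n by rewrite qE exprn_gt0.
have qS n : q n = q n.+1 + q n.+1 by rewrite !qE exprS; field.
(* One of the four quarters carries at least a quarter of the boundary sum; [E * q n ^+ 2] is the
   share E / 4^n kept after n halvings. *)
pose bad n (p : R * R) := [/\ a <= p.1, p.1 + A * q n <= b, s <= p.2, p.2 + B * q n <= t &
   E * q n ^+ 2 <= cabs (loop H V p.1 (p.1 + A * q n) p.2 (p.2 + B * q n))].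
have step (np : nat * (R * R)) : exists p', bad np.1 np.2 ->
    [/\ bad np.1.+1 p', np.2.1 <= p'.1, p'.1 + A * q np.1.+1 <= np.2.1 + A * q np.1,
    np.2.2 <= p'.2 & p'.2 + B * q np.1.+1 <= np.2.2 + B * q np.1].
  case: np => n [x y] /=.
  have [[ax xb sy yt loopE]|] := pselect (bad n (x, y)); last by exists (x, y).
  rewrite /= in ax xb sy yt loopE.
  move hdef : (A * q n.+1) => h; move kdef : (B * q n.+1) => k.
  have h0 : 0 <= h by rewrite -hdef mulr_ge0// ltW.
  have k0 : 0 <= k by rewrite -kdef mulr_ge0// ltW.
  have hE : A * q n = h + h by rewrite -hdef (qS n) mulrDr.
  have kE : B * q n = k + k by rewrite -kdef (qS n) mulrDr.
  rewrite hE kE in xb yt loopE *.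
  have split4 : loop H V x (x + (h + h)) y (y + (k + k)) =
    (loop H V x (x + h) y (y + k) + loop H V (x + h) (x + h + h) y (y + k)) +
    (loop H V x (x + h) (y + k) (y + k + k) +
     loop H V (x + h) (x + h + h) (y + k) (y + k + k)) by rewrite /loop !addrA; ring.
  pose F := E * q n.+1 ^+ 2.
  have FE : E * q n ^+ 2 = (F + F) + (F + F) by rewrite (qS n) /F; ring.
  have badI x' y' : a <= x' -> x' + h <= b -> s <= y' -> y' + k <= t ->
    F <= cabs (loop H V x' (x' + h) y' (y' + k)) -> bad n.+1 (x', y').
    by rewrite -hdef -kdef.
  have x1 : x <= x + h by rewrite lerDl.
  have x2 : x + h <= x + h + h by rewrite lerDl.
  have x3 : x + h <= x + (h + h) by rewrite addrA.
  have x4 : x + h + h <= x + (h + h) by rewrite addrA.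
  have y1 : y <= y + k by rewrite lerDl.
  have y2 : y + k <= y + k + k by rewrite lerDl.
  have y3 : y + k <= y + (k + k) by rewrite addrA.
  have y4 : y + k + k <= y + (k + k) by rewrite addrA.
  have [ax1 xb2] := (le_trans ax x1, le_trans x4 xb); have xb1 := le_trans x3 xb.
  have [sy1 yt2] := (le_trans sy y1, le_trans y4 yt); have yt1 := le_trans y3 yt.
  have [H1|H1] := leP F (cabs (loop H V x (x + h) y (y + k))).
    by exists (x, y) => _; split => //=; exact: badI.
  have [H2|H2] := leP F (cabs (loop H V (x + h) (x + h + h) y (y + k))).
    by exists (x + h, y) => _; split => //=; exact: badI.
  have [H3|H3] := leP F (cabs (loop H V x (x + h) (y + k) (y + k + k))).
    by exists (x, y + k) => _; split => //=; exact: badI.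
  have [H4|H4] := leP F (cabs (loop H V (x + h) (x + h + h) (y + k) (y + k + k))).
    by exists (x + h, y + k) => _; split => //=; exact: badI.
  move: loopE; rewrite FE split4 => /le_trans/(_ (cabsD _ _)).
  rewrite leNgt => /negP[].
  by rewrite ltrD// (le_lt_trans (cabsD _ _))// ltrD.
have [f fP] := choice step.
pose p := fix p n := if n is m.+1 then f (m, p m) else (a, s).
have badp n : bad n (p n).
  elim: n => [|n ih]; last by have [] := fP (n, p n) ih.
  by rewrite /bad qE expr0 expr1n !mulr1 AE BE /= !(addrC _ (_ - _)) !subrK; split.
have [x xP] := @nested_point (fun n => (p n).1) (fun n => A * q n)
  (fun n => let: And5 _ h _ _ _ := fP (n, p n) (badp n) in h)
  (fun n => mulr_ge0 A0 (ltW (q0 n)))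
  (fun n => let: And5 _ _ h _ _ := fP (n, p n) (badp n) in h).
have [y yP] := @nested_point (fun n => (p n).2) (fun n => B * q n)
  (fun n => let: And5 _ _ _ h _ := fP (n, p n) (badp n) in h)
  (fun n => mulr_ge0 B0 (ltW (q0 n)))
  (fun n => let: And5 _ _ _ _ h := fP (n, p n) (badp n) in h).
have [xab yst] : (a <= x <= b) /\ (s <= y <= t).
  have := badp 0%N; case; have := xP 0%N; have := yP 0%N; lra.
have [[L dL] _ _] := HH _ _ xab yst.
have AB0 : 0 < A + B + 1 by lra.
(* The n-th boundary sum will be at most 2 e (A + B)^2 / 4^n, which this e makes smaller than E /
   4^n. The added 1 covers degenerate rectangles. *)
pose e := E / (4 * (A + B + 1) ^+ 2).
have e0 : 0 < e by rewrite divr_gt0// mulr_gt0// exprn_gt0.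
have [d d0 dd] := dL _ e0.
have [n nd] : exists n, (A + B + 1) * q n < d.
  have [n nP] : exists n, (A + B + 1) / d < n%:R.
    by exists (Num.bound ((A + B + 1) / d)); rewrite archi_boundP// divr_ge0 ?ltW.
  exists n; rewrite qE exprVn ltr_pdivrMr ?exprn_gt0// mulrC -ltr_pdivrMr//.
  by rewrite (lt_trans nP)// -natrX ltr_nat ltn_expl.
have [h1 h2 h3 h4 h5] := badp n.
have := xP n; have := yP n; move: h1 h2 h3 h4 h5.
case: (p n) => x1 y1 /= h1 h2 h3 h4 h5 /andP[yl yr] /andP[xl xr].
set D := (A + B) * q n.
have D0 : 0 <= D by rewrite mulr_ge0 ?(ltW (q0 n))//; lra.
have qn := ltW (q0 n).
have Aq : 0 <= A * q n by rewrite mulr_ge0.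
have Bq : 0 <= B * q n by rewrite mulr_ge0.
have DE : D = A * q n + B * q n by rewrite /D mulrDl.
have Dd : D < d by rewrite (lt_trans _ nd)// /D [ltRHS]mulrDl mul1r ltrDl.
have small : cabs (loop H V x1 (x1 + A * q n) y1 (y1 + B * q n)) <=
    2 * (e * D) * ((x1 + A * q n - x1) + (y1 + B * q n - y1)).
  have eD : 0 <= e * D by exact: mulr_ge0 (ltW e0) D0.
  apply: (@loop_small g H V _ _ _ _ (polar x y) L); rewrite ?lerDl//.
  move=> r u /andP[r1 r2] /andP[u1 u2].
  have rab : a <= r <= b by lra.
  have ust : s <= u <= t by lra.
  split; first by rewrite ger0_norm; lra.
  have [_ dH dV] := HH _ _ rab ust; split => //.
  have hD : cabs (polar r u - polar x y) <= D.
    rewrite (le_trans (polar_dist _ _ _ _))// DE lerD//.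
      by rewrite ler_norml; lra.
    rewrite -[leRHS]mul1r ler_pM//; rewrite ler_norml; lra.
  have E1 : polar x y + (polar r u - polar x y) = polar r u by ring.
  have := dd (polar r u - polar x y); rewrite E1 => /(_ (le_lt_trans hD Dd)) hh.
  by rewrite (le_trans hh)// ler_wpM2l// ltW.
have {}small := le_trans h5 small.
rewrite (addrC x1) addrK (addrC y1) addrK -DE /D in small.
have : E * q n ^+ 2 <= (e * (2 * (A + B) ^+ 2)) * q n ^+ 2 by lra.
rewrite ler_pM2r ?exprn_gt0// leNgt => /negP[].
rewrite /e -mulrA gtr_pMr// mulrC ltr_pdivrMr ?mulr_gt0 ?exprn_gt0//; nra.
Qed.

(** A relation rather than a function: the antiderivative witnesses integrability and value
    together, so linearity and positivity follow from the rules for derivatives. *)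
Definition circ_int (f : R -> C) (v : C) :=
  exists2 P, (forall t, 0 <= t <= 2 * pi -> rder P t (f t)) & v = P (2 * pi) - P 0.

Lemma circ_intD f g v w : circ_int f v -> circ_int g w ->
  circ_int (fun t => f t + g t) (v + w).
Proof.
move=> [P dP ->] [Q dQ ->]; exists (fun t => P t + Q t); last by ring.
by move=> t tI; apply: derD; [exact: dP|exact: dQ].
Qed.

Lemma circ_intZ f v c : circ_int f v -> circ_int (fun t => c * f t) (c * v).
Proof.
move=> [P dP ->]; exists (fun t => c * P t); last by ring.
by move=> t tI; apply: rderZ; exact: dP.
Qed.

Lemma circ_int_Re_ge0 f v : (forall t, 0 <= complex.Re (f t)) -> circ_int f v -> 0 <= complex.Re v.
Proof.
move=> f0 [P dP ->]; rewrite cReD cReN subr_ge0.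
have pi0 : (0 : R) <= 2 * pi by rewrite mulr_ge0// pi_ge0.
have dRe t : 0 <= t <= 2 * pi -> is_derive t 1 (fun s => complex.Re (P s)) (complex.Re (f t)).
  by move=> /dP/rder_Re.
have [c _ E] := is_derive_mvt pi0 dRe.
by rewrite -subr_ge0 E mulr_ge0// subr0.
Qed.

(* The circle integral of [g(z) z dt = -i g(z) dz] does not depend on the
   radius, and tends to [2 pi l] as the radius tends to [0]. *)
Lemma circ_int_residue (g : C -> C) (l : C) :
  (forall z, 0 < cabs z < 1 -> exists L, cder g z L) ->
  (forall e : R, 0 < e -> exists2 d : R, 0 < d &
     forall z, 0 < cabs z < d -> cabs (g z * z - l) <= e) ->
  forall r, 0 < r < 1 -> circ_int (fun t => g (polar r t) * polar r t) ((2 * pi)%:C * l).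
Proof.
move=> dg gl.
have pi0 : (0 : R) < 2 * pi by rewrite mulr_gt0// pi_gt0.
have dgp r t : 0 < r < 1 -> exists L, cder g (polar r t) L.
  by move=> r01; apply: dg; rewrite cabs_polar gtr0_norm//; case/andP: r01.
have [V VP] : exists V : R -> R -> C, forall r, 0 < r < 1 -> forall t, 0 <= t <= 2 * pi ->
    rder (V r) t (g (polar r t) * ('i * polar r t)).
  suff ex r : exists P : R -> C, 0 < r < 1 -> forall t, 0 <= t <= 2 * pi ->
    rder P t (g (polar r t) * ('i * polar r t)) by have [V HV] := choice ex; exists V.
  have [r01|] := pselect (0 < r < 1); last by exists (fun=> 0).
  have [||||P dP] := @rder_antiderivative R (fun t => g (polar r t) * ('i * polar r t))
     (-1) 0 (2 * pi) (2 * pi + 1).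
  - by rewrite ltrN10.
  - exact: ltW.
  - by rewrite ltrDl.
  - move=> t _; have [L dL] := dgp r t r01.
    have h := der_comp (rder_polar_arg r t) dL.
    by eexists; exact: (derM h (rderZ 'i (rder_polar_arg r t))).
  by exists P.
pose W r := V r (2 * pi) - V r 0.
have Wcst r r' : 0 < r -> r <= r' -> r' < 1 -> W r = W r'.
  move=> r0 rr r1.
  have [H HP] : exists H : R -> R -> C, forall t s, r <= s <= r' ->
      rder (H t) s (g (polar s t) * cis t).
    suff ex t : exists P : R -> C, forall s, r <= s <= r' ->
      rder P s (g (polar s t) * cis t) by have [H HH] := choice ex; exists H.
    apply: (@rder_antiderivative R _ 0 _ _ 1) => // s s01.
    have [L dL] := dgp s t s01.
    have h := der_comp (rder_polar_mod s t) dL.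
    by eexists; exact: (derM h (der_cst (cis t) s)).
  (* The rays of angle 0 and 2 pi coincide; with the same antiderivative on both, the radial terms
     of [loop] cancel and only the two circles remain. *)
  pose H' t := if t == 2 * pi then H 0 else H t.
  have H'P t s : r <= s <= r' -> rder (H' t) s (g (polar s t) * cis t).
    rewrite /H'; case: eqVneq => [->|_] sI; last exact: HP.
    by have := HP 0 s sI; rewrite /polar cis2pi.
  have I01 s : r <= s <= r' -> 0 < s < 1.
    by move=> /andP[h1 h2]; rewrite (lt_le_trans r0 h1) (le_lt_trans h2 r1).
  have := @goursat_polar g H' V r r' 0 (2 * pi) (ltW r0) rr (ltW r1) (ltW pi0).
  move=> /(_ _)/wrap[s t sI tI|].
    by split; [exact/dgp/I01|exact: H'P|apply: VP => //; exact: I01].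
  rewrite /loop /H' eqxx (lt_eqF pi0) => E.
  have : W r' - W r = 0 by rewrite -E /W; ring.
  by move=> /subr0_eq.
have Wl r : 0 < r < 1 -> W r = 'i * (2 * pi)%:C * l.
  move=> /andP[r0 r1]; apply/eqP; rewrite -subr_eq0 -cabs_eq0 eq_le cabs_ge0 andbT.
  apply/ler_addgt0Pr => e e0; rewrite add0r.
  have [|d d0 hd] := gl (e / (2 * pi)); first by rewrite divr_gt0.
  pose s := Num.min r (d / 2).
  have s0 : 0 < s by rewrite lt_min r0 divr_gt0.
  have sr : s <= r by rewrite ge_min lexx.
  have s1 : s < 1 by rewrite (le_lt_trans sr).
  have sd : s < d by rewrite gt_min ltr_pdivrMr// ltr_pMr// ltr1n orbT.
  rewrite -(Wcst s r)//.
  pose F t := V s t - 'i * l * t%:C.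
  have -> : W s - 'i * (2 * pi)%:C * l = F (2 * pi) - F 0.
    by rewrite /F /W rmorph0; ring.
  have -> : e = e / (2 * pi) * (2 * pi - 0) by rewrite subr0 divfK// lt0r_neq0.
  apply: (rder_mvt (g := F) (D := fun t => 'i * (g (polar s t) * polar s t - l)) (ltW pi0)) => t tI.
    have h1 : rder (fun t : R => t%:C) t 1.
      by apply: der_affine => h; rewrite mul1r rmorphD.
    have := derD (VP s _ t tI) (rderZ (- ('i * l)) h1); rewrite s0 s1 => /(_ isT).
    rewrite (_ : (fun y => _ + _) = F); last by apply/funext => y; rewrite /F mulNr.
    by congr rder; ring.
  rewrite cabsM [cabs 'i](_ : _ = 1) ?mul1r; last by rewrite /= expr0n expr1n add0r sqrtr1.
  by apply: hd; rewrite cabs_polar gtr0_norm// s0.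
move=> r r01; have := Wl r r01; rewrite /W => E.
exists (fun t => (- 'i) * V r t).
  move=> t tI; have := rderZ (- 'i) (VP r r01 t tI).
  by congr rder; rewrite mulrCA (mulrA (- 'i)) mulNr -expr2 sqr_i opprK mul1r.
by rewrite -mulrBr E !mulrA mulNr -expr2 sqr_i opprK mul1r.
Qed.

End Goursat.
(** * Holomorphic maps from the disc to the half-plane *)

Section SchwarzPick.
Context {R : realType}.
Local Notation C := (R[i]).
Implicit Types (f : C -> C) (a c z L : C).

(** For c = 1 the automorphism of the disc that moves 0 to a; for c = -1 the one that exchanges 0
    and a, which reverses chains. *)
Definition mobius a c z : C := (a + c * z) / (1 + conjc a * (c * z)).

Lemma mobius_den a c z : cabs a < 1 -> cabs c <= 1 -> cabs z < 1 -> 1 + conjc a * (c * z) != 0.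
Proof.
move=> a1 c1 z1; apply/eqP => /eqP; rewrite addr_eq0 => /eqP E.
have : cabs (conjc a * (c * z)) < 1.
  rewrite !cabsM cabs_conj (le_lt_trans _ z1)//.
  by rewrite (le_trans (ler_piMl _ (ltW a1))) ?mulr_ge0 ?cabs_ge0// ler_piMl ?cabs_ge0.
by rewrite -cabsN -E cabs1 ltxx.
Qed.

Lemma mobius_disc a c z : cabs a < 1 -> cabs c <= 1 -> cabs z < 1 -> cabs (mobius a c z) < 1.
Proof.
move=> a1 c1 z1; have D := mobius_den a1 c1 z1.
rewrite /mobius cabsM cabsV ltr_pdivrMr ?cabs_gt0// mul1r.
have : cabs (c * z) < 1.
  by rewrite cabsM (le_lt_trans _ z1)// ler_piMl ?cabs_ge0.
set w := c * z => w1; rewrite -ltr_sqr ?nnegrE ?cabs_ge0// !cabs_sq.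
(* This product is the difference of the squared moduli of the denominator and the numerator. *)
have : 0 < (1 - cabs a ^+ 2) * (1 - cabs w ^+ 2).
  by apply: mulr_gt0; rewrite subr_gt0 exprn_ilt1 ?cabs_ge0.
rewrite !cabs_sq; case: (a) => a1' a2; case: (w) => w1' w2 /=; nra.
Qed.

Lemma mobius0 a c : mobius a c 0 = a.
Proof. by rewrite /mobius !mulr0 !addr0 divr1. Qed.

Lemma cder_mobius a c z : cabs a < 1 -> cabs c <= 1 -> cabs z < 1 ->
  cder (mobius a c) z (c * (1 - (cabs a ^+ 2)%:C) / (1 + conjc a * (c * z)) ^+ 2).
Proof.
move=> a1 c1 z1; have D := mobius_den a1 c1 z1.
have h1 : cder (fun z => a + c * z) z c.
  by apply: der_affine => h; ring.
have h2 : cder (fun z => 1 + conjc a * (c * z)) z (conjc a * c).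
  by apply: der_affine => h; ring.
have := derM h1 (der_comp h2 (cderV D)).
by rewrite -mul_conj; congr cder; rewrite /=; field.
Qed.

(** Re f is integrated over the circle of radius r against the nonnegative kernel 2 (1 + Re (conj e
    * cis t)). Its constant mode gives 2 f 0 and its mode 1 / cis t gives e r L, while the mode cis
    t meets no negative power of z and gives 0. As e rotates - L onto the positive axis, r |L| <= 2
    Re (f 0), and r is arbitrary below 1. *)
Lemma half_plane_der0 f L : (forall z, cabs z < 1 -> exists M, cder f z M) ->
  (forall z, cabs z < 1 -> 0 < complex.Re (f z)) ->
  cder f 0 L -> cabs L <= 2 * complex.Re (f 0).
Proof.
move=> df f0 dL.
have z0 z : 0 < cabs z -> z != 0 by rewrite cabs_gt0.
have dV z : 0 < cabs z < 1 -> exists M, cder (fun w => w^-1) z M.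
  by move=> /andP[/z0 zn _]; eexists; exact: cderV.
have [rho rho0 fb] := der_incr dL; rewrite /= in fb.
set K := cabs L + 1 in fb; have K0 : 0 < K by rewrite ltr_wpDl ?cabs_ge0.
have pi0 : (0 : R) < 2 * pi by rewrite mulr_gt0// pi_gt0.
suff H r : 0 < r < 1 -> r * cabs L <= 2 * complex.Re (f 0).
  have [->|cL] := eqVneq L 0; first by rewrite cabs0 mulr_ge0 ?ltW ?f0 ?cabs0.
  rewrite leNgt; apply/negP => Llt; have cL0 : 0 < cabs L by rewrite cabs_gt0.
  have f00 : 0 < complex.Re (f 0) by rewrite f0// cabs0.
  set x := 2 * _ in Llt; have x0 : 0 < x by rewrite mulr_gt0.
  (* The midpoint of x / |L| and 1, for which r |L| would exceed x. *)
  have := H ((x / cabs L + 1) / 2).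
  have q1 : x / cabs L < 1 by rewrite ltr_pdivrMr// mul1r.
  have q0 : 0 < x / cabs L by rewrite divr_gt0.
  move=> /(_ _)/wrap[|]; first by lra.
  rewrite -/x mulrAC mulrDl divfK ?cabs_eq0// mul1r; lra.
move=> r01; case/andP: (r01) => r0 r1.
have rC : r%:C != 0 :> C by rewrite -cabs_eq0 cabs_real normr_eq0 lt0r_neq0.
have [e e1 eL] := rotate_pos (- L).
have I1 := @circ_int_residue R (fun z => f z * z^-1) (f 0).
have I2 := @circ_int_residue R (fun z => (f z - f 0) * (z^-1 * z^-1)) L.
have I3 := @circ_int_residue R f 0.
have pz t : polar r t != 0 by rewrite -cabs_eq0 cabs_polar normr_eq0 lt0r_neq0.
have {}I1 : circ_int (fun t => f (polar r t)) ((2 * pi)%:C * f 0).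
  have := I1 _ _ r r01; rewrite (_ : (fun t => _) = (fun t => f (polar r t))); last first.
    by apply/funext => t; rewrite divfK.
  apply.
    move=> z /[dup] z01 /andP[_ z1]; have [M dM] := df z z1; have [N dN] := dV z z01.
    by eexists; exact: derM dM dN.
  move=> x x0; exists (Num.min rho (x / K)) => [|z]; first by rewrite lt_min rho0 divr_gt0.
  rewrite lt_min => /and3P[/z0 zn /fb + zK]; rewrite add0r divfK// => /le_trans; apply.
  by rewrite mulrC -ler_pdivlMr// ltW.
have {}I2 : circ_int (fun t => (f (polar r t) - f 0) / polar r t) ((2 * pi)%:C * L).
  have := I2 _ _ r r01.
  rewrite (_ : (fun t => _) = (fun t => (f (polar r t) - f 0) / polar r t)); last first.
    by apply/funext => t; rewrite -!mulrA mulVf// mulr1.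
  apply.
    move=> z /[dup] z01 /andP[_ z1]; have [M dM] := df z z1; have [N dN] := dV z z01.
    eexists; exact: derM (derD dM (der_cst (- f 0) z)) (derM dN dN).
  move=> x /dL[s s0 H]; exists s => // z /andP[/z0 zn /H]; rewrite add0r /= => H'.
  rewrite -(ler_pM2r (_ : 0 < cabs z)) ?cabs_gt0// -cabsM; apply: le_trans H'.
  by rewrite [leLHS](_ : _ = cabs (f z - f 0 - L * z))//; congr cabs; field.
have {}I3 : circ_int (fun t => f (polar r t) * polar r t) 0.
  have := I3 _ _ r r01; rewrite mulr0; apply.
    by move=> z /andP[_ /df].
  set K' := K + cabs (f 0); have K'0 : 0 < K' by rewrite ltr_wpDr ?cabs_ge0.
  move=> x x0; exists (Num.min rho (Num.min 1 (x / K'))) => [|z].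
    by rewrite !lt_min rho0 ltr01 divr_gt0.
  rewrite !lt_min => /and4P[/z0 zn /fb + z1 zK]; rewrite add0r subr0 cabsM => h.
  have fz : cabs (f z) <= K'.
    rewrite -[f z](subrK (f 0)) (le_trans (cabsD _ _))// lerD2r (le_trans h)//.
    by rewrite ler_piMr ?ltW.
  rewrite (le_trans (ler_wpM2r (cabs_ge0 _) fz))// mulrC -ler_pdivlMr// ltW//.
(* Subtracting f 0 in I2 removed the pole of order two; this integral restores the term e f 0 / cis
   t at no cost. *)
have I4 : circ_int (fun t : R => cos t -i* sin t) 0.
  exists (fun t : R => sin t +i* cos t).
    by move=> t _; exact: is_derive_rder (is_derive_sin t) (is_derive_cos t).
  by rewrite mulr_natl sin2pi cos2pi sin0 cos0 subrr.
have := circ_intD (circ_intD (circ_intZ 2 I1) (circ_intZ (e * r%:C) I2))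
  (circ_intD (circ_intZ (conjc e / r%:C) I3) (circ_intZ (e * f 0) I4)).
set ker := fun t => _ => I.
have kerE t : ker t = (2 * (1 + complex.Re (conjc e * cis t)))%:C * f (polar r t).
  have -> (x : R) : (2 * (1 + x))%:C = 2 * (1 + x%:C) :> C.
    by rewrite rmorphM !rmorphD !rmorph1.
  have k0 : cis t != 0 by rewrite -cabs_eq0 cabs_cis oner_eq0.
  have cJ : conjc (cis t) = (cis t)^-1.
    by apply: (mulfI k0); rewrite mul_conj cabs_cis expr1n divff.
  have eJ : conjc (conjc e * cis t) = e / cis t by rewrite -cJ rmorphM /= conjcK.
  rewrite /ker ReJ_add eJ -[cos t -i* sin t]/(conjc (cis t)) cJ.
  by rewrite /polar; field; rewrite k0 rC.
have := circ_int_Re_ge0 _ I; move=> /(_ _)/wrap[t|].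
  rewrite kerE cReMr mulr_ge0//; last by rewrite ltW// f0// cabs_polar gtr0_norm.
  have := Re_le_cabs (conjc e * cis t); rewrite cabsM cabs_conj e1 cabs_cis mul1r ler_norml; lra.
rewrite !mulr0 !addr0 cReD.
have -> : complex.Re (2 * ((2 * pi)%:C * f 0)) = (2 * pi) * (2 * complex.Re (f 0)).
  by rewrite mulrCA cReMr -(rmorph_nat (real_complex R)) cReMr.
have -> : complex.Re (e * r%:C * ((2 * pi)%:C * L)) = (2 * pi) * (- (r * cabs L)).
  rewrite -cabsN -eL (mulrN e) cReN !mulrN opprK.
  have -> : e * r%:C * ((2 * pi)%:C * L) = (2 * pi)%:C * (r%:C * (e * L)) by ring.
  by rewrite !cReMr.
by rewrite -mulrDr pmulr_rge0// subr_ge0.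
Qed.

Lemma half_plane_der f z L : (forall z, cabs z < 1 -> exists M, cder f z M) ->
  (forall z, cabs z < 1 -> 0 < complex.Re (f z)) -> cabs z < 1 ->
  cder f z L -> cabs L * (1 - cabs z ^+ 2) <= 2 * complex.Re (f z).
Proof.
move=> df f0 z1 dL.
have c1 : cabs (1 : C) <= 1 by rewrite cabs1.
have m1 w : cabs w < 1 -> cabs (mobius z 1 w) < 1 by exact: mobius_disc.
have := @half_plane_der0 (f \o mobius z 1) (L * (1 - (cabs z ^+ 2)%:C)).
rewrite /= mobius0 cabsM.
have -> : cabs (1 - (cabs z ^+ 2)%:C) = 1 - cabs z ^+ 2.
  rewrite -[1](rmorph1 (real_complex R)) -rmorphB cabs_real ger0_norm// subr_ge0.
  by rewrite exprn_ile1 ?cabs_ge0// ltW.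
apply.
- move=> w w1; have [M dM] := df _ (m1 w w1).
  by eexists; exact: (der_comp (cder_mobius z1 c1 w1) dM).
- by move=> w /m1/f0.
have o1 : cabs (0 : C) < 1 by rewrite cabs0.
have h := cder_mobius z1 c1 o1; rewrite !mulr0 addr0 expr1n divr1 mul1r in h.
by apply: der_comp h _; rewrite mobius0.
Qed.

Lemma is_derive_homographic (k c y : R) : 1 - c * y != 0 ->
  is_derive y 1 (fun y => k / (1 - c * y)) (k * c / (1 - c * y) ^+ 2).
Proof.
move=> p.
have h : is_derive y 1 (fun y : R => 1 - c * y) (- c).
  apply/is_derive_epsP => e e0; exists 1 => // h _.
  by rewrite [X in `|X|](_ : _ = 0) ?normr0 ?mulr_ge0// ?(ltW e0)//; ring.
have h2 : is_derive y 1 (fun y => (1 - c * y)^-1) (- (1 - c * y) ^- 2 *: - c).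
  exact: (@is_deriveV R (fun y => 1 - c * y) y (- c) 1 p h).
have h3 := is_deriveZ k h2.
have -> : k * c / (1 - c * y) ^+ 2 = k *: (- (1 - c * y) ^- 2 *: - c).
  by rewrite /GRing.scale /= mulrNN -mulrA; congr (_ * _); rewrite mulrC.
exact: h3.
Qed.

(** The derivative bound is integrated twice along the radius through t: first for Re f, giving
    Harnack's inequality, then for f with 2 u 0 / (1 - s)^2 as majorant. The bound is attained by (1
    + z) / (1 - z), and exactness matters: 2|t| / (1 - |t|) is exp(2 poincare0 t) - 1, which
    composes along chains. *)
Lemma half_plane_growth f t : (forall z, cabs z < 1 -> exists M, cder f z M) ->
  (forall z, cabs z < 1 -> 0 < complex.Re (f z)) -> cabs t < 1 ->
  cabs (f t - f 0) <= 2 * cabs t / (1 - cabs t) * complex.Re (f 0).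
Proof.
move=> df f0 t1; set x := cabs t.
have x0 : 0 <= x := cabs_ge0 t.
pose w := t / x%:C.
have tE : t = x%:C * w.
  have [t0|t0] := eqVneq t 0; first by rewrite /w t0 mul0r mulr0.
  by rewrite /w mulrC divfK// -cabs_eq0 cabs_real normr_eq0 cabs_eq0.
have w1 : cabs w <= 1.
  rewrite /w cabsM cabsV cabs_real ger0_norm// -/x.
  have [->|xn] := eqVneq x 0; first by rewrite mul0r.
  by rewrite divff.
have sw1 s : 0 <= s <= x -> cabs (s%:C * w) < 1.
  move=> /andP[s0 sx]; rewrite cabsM cabs_real ger0_norm// (le_lt_trans _ t1)//.
  by rewrite (le_trans (ler_piMr _ w1)).
have [D DP] : exists D : R -> C, forall s, 0 <= s <= x -> cder f (s%:C * w) (D s).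
  suff ex s : exists M, 0 <= s <= x -> cder f (s%:C * w) M.
    by have [D DD] := choice ex; exists D.
  have [s01|] := pselect (0 <= s <= x); last by exists 0.
  by have [M dM] := df _ (sw1 s s01); exists M.
pose u s := complex.Re (f (s%:C * w)).
have dg s : 0 <= s <= x -> rder (fun s => f (s%:C * w)) s (D s * w).
  move=> /DP dM; apply: (der_comp (f := fun s : R => s%:C * w)) dM.
  by apply: der_affine => h; rewrite rmorphD mulrDl (mulrC w).
have DB s : 0 <= s <= x -> cabs (D s * w) * (1 - s ^+ 2) <= 2 * u s.
  move=> sI; apply: le_trans (half_plane_der df f0 (sw1 s sI) (DP s sI)).
  case/andP: sI => s0 sx; have s1 : s < 1 := le_lt_trans sx t1.
  rewrite cabsM; apply: ler_pM; rewrite ?mulr_ge0 ?cabs_ge0//.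
  - by rewrite subr_ge0 exprn_ile1// ltW.
  - by rewrite ler_piMr ?cabs_ge0.
  rewrite lerD2l lerN2 ler_sqr ?nnegrE ?cabs_ge0// cabsM cabs_real ger0_norm//.
  by rewrite ler_piMr.
have u_ge0 s : 0 <= s <= x -> 0 <= u s by move=> sI; rewrite ltW// f0// sw1.
have uB s : 0 <= s <= x -> u s <= (1 + s) / (1 - s) * u 0.
  move=> /andP[s0 sx].
  (* This is (1 - y) / (1 + y) * u y, in the shape differentiated by [is_derive_homographic]; that
     it decreases is Harnack's inequality. *)
  pose k y := (2 / (1 - (-1) * y) - 1) * u y.
  have dk y : 0 <= y <= s -> is_derive y 1 k
      (- 2 / (1 + y) ^+ 2 * u y + (1 - y) / (1 + y) * complex.Re (D y * w)).
    move=> /andP[y0 ys]; have p1 : 0 < 1 + y by lra.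
    have p2 : 1 - (-1) * y != 0 by rewrite lt0r_neq0//; lra.
    have yI : 0 <= y <= x by rewrite y0 (le_trans ys).
    have h1 := is_deriveB (is_derive_homographic 2 p2) (is_derive_cst (1 : R) y 1).
    have := is_deriveM h1 (rder_Re (dg y yI)).
    rewrite (_ : _ * _ = k)//; congr is_derive.
    rewrite /GRing.scale /= -/(u y) !fctE.
    have -> : 1 - -1 * y = 1 + y by ring.
    by field; rewrite lt0r_neq0.
  have [c /andP[c0 cs] E] := is_derive_mvt s0 dk.
  have cI : 0 <= c <= x by rewrite c0 (le_trans cs).
  have c1 : c < 1 by rewrite (le_lt_trans (le_trans cs sx)).
  have s1 : s < 1 by rewrite (le_lt_trans sx).
  have : k s <= k 0.
    rewrite -subr_le0 E; apply: mulr_le0_ge0; last by rewrite subr0.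
    have := DB c cI; have := Re_le_cabs (D c * w); rewrite ler_norml => /andP[_].
    set a := complex.Re _; set b := cabs _ => ab bu.
    have p1 : 0 < 1 + c by lra.
    have m1 : 0 < 1 - c by lra.
    have au : a * (1 - c ^+ 2) <= 2 * u c.
      by rewrite (le_trans _ bu)// ler_wpM2r// subr_ge0 exprn_ile1// ltW.
    have -> : - 2 / (1 + c) ^+ 2 * u c + (1 - c) / (1 + c) * a =
      (a * (1 - c ^+ 2) - 2 * u c) / (1 + c) ^+ 2 by field; rewrite lt0r_neq0.
    by rewrite pmulr_lle0 ?invr_gt0 ?exprn_gt0// subr_le0.
  have -> : k 0 = u 0 by rewrite /k mulr0 subr0 divr1; ring.
  rewrite /k => H.
  have p1 : 0 < 1 + s by lra.
  have m1 : 0 < 1 - s by lra.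
  rewrite mulrAC ler_pdivlMr//; move: H.
  have -> : 2 / (1 - -1 * s) - 1 = (1 - s) / (1 + s) by field; rewrite lt0r_neq0//; lra.
  by rewrite mulrAC ler_pdivrMr// mulrC (mulrC (u 0)).
have u00 := u_ge0 0; rewrite lexx x0 in u00; have {}u00 := u00 isT.
have := @rder_mvt_gen R (fun s => f (s%:C * w)) (fun s => D s * w)
  (fun s => 2 * u 0 / (1 - s)) (fun s => 2 * u 0 / (1 - s) ^+ 2) 0 x x0 dg.
rewrite rmorph0 mul0r -tE subr0 divr1.
have x1 : 0 < 1 - x by rewrite subr_gt0.
have -> : 2 * u 0 / (1 - x) - 2 * u 0 = 2 * x / (1 - x) * u 0.
  by field; rewrite lt0r_neq0.
have u0E : u 0 = complex.Re (f 0) by rewrite /u rmorph0 mul0r.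
rewrite -u0E; apply=> s sI; case/andP: (sI) => s0 sx.
  have := @is_derive_homographic (2 * u 0) 1 s; rewrite mul1r mulr1.
  rewrite (_ : (fun y => _ / (1 - 1 * y)) = (fun s => 2 * u 0 / (1 - s))); last first.
    by apply/funext => y; rewrite mul1r.
  by apply; rewrite lt0r_neq0//; lra.
have s1 : 0 < 1 - s by lra.
have s2 : 0 < 1 + s by lra.
have := le_trans (DB s sI) (ler_wpM2l (ler0n _ 2) (uB s sI)).
have -> : 1 - s ^+ 2 = (1 - s) * (1 + s) by ring.
move=> h; rewrite -(ler_pM2r (mulr_gt0 s1 s2)) (le_trans h)//.
by rewrite [leLHS](_ : _ = 2 * u 0 / (1 - s) ^+ 2 * ((1 - s) * (1 + s)))//; field; rewrite lt0r_neq0.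
Qed.

End SchwarzPick.
(** * Discs and chains of discs *)

Section Poincare.
Context {R : realType}.
Local Notation C := (R[i]).
Implicit Types (t : C) (s r : R).

Lemma expR_poincare t : cabs t < 1 -> expR (2 * poincare0 t) = (1 + cabs t) / (1 - cabs t).
Proof.
move=> t1; rewrite /poincare0 mulVKf// lnK// posrE divr_gt0 ?subr_gt0//.
by rewrite ltr_pwDl// cabs_ge0.
Qed.

Lemma poincare_le s t : cabs t < 1 ->
  (poincare0 t <= s) = (1 + cabs t <= expR (2 * s) * (1 - cabs t)).
Proof.
move=> t1; rewrite -(ler_pM2l (ltr0n R 2)) -ler_expR expR_poincare//.
by rewrite ler_pdivrMr// subr_gt0.
Qed.

Lemma poincare_ge0 t : cabs t < 1 -> 0 <= poincare0 t.
Proof.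
move=> t1; rewrite -(pmulr_rge0 _ (ltr0n R 2)) -ler_expR expR_poincare//.
by rewrite expR0 ler_pdivlMr ?subr_gt0// mul1r; have := cabs_ge0 t; lra.
Qed.

Lemma poincare0_0 : poincare0 (0 : C) = 0.
Proof. by rewrite /poincare0 cabs0 addr0 subr0 divr1 ln1 mulr0. Qed.

Lemma poincare_mono t t' : cabs t <= cabs t' -> cabs t' < 1 -> poincare0 t <= poincare0 t'.
Proof.
move=> tt t1; rewrite poincare_le; last exact: le_lt_trans t1.
rewrite expR_poincare// mulrAC ler_pdivlMr ?subr_gt0//; nra.
Qed.

Definition tanh s : R := (expR (2 * s) - 1) / (expR (2 * s) + 1).

Lemma tanh_ge0 s : 0 <= s -> 0 <= tanh s.
Proof.
move=> s0; apply: divr_ge0; last by rewrite addr_ge0 ?expR_ge0.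
by rewrite subr_ge0 -[leLHS]expR0 ler_expR mulr_ge0.
Qed.

Lemma tanh_lt1 s : tanh s < 1.
Proof.
have := expR_gt0 (2 * s); rewrite /tanh => e0.
by rewrite ltr_pdivrMr; lra.
Qed.

Lemma tanh0 : tanh 0 = 0.
Proof. by rewrite /tanh mulr0 expR0 subrr mul0r. Qed.

Lemma tanh_poincare t : cabs t < 1 -> tanh (poincare0 t) = cabs t.
Proof.
move=> t1; rewrite /tanh expR_poincare//.
by field; rewrite !lt0r_neq0 ?subr_gt0//; lra.
Qed.

Lemma tanh_ratio s : (1 + tanh s) / (1 - tanh s) = expR (2 * s).
Proof.
have e0 := expR_gt0 (2 * s); rewrite /tanh; field.
by rewrite !lt0r_neq0//; lra.
Qed.

Lemma poincare_tanh s : 0 <= s -> poincare0 (tanh s)%:C = s.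
Proof.
move=> s0; rewrite /poincare0 cabs_real ger0_norm ?tanh_ge0// tanh_ratio expRK.
by rewrite mulKf.
Qed.

Lemma tanh_le s t : cabs t < 1 -> (cabs t <= tanh s) = (poincare0 t <= s).
Proof.
move=> t1; rewrite poincare_le// /tanh; have := expR_gt0 (2 * s) => e0.
rewrite ler_pdivlMr; last by lra.
by apply/idP/idP; lra.
Qed.

End Poincare.

Section Discs.
Context {R : realType} {d : nat}.
Local Notation C := (R[i]).
Local Notation pt := 'rV[C]_d.
Implicit Types (O : set pt) (f : C -> pt) (x y z p w : pt) (s : R).

Definition vder f (z : C) (L : pt) := forall e : R, 0 < e -> exists2 r : R, 0 < r &
  forall h, cabs h < r -> vnorm (f (z + h) - f z - h *: L) <= e * cabs h.

Lemma cdiff_atP f (z : C) : cdiff_at f z <-> exists L, vder f z L.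
Proof.
have E h L : h != 0 -> f (z + h) - f z - h *: L = h *: (h^-1 *: (f (z + h) - f z) - L).
  by move=> h0; rewrite scalerBr scalerA divff// scale1r.
split=> -[L H]; exists L => e e0.
  have [r [r0 hr]] := H e e0; exists r => // h hlt.
  have [->|h0] := eqVneq h 0.
    by rewrite addr0 subrr scale0r subr0 vnorm0 cabs0 mulr0.
  by rewrite E// vnormZ mulrC ler_wpM2r ?cabs_ge0// ltW// hr// cabs_gt0 h0.
have e2 : 0 < e / 2 by rewrite divr_gt0.
have [r r0 hr] := H _ e2; exists r; split => // h /andP[h0 /hr].
rewrite cabs_gt0 in h0; rewrite E// vnormZ mulrC ler_pM2r ?cabs_gt0// => /le_lt_trans; apply.
by rewrite ltr_pdivrMr// ltr_pMr// ltr1n.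
Qed.

Lemma vder_comp f (phi : C -> C) (z m : C) (L : pt) :
  cder phi z m -> vder f (phi z) L -> vder (f \o phi) z (m *: L).
Proof.
move=> dp df e e0.
set A := cabs m + 1; set B := vnorm L + 1.
have A0 : 0 < A by rewrite ltr_wpDl ?cabs_ge0.
have B0 : 0 < B by rewrite ltr_wpDl ?vnorm_ge0.
have eA : 0 < e / 2 / A by rewrite !divr_gt0.
have eB : 0 < e / 2 / B by rewrite !divr_gt0.
have [r1 r10 p1] := der_incr dp.
have [r r0 pr] := dp _ eB; have [s s0 fs] := df _ eA.
exists (Num.min r (Num.min r1 (s / A))) => [|h].
  by rewrite !lt_min r0 r10 divr_gt0.
rewrite !lt_min => /and3P[/pr hp /p1 kp hA].
rewrite /= in hp kp.
have k0 : 0 <= cabs h by rewrite cabs_ge0.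
have /fs : cabs (phi (z + h) - phi z) < s.
  by rewrite (le_lt_trans kp)// mulrC -ltr_pdivlMr.
have -> : phi z + (phi (z + h) - phi z) = phi (z + h) by ring.
move=> hf; rewrite /comp; set k := phi (z + h) - phi z in hp kp hf; clearbody k.
have -> : f (phi (z + h)) - f (phi z) - h *: (m *: L) =
   (f (phi (z + h)) - f (phi z) - k *: L) + (k - m * h) *: L.
  by rewrite scalerBl addrA subrK (mulrC m) scalerA.
rewrite (le_trans (vnormD _ _))// vnormZ [leRHS](_ : _ = e / 2 * cabs h + e / 2 * cabs h); last by field.
apply: lerD.
  rewrite (le_trans hf)// (le_trans (ler_wpM2l (ltW eA) kp))//.
  by rewrite mulrA divfK ?lt0r_neq0.
rewrite mulrC (le_trans (ler_wpM2l (vnorm_ge0 _) hp))// mulrA ler_wpM2r//.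
by rewrite mulrA ler_pdivrMr// mulrC ler_wpM2l ?ltW ?divr_gt0// ltrDl.
Qed.

Lemma holo_comp O f (phi : C -> C) :
  (forall z : C, cabs z < 1 -> cabs (phi z) < 1 /\ exists L, cder phi z L) ->
  holo_disc O f -> holo_disc O (f \o phi).
Proof.
move=> hp hf z /hp[p1 [m dm]]; have [fO /cdiff_atP[L dL]] := hf _ p1.
by split => //; apply/cdiff_atP; exists (m *: L); exact: vder_comp.
Qed.

Lemma holo_mobius O f (a c : C) : cabs a < 1 -> cabs c <= 1 ->
  holo_disc O f -> holo_disc O (f \o mobius a c).
Proof.
move=> a1 c1; apply: holo_comp => z z1; split; first exact: mobius_disc.
by eexists; exact: cder_mobius.
Qed.

Lemma cdiff_affine p w (z : C) : cdiff_at (fun z : C => p + z *: w) z.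
Proof.
apply/cdiff_atP; exists w => e e0; exists 1 => // h _.
rewrite scalerDl addrA (addrC _ (h *: w)) addrK addrN vnorm0.
by rewrite mulr_ge0 ?cabs_ge0// ltW.
Qed.

(** No conjugation, so that [lf w] is complex linear and turns discs into holomorphic functions. *)
Definition lf w x : C := \sum_(i < d) x 0 i * w 0 i.

Lemma lfD w x y : lf w (x + y) = lf w x + lf w y.
Proof. by rewrite -big_split; apply: eq_bigr => i _; rewrite mxE mulrDl. Qed.

Lemma lfZ w (a : C) x : lf w (a *: x) = a * lf w x.
Proof. by rewrite mulr_sumr; apply: eq_bigr => i _; rewrite mxE mulrA. Qed.

Lemma lfN w x : lf w (- x) = - lf w x.
Proof. by rewrite -scaleN1r lfZ mulN1r. Qed.

Lemma lf_bound w : exists2 K, 0 < K & forall x, cabs (lf w x) <= K * vnorm x.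
Proof.
exists (\sum_(i < d) cabs (w 0 i) + 1) => [|x].
  by rewrite ltr_wpDl// sumr_ge0// => i _; exact: cabs_ge0.
rewrite mulrDl mul1r ler_wpDr ?vnorm_ge0// mulr_suml.
apply: (big_ind2 (fun (a : C) b => cabs a <= b)) => [|a a' b b' h1 h2|i _].
- by rewrite cabs0.
- by rewrite (le_trans (cabsD _ _))// lerD.
by rewrite cabsM mulrC ler_wpM2l ?cabs_ge0// coord_le_vnorm.
Qed.

Lemma cder_lf f (z : C) (L : pt) w (c : C) : vder f z L -> cder (fun z : C => lf w (f z) + c) z (lf w L).
Proof.
move=> df e e0; have [K K0 hK] := lf_bound w.
have [|r r0 hr] := df (e / K); first by rewrite divr_gt0.
exists r => // h /hr {}hr.
have -> : lf w (f (z + h)) + c - (lf w (f z) + c) - lf w L * h =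
  lf w (f (z + h) - f z - h *: L) by rewrite !lfD !lfN lfZ; ring.
rewrite (le_trans (hK _))// (le_trans (ler_wpM2l (ltW K0) hr))//.
by rewrite mulrA mulrCA divff ?mulr1// lt0r_neq0.
Qed.

Lemma cdiff_aff f (z : C) (M : 'M[C]_d) b : cdiff_at f z -> cdiff_at (aff M b \o f) z.
Proof.
move=> /cdiff_atP[L df]; apply/cdiff_atP; exists (L *m M) => e e0.
have [K K0 hK] : exists2 K, 0 < K & forall x : pt, vnorm (x *m M) <= K * vnorm x.
  have /choice[k hk] : forall j, exists k, 0 < k /\ forall x, cabs (lf (col j M)^T x) <= k * vnorm x.
    by move=> j; have [k k0 kP] := lf_bound (col j M)^T; exists k.
  have k0 j : 0 <= k j by rewrite ltW// (hk j).1.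
  pose S := \sum_j k j + 1.
  have S0 : 0 < S by rewrite ltr_wpDl// sumr_ge0.
  exists (d.+1%:R * S) => [|x]; first by rewrite mulr_gt0// ltr0n.
  rewrite -mulrA vnorm_le_coord ?mulr_ge0 ?vnorm_ge0 ?ltW// => j.
  have -> : (x *m M) 0 j = lf (col j M)^T x.
    by rewrite mxE; apply: eq_bigr => i _; rewrite !mxE.
  rewrite (le_trans ((hk j).2 x))// ler_wpM2r ?vnorm_ge0//.
  by rewrite /S (bigD1 j)//= -addrA lerDl addr_ge0// sumr_ge0.
have [|r r0 hr] := df (e / K); first by rewrite divr_gt0.
exists r => // h /hr {}hr.
have -> : (aff M b \o f) (z + h) - (aff M b \o f) z - h *: (L *m M) =
  (f (z + h) - f z - h *: L) *m M.
  by rewrite /aff /= !mulmxBl -scalemxAl opprD addrACA subrr addr0.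
rewrite (le_trans (hK _))// (le_trans (ler_wpM2l (ltW K0) hr))//.
by rewrite mulrA mulrCA divff ?mulr1// lt0r_neq0.
Qed.

End Discs.

(** * Chains of discs, the Kobayashi distance and almost-geodesic paths *)

Section Chains.
Context {R : realType} {d : nat}.
Local Notation C := (R[i]).
Local Notation pt := 'rV[C]_d.
Implicit Types (O : set pt) (f : C -> pt) (x y z p w : pt) (s a b : R).

(** Inductive form of the finite sequences inside [kob], so that concatenation, reversal, affine
    images and estimates become inductions. *)
Inductive chain O : pt -> pt -> R -> Prop :=
| chain0 x : chain O x x 0
| chainS x z t f s : holo_disc O f -> cabs t < 1 -> f 0 = x -> chain O (f t) z s ->
    chain O x z (poincare0 t + s).

Lemma kobE O x y : kob O x y = inf [set s | chain O x y s].
Proof.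
congr inf; apply/seteqP; split => s /=.
  move=> [n [p [t [f [<- [<- [H ->]]]]]]].
  elim: n p t f H => [|n ih] p t f H; first by rewrite big_ord0; exact: chain0.
  rewrite big_ord_recl; have [hf [t1 [f0 ft]]] := H 0%N isT.
  apply: (chainS hf t1 f0); rewrite ft.
  by apply: (ih (p \o S) (t \o S) (f \o S)) => i ?; exact: H.
elim=> {x y s} [x|x z t f s hf t1 f0 _ [n [p [u [g [p0 [pn [H ->]]]]]]]].
  exists 0%N, (fun=> x), (fun=> 0), (fun=> fun=> 0); split => //; split => //.
  by split => //; rewrite big_ord0.
exists n.+1, (fun i => if i is j.+1 then p j else x), (fun i => if i is j.+1 then u j else t),
  (fun i => if i is j.+1 then g j else f).
split; first by [].
split; first exact: pn.
split; last by rewrite big_ord_recl.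
move=> [_|i iln]; last exact: H.
by rewrite p0; split; first exact: hf.
Qed.

Lemma chain_ge0 O x y s : chain O x y s -> 0 <= s.
Proof. by elim=> {x y s} // x z t f s _ t1 _ _ s0; rewrite addr_ge0// poincare_ge0. Qed.

Lemma chain1 O f (t : C) : holo_disc O f -> cabs t < 1 -> chain O (f 0) (f t) (poincare0 t).
Proof. by move=> hf t1; rewrite -[poincare0 t]addr0; apply: chainS hf t1 _ _ => //; exact: chain0. Qed.

Lemma chain_cat O x y z s s' : chain O x y s -> chain O y z s' -> chain O x z (s + s').
Proof.
elim=> {x y s} [x|x y t f s hf t1 f0 _ ih]; first by rewrite add0r.
by move=> /ih; rewrite -addrA; exact: chainS.
Qed.

Lemma chain_rev O x y s : chain O x y s -> chain O y x s.
Proof.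
elim=> {x y s} [x|x y t f s hf t1 <- _ ih]; first exact: chain0.
rewrite addrC; apply: chain_cat ih _.
have m1 : cabs (-1 : C) <= 1 by rewrite cabsN cabs1.
have := chain1 (holo_mobius t1 m1 hf) t1.
rewrite /= mobius0 (_ : mobius t (-1) t = 0)//.
by rewrite /mobius mulN1r subrr mul0r.
Qed.

Lemma kob_ge0 O x y : 0 <= kob O x y.
Proof.
rewrite kobE; have [[s cs]|no] := pselect (exists s, chain O x y s).
  by apply: lb_le_inf => [|s' /chain_ge0]; first by exists s.
(* Without any chain the infimum is that of the empty set, which is 0 by convention. *)
rewrite (_ : [set s | _] = set0) ?inf0//.
by apply/seteqP; split => // s cs; case: no; exists s.
Qed.

Lemma kob_le O x y s : chain O x y s -> kob O x y <= s.
Proof. by move=> cs; rewrite kobE; apply: ge_inf => //; exists 0 => s' /chain_ge0. Qed.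

Lemma kob_xx O x : kob O x x = 0.
Proof. by apply/eqP; rewrite eq_le kob_ge0 andbT; apply: kob_le; exact: chain0. Qed.

Lemma kobC O x y : kob O x y = kob O y x.
Proof. by rewrite !kobE; congr inf; apply/seteqP; split => s; exact: chain_rev. Qed.

(** Since the infimum of the empty set is 0, unconnected points would be at distance 0; this
    condition is what makes the triangle inequality provable. *)
Definition chainable O := forall x y, O x -> O y -> exists s, chain O x y s.

Lemma kob_lt O x y a : chainable O -> O x -> O y -> kob O x y < a ->
  exists2 s, s < a & chain O x y s.
Proof.
move=> cO Ox Oy; rewrite kobE => /inf_lt h; have [|s cs sa] := h; last by exists s.
by have [s cs] := cO _ _ Ox Oy; exists s.
Qed.

Lemma kobD O x y z : chainable O -> O x -> O y -> O z -> kob O x z <= kob O x y + kob O y z.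
Proof.
move=> cO Ox Oy Oz; apply/ler_addgt0Pr => e e0.
have e2 : 0 < e / 2 by rewrite divr_gt0.
have [|s slt cs] := @kob_lt O x y (kob O x y + e / 2) cO Ox Oy; first by rewrite ltrDl.
have [|s' slt' cs'] := @kob_lt O y z (kob O y z + e / 2) cO Oy Oz; first by rewrite ltrDl.
by rewrite (le_trans (kob_le (chain_cat cs cs')))//; lra.
Qed.

Lemma kob_chain O x y e : chainable O -> O x -> O y -> 0 < e ->
  exists2 s, s <= kob O x y + e & chain O x y s.
Proof.
move=> cO Ox Oy e0; have [|s slt cs] := @kob_lt O x y (kob O x y + e) cO Ox Oy.
  by rewrite ltrDl.
by exists s => //; exact: ltW.
Qed.

Lemma tanhD a b : 0 <= a -> 0 <= b ->
  tanh (a + b) = (tanh a + tanh b) / (1 + tanh a * tanh b).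
Proof.
move=> a0 b0; rewrite /tanh mulrDr expRD.
have := expR_gt0 (2 * a); have := expR_gt0 (2 * b).
set A := expR (2 * a); set B := expR (2 * b) => B0 A0.
have AB : 0 < A * B by rewrite mulr_gt0.
field; rewrite !lt0r_neq0//; nra.
Qed.

(* The radius of a disc, parametrised by arc length, is a path along which
   chains of the exact expected length exist. *)
Lemma chain_path O x y s : O x -> chain O x y s -> exists tau : R -> pt,
  [/\ tau 0 = x, tau s = y, forall a, 0 <= a <= s -> O (tau a) &
   forall a b, 0 <= a -> a <= b -> b <= s -> chain O (tau a) (tau b) (b - a)].
Proof.
move=> + c; elim: c => {x y s} [x Ox|x y t f s hf t1 f0 cs ih Ox].
  by exists (fun=> x); split => // a b a0 ab b0; rewrite (_ : b - a = 0); [exact: chain0|lra].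
have [tau [t0 ts tO tc]] := ih (hf t t1).1.
pose om : C := if t == 0 then 1 else t / (cabs t)%:C.
have tE : t = (cabs t)%:C * om.
  rewrite /om; have [->|tn] := eqVneq; first by rewrite cabs0 mul0r.
  by rewrite mulrC divfK// -cabs_eq0 cabs_real normr_eq0 cabs_eq0.
have om1 : cabs om = 1.
  rewrite /om; have [_|tn] := eqVneq; first exact: cabs1.
  by rewrite cabsM cabsV cabs_real ger0_norm ?cabs_ge0// divff// cabs_eq0.
pose g a := f ((tanh a)%:C * om).
have pt1 a : 0 <= a -> cabs ((tanh a)%:C * om) < 1.
  by move=> a0; rewrite cabsM om1 mulr1 cabs_real ger0_norm ?tanh_ge0 ?tanh_lt1.
have gc a b : 0 <= a -> a <= b -> chain O (g a) (g b) (b - a).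
  move=> a0 ab; have ba : 0 <= b - a by rewrite subr_ge0.
  have c1 : cabs (1 : C) <= 1 by rewrite cabs1.
  (* The disc recentred at parameter a reaches the point of parameter b at tanh (b - a), by the
     addition formula for tanh. *)
  have := chain1 (holo_mobius (pt1 a a0) c1 hf) (pt1 _ ba).
  have -> : poincare0 ((tanh (b - a))%:C * om) = b - a.
    by rewrite -[RHS](poincare_tanh ba) /poincare0 cabsM om1 mulr1.
  rewrite /= mobius0.
  congr chain; rewrite /g; congr f.
  have -> : tanh b = (tanh a + tanh (b - a)) / (1 + tanh a * tanh (b - a)).
    by rewrite -tanhD// addrC subrK.
  have D : 0 < 1 + tanh a * tanh (b - a) by rewrite ltr_pwDl// mulr_ge0// tanh_ge0.
  have cJ : conjc ((tanh a)%:C * om) = (tanh a)%:C * conjc om.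
    by rewrite rmorphM; congr (_ * _); rewrite /= oppr0.
  rewrite /mobius cJ mul1r.
  have -> : (tanh a)%:C * (conjc om) * ((tanh (b - a))%:C * om) = (tanh a * tanh (b - a))%:C.
    by rewrite mulrACA (mulrC (conjc om)) mul_conj om1 expr1n mulr1 -rmorphM.
  have -> (u : R) : 1 + u%:C = (1 + u)%:C :> C by rewrite rmorphD rmorph1.
  rewrite -mulrDl -rmorphD.
  by rewrite mulrAC -fmorphV -rmorphM.
have P0 := poincare_ge0 t1; set P := poincare0 t in P0 *.
have gP : g P = f t by rewrite /g tanh_poincare// -tE.
pose sig a := if a <= P then g a else tau (a - P).
have s0 := chain_ge0 cs.
exists sig; split.
- by rewrite /sig P0 /g tanh0 rmorph0 mul0r.
- rewrite /sig; case: ifPn => [h|_]; last by rewrite (addrC P) addrK.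
  have sE : s = 0 by lra.
  by rewrite -ts sE t0 addr0.
- move=> a /andP[a0 aS]; rewrite /sig; case: ifPn => aP; first exact: (hf _ (pt1 a a0)).1.
  by apply: tO; lra.
move=> a b a0 ab bS; rewrite /sig; case: ifPn => aP; case: ifPn => bP.
- exact: gc.
- have := chain_cat (gc _ _ a0 aP) (_ : chain O (g P) (tau (b - P)) (b - P)).
  rewrite (_ : P - a + (b - P) = b - a); last by ring.
  by apply; rewrite gP -t0 -[X in chain _ _ _ X]subr0; apply: tc; lra.
- lra.
by rewrite (_ : b - a = b - P - (a - P)); [apply: tc; lra|ring].
Qed.

Definition epath O eps s (tau : R -> pt) := [/\ 0 <= s, forall a, 0 <= a <= s -> O (tau a) &
  forall a b, 0 <= a -> a <= b -> b <= s -> b - a - eps <= kob O (tau a) (tau b) <= b - a].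

(** A chain exceeding the distance of its ends by at most eps exceeds it by at most eps on every
    subinterval too, by the triangle inequality on the three pieces. *)
Lemma epath_exists O x y eps : chainable O -> O x -> O y -> 0 < eps ->
  exists s tau, [/\ epath O eps s tau, tau 0 = x & tau s = y].
Proof.
move=> cO Ox Oy e0; have [s sle cs] := kob_chain cO Ox Oy e0.
have [tau [t0 ts tO tc]] := chain_path Ox cs; exists s, tau; split => //; split => //.
  exact: chain_ge0 cs.
move=> a b a0 ab bs; apply/andP; split; last by apply: kob_le; exact: tc.
have Oa : O (tau a) by apply: tO; rewrite a0 (le_trans ab).
have Ob : O (tau b) by apply: tO; rewrite bs (le_trans a0).
have h1 : kob O x (tau a) <= a.
  by rewrite -t0 -[leRHS]subr0; apply: kob_le; apply: tc => //; exact: le_trans bs.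
have h2 : kob O (tau b) y <= s - b.
  by rewrite -ts; apply: kob_le; apply: tc => //; exact: le_trans ab.
have := kobD cO Ox Oa Oy; have := kobD cO Oa Ob Oy; lra.
Qed.

Lemma epath_rev O eps s tau : epath O eps s tau -> epath O eps s (fun a => tau (s - a)).
Proof.
move=> [s0 tO tk]; split => //.
  by move=> a /andP[a0 ale]; apply: tO; lra.
move=> a b a0 ab bs; rewrite kobC; have := tk (s - b) (s - a).
by rewrite (_ : s - a - (s - b) = b - a); [apply; lra|ring].
Qed.

Lemma epath_sub O eps s tau a b : 0 <= a -> a <= b -> b <= s -> epath O eps s tau ->
  epath O eps (b - a) (fun c => tau (a + c)).
Proof.
move=> a0 ab bs [s0 tO tk]; split; first by rewrite subr_ge0.
  by move=> c /andP[c0 cle]; apply: tO; lra.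
move=> c c' c0 cc c's; have := tk (a + c) (a + c').
by rewrite (_ : a + c' - (a + c) = c' - c); [apply; lra|ring].
Qed.

Lemma chain_aff O x y s (M : 'M[C]_d) (v : pt) : chain O x y s ->
  chain (aff M v @` O) (aff M v x) (aff M v y) s.
Proof.
elim=> {x y s} [x|x y t f s hf t1 <- _ ih]; first exact: chain0.
refine (@chainS _ _ _ _ (aff M v \o f) _ _ t1 erefl ih) => z z1.
by have [fO df] := hf z z1; split; [exists (f z)|exact: cdiff_aff].
Qed.

Lemma kob_aff O x y (M : 'M[C]_d) (v : pt) : M \in unitmx ->
  kob (aff M v @` O) (aff M v x) (aff M v y) = kob O x y.
Proof.
move=> uM; rewrite !kobE; congr inf; apply/seteqP; split => s; last exact: chain_aff.
move=> /(@chain_aff _ _ _ _ (invmx M) (- (v *m invmx M))).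
have K z : aff (invmx M) (- (v *m invmx M)) (aff M v z) = z.
  by rewrite /aff mulmxDl mulmxK// addrK.
rewrite !K image_comp (_ : _ @` O = O)//.
by apply/seteqP; split => [_ [z Oz <-] /=|z Oz]; [rewrite K|exists z => //=; rewrite K].
Qed.

(** One disc multiplies the real part by at most E = exp(2 poincare0 t), so the bounds telescope:
    (exp(2s) - 1) E + (E - 1) = exp(2s) E - 1. *)
Lemma half_plane_chain O w (c : C) x y s : (forall z, O z -> 0 < complex.Re (lf w z + c)) ->
  O x -> chain O x y s ->
  cabs (lf w y - lf w x) <= (expR (2 * s) - 1) * complex.Re (lf w x + c).
Proof.
move=> h0 + ch; elim: ch => {x y s} [x _|x y t f s hf t1 <- cs ih _].
  by rewrite mulr0 expR0 !subrr cabs0 mul0r.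
have ft := (hf t t1).1; have u0 : cabs (0 : C) < 1 by rewrite cabs0.
have f0 : O (f 0) := (hf 0 u0).1.
have {}ih := ih ft.
have h1 := @half_plane_growth R (fun u : C => lf w (f u) + c) t.
have {}h1 : cabs (lf w (f t) - lf w (f 0)) <= (expR (2 * poincare0 t) - 1) * complex.Re (lf w (f 0) + c).
  have -> : lf w (f t) - lf w (f 0) = lf w (f t) + c - (lf w (f 0) + c) by ring.
  have -> : expR (2 * poincare0 t) - 1 = 2 * cabs t / (1 - cabs t).
    by rewrite expR_poincare//; field; rewrite lt0r_neq0// subr_gt0.
  apply: h1 => // z z1; have [fO /cdiff_atP[L dL]] := hf z z1; last exact: h0.
  by exists (lf w L); exact: cder_lf.
set u := complex.Re (lf w (f 0) + c) in h1 *; set v := complex.Re (lf w (f t) + c) in ih.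
set E := expR (2 * poincare0 t) in h1.
have vu : v <= E * u.
  have : v - u <= (E - 1) * u.
    rewrite (le_trans _ h1)// (le_trans _ (Re_le_cabs _))// (le_trans _ (ler_norm _))//.
    by rewrite /v /u !cReD !cReN; lra.
  by rewrite mulrBl mul1r lerD2r.
have s0 : 0 <= expR (2 * s) - 1.
  by have := expR_ge1Dx (2 * s); have := chain_ge0 cs; lra.
have -> : lf w y - lf w (f 0) = (lf w y - lf w (f t)) + (lf w (f t) - lf w (f 0)) by ring.
rewrite (le_trans (cabsD _ _))// mulrDr expRD -/E.
have : (expR (2 * s) - 1) * v <= (expR (2 * s) - 1) * (E * u) by rewrite ler_wpM2l.
lra.
Qed.

End Chains.
(** * Limits along an ultrafilter *)

Section UltraLimits.
Context {R : realType} {d : nat} {U : set_system nat} {UU : UltraFilter U}.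
Local Notation C := (R[i]).
Local Notation pt := 'rV[C]_d.
Implicit Types (P Q : nat -> Prop) (x y : nat -> pt) (l p q : pt).

Lemma ultraN P : ~ (\forall n \near U, P n) -> \forall n \near U, ~ P n.
Proof. by move=> nP; have [|] := in_ultra_setVsetC [set n | P n] UU. Qed.

Lemma ultra_ex P : (\forall n \near U, P n) -> exists n, P n.
Proof. exact: filter_ex. Qed.

Lemma ultra_cst (P : Prop) : (\forall n \near U, P) -> P.
Proof. by case/ultra_ex. Qed.

(** The limit is the supremum of the t below [a n] for almost all n; that an ultrafilter decides
    every property gives the other inequality. *)
Lemma ultra_real (a : nat -> R) (m : R) : (\forall n \near U, `|a n| <= m) ->
  exists c : R, forall e : R, 0 < e -> \forall n \near U, `|a n - c| < e.
Proof.
move=> am; pose S := [set t : R | \forall n \near U, t <= a n].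
have Sm : ubound S m.
  move=> t St; apply: ultra_cst; apply: filterS2 St am => n ta.
  by rewrite ler_norml => /andP[_]; exact: le_trans.
have S0 : S (- m) by apply: filterS am => n; rewrite ler_norml => /andP[].
have hs : has_sup S by split; [exists (- m)|exists m].
exists (sup S) => e e0.
have [t St lt] := sup_adherent e0 hs.
have : \forall n \near U, ~ (sup S + e <= a n).
  by apply: ultraN => H; have := ub_le_sup hs.2 H; lra.
apply: filterS2 St => n ta /negP; rewrite -ltNge ltr_norml => h.
by apply/andP; split; lra.
Qed.

Definition ulim x l := forall e : R, 0 < e -> \forall n \near U, vnorm (x n - l) < e.

Lemma ultra_vec x (m : R) : (\forall n \near U, vnorm (x n) <= m) -> exists l, ulim x l.
Proof.
move=> xm.
have coord (i : 'I_d) : exists c : C, forall e : R, 0 < e -> \forall n \near U, cabs (x n 0 i - c) < e.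
  have [|a ha] := @ultra_real (fun n => complex.Re (x n 0 i)) m.
    apply: filterS xm => n; apply: le_trans.
    by rewrite (le_trans (Re_le_cabs _))// coord_le_vnorm.
  have [|b hb] := @ultra_real (fun n => complex.Im (x n 0 i)) m.
    apply: filterS xm => n; apply: le_trans.
    by rewrite (le_trans (Im_le_cabs _))// coord_le_vnorm.
  exists (a +i* b) => e e0; have e2 : 0 < e / 2 by rewrite divr_gt0.
  apply: filterS2 (ha _ e2) (hb _ e2) => n h1 h2.
  rewrite (le_lt_trans (cabs_le_ReIm _))// cReD cReN cImD cImN /= [e]splitr.
  exact: ltrD.
have [c hc] := choice coord; exists (\row_i c i) => e e0.
have ed : 0 < e / 2 / d.+1%:R by rewrite !divr_gt0.
have : \forall n \near U, forall i, cabs (x n 0 i - c i) < e / 2 / d.+1%:R.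
  by apply: filter_forall => i; exact: hc.
apply: filterS => n h; rewrite (@le_lt_trans _ _ (d.+1%:R * (e / 2 / d.+1%:R)))//.
  by apply: vnorm_le_coord => [|i]; [exact: ltW|rewrite !mxE ltW].
by rewrite mulrC divfK// ltr_pdivrMr// ltr_pMr// ltr1n.
Qed.

Lemma ulim_cst l : ulim (fun=> l) l.
Proof. by move=> e e0; apply: nearW => n; rewrite subrr vnorm0. Qed.

Lemma ulimD x y l p : ulim x l -> ulim y p -> ulim (fun n => x n + y n) (l + p).
Proof.
move=> hx hy e e0; have e2 : 0 < e / 2 by rewrite divr_gt0.
apply: filterS2 (hx _ e2) (hy _ e2) => n h1 h2.
by rewrite opprD addrACA (le_lt_trans (vnormD _ _))// [e]splitr ltrD.
Qed.

Lemma ulimZ x l (c : C) : ulim x l -> ulim (fun n => c *: x n) (c *: l).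
Proof.
move=> hx e e0; have c0 : 0 < cabs c + 1 by rewrite ltr_wpDl ?cabs_ge0.
have ec : 0 < e / (cabs c + 1) by rewrite divr_gt0.
apply: filterS (hx _ ec) => n; rewrite ltr_pdivlMr// => h.
rewrite -scalerBr vnormZ (le_lt_trans _ h)// mulrC ler_wpM2l ?vnorm_ge0//.
by rewrite lerDl.
Qed.

Lemma ulim_bounded x l : ulim x l -> \forall n \near U, vnorm (x n) <= vnorm l + 1.
Proof.
move=> /(_ 1 ltr01); apply: filterS => n h.
by have := vnormD (x n - l) l; rewrite subrK; lra.
Qed.

Lemma ulim_dist_le x y l p (r : R) : ulim x l -> ulim y p ->
  (\forall n \near U, vnorm (x n - y n) <= r) -> vnorm (l - p) <= r.
Proof.
move=> hx hy h; apply/ler_addgt0Pr => e e0; have e2 : 0 < e / 2 by rewrite divr_gt0.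
apply: ultra_cst; apply: filterS3 h (hx _ e2) (hy _ e2) => n h1 h2 h3.
have := vdistD (x n) l p; have := vdistD (y n) (x n) p; rewrite (vdistC l (x n)); lra.
Qed.

End UltraLimits.

Lemma free_ultrafilter : exists U : set_system nat, UltraFilter U /\ \oo `<=` U.
Proof. exact: ultraFilterLemma. Qed.
(** * Convex sets *)

Section Convex.
Context {R : realType} {d : nat}.
Local Notation C := (R[i]).
Local Notation pt := 'rV[C]_d.
Implicit Types (O : set pt) (x y p q u v : pt) (r s : R).

Definition ball_in O p r := forall q, vnorm (q - p) < r -> O q.

Definition mix s p q : pt := (1 - s)%:C *: p + s%:C *: q.

Lemma mix0 p q : mix 0 p q = p.
Proof. by rewrite /mix subr0 rmorph1 rmorph0 scale1r scale0r addr0. Qed.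

Lemma mix1 p q : mix 1 p q = q.
Proof. by rewrite /mix subrr rmorph1 rmorph0 scale1r scale0r add0r. Qed.

Lemma mixB s s' p q : mix s p q - mix s' p q = (s - s')%:C *: (q - p).
Proof. by apply/rowP => i; rewrite !mxE; ring. Qed.

Lemma is_openP O p : is_open O -> O p -> exists2 r, 0 < r & ball_in O p r.
Proof. by move=> oO /oO[r [r0 H]]; exists r. Qed.

Lemma ball_in_center O p r : 0 < r -> ball_in O p r -> O p.
Proof. by move=> r0; apply; rewrite subrr vnorm0. Qed.

Lemma ball_in_le O p r r' : r' <= r -> ball_in O p r -> ball_in O p r'.
Proof. by move=> rr H q qr; apply: H; exact: lt_le_trans rr. Qed.

Lemma ball_in_shift O p q r r' : vnorm (q - p) + r' <= r -> ball_in O p r -> ball_in O q r'.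
Proof.
move=> h H x xq; apply: H; rewrite (le_lt_trans (vdistD q _ _))//.
by rewrite addrC (lt_le_trans _ h)// ltrD2l.
Qed.

Lemma ball_in_mix O p u r s : is_convex O -> O p -> ball_in O u r -> 0 < s -> s <= 1 ->
  ball_in O (mix s p u) (s * r).
Proof.
move=> cO Op Bu s0 s1 q qr.
have sC : s%:C != 0 :> C by rewrite -cabs_eq0 cabs_real normr_eq0 lt0r_neq0.
pose u' := u + s^-1%:C *: (q - mix s p u).
have -> : q = mix s p u'.
  by apply/rowP => i; rewrite /u' /mix !mxE fmorphV /=; field.
apply: cO => //; last by rewrite ltW.
apply: Bu; rewrite /u' addrC addKr vnormZr gtr0_norm ?invr_gt0//.
by rewrite mulrC ltr_pdivrMr// mulrC.
Qed.

(** A point of O within s r of q replaces q: the homothetic ball of radius s r about its mixture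
    with u still contains the mixture of q. *)
Lemma closure_mix O q u r s : is_convex O -> 0 < r -> ball_in O u r -> closure_set O q ->
  0 < s -> s <= 1 -> O (mix s q u).
Proof.
move=> cO r0 Bu cq s0 s1.
have [q' [Oq' qq]] := cq _ (mulr_gt0 s0 r0).
apply: (ball_in_mix cO Oq' Bu s0 s1).
have -> : mix s q u - mix s q' u = (1 - s)%:C *: (q - q').
  by apply/rowP => i; rewrite !mxE; ring.
rewrite vnormZr ger0_norm ?subr_ge0// (le_lt_trans _ qq)//.
by rewrite ler_piMl ?vnorm_ge0//; lra.
Qed.

Lemma chain_ball O p y r : ball_in O p r -> vnorm (y - p) < r ->
  chain O p y (poincare0 (vnorm (y - p) / r)%:C).
Proof.
move=> Bp yr; have r0 : 0 < r := le_lt_trans (vnorm_ge0 _) yr.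
set a := vnorm (y - p) in yr *; have a0 : 0 <= a := vnorm_ge0 _.
have [aE|an] := eqVneq a 0.
  have /eqP : y - p = 0 by apply/eqP; rewrite -vnorm_eq0; apply/eqP.
  rewrite subr_eq0 => /eqP ->; rewrite aE mul0r poincare0_0; exact: chain0.
pose w := (r / a)%:C *: (y - p).
have wr : vnorm w = r.
  by rewrite vnormZr ger0_norm ?divr_ge0 ?(ltW r0)// divfK.
have hf : holo_disc O (fun z : C => p + z *: w).
  move=> z z1; split; last exact: cdiff_affine.
  apply: Bp; rewrite addrC addKr vnormZ wr.
  by rewrite gtr_pMl.
have t1 : cabs ((a / r)%:C : C) < 1.
  by rewrite cabs_real ger0_norm ?divr_ge0 ?(ltW r0)// ltr_pdivrMr// mul1r.
have := chain1 hf t1; rewrite scale0r addr0 /w scalerA -rmorphM.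
have -> : a / r * (r / a) = 1 by field; rewrite an lt0r_neq0.
by rewrite rmorph1 scale1r addrC subrK.
Qed.

(** By convexity the smaller of the radii available at the two ends is available all along the
    segment, which is crossed in steps shorter than this radius. *)
Lemma chainable_convex O : is_convex O -> is_open O -> chainable O.
Proof.
move=> cO oO x y Ox Oy.
have [r r0 Bx] := is_openP oO Ox; have [r' r'0 By] := is_openP oO Oy.
pose e := Num.min r r'; have e0 : 0 < e by rewrite lt_min r0.
have Be s : 0 <= s <= 1 -> ball_in O (mix s x y) e.
  move=> /andP[s0 s1] q qe.
  have -> : q = mix s (x + (q - mix s x y)) (y + (q - mix s x y)).
    by apply/rowP => i; rewrite !mxE; ring.
  apply: cO; last by rewrite s0.
    by apply: Bx; rewrite addrC addKr (lt_le_trans qe)// ge_min lexx.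
  by apply: By; rewrite addrC addKr (lt_le_trans qe)// ge_min lexx orbT.
pose n := Num.bound (vnorm (y - x) / e).
have n0 : 0 < n.+1%:R :> R by rewrite ltr0n.
have step k : (k <= n.+1)%N -> exists s, chain O x (mix (k%:R / n.+1%:R) x y) s.
  elim: k => [_|k ih kn].
    by exists 0; rewrite mul0r mix0; exact: chain0.
  have [s cs] := ih (ltnW kn).
  have kI : 0 <= (k%:R / n.+1%:R : R) <= 1.
    by apply/andP; split; [exact: divr_ge0|rewrite ler_pdivrMr// mul1r ler_nat ltnW].
  eexists; apply: chain_cat cs _; apply: (chain_ball (Be _ kI)).
  rewrite mixB -mulrBl -natrB// subSnn vnormZr ger0_norm ?divr_ge0//.
  rewrite mul1r mulrC ltr_pdivrMr// mulrC -ltr_pdivrMr//.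
  rewrite (lt_le_trans (archi_boundP _)) ?divr_ge0 ?vnorm_ge0 ?(ltW e0)//.
  by rewrite ler_nat.
by have := step _ (leqnn _); rewrite divff ?lt0r_neq0// mix1.
Qed.

Lemma rdot_limit_ge0 (U : set_system nat) (UU : UltraFilter U) (a b : nat -> pt) x y :
  ulim (U := U) a x -> ulim (U := U) b y -> (\forall n \near U, 0 <= rdot (a n) (b n)) ->
  0 <= rdot x y.
Proof.
move=> ha hb H; apply/ler_addgt0Pr => e e0.
pose K := vnorm x + vnorm y + 2.
have K0 : 0 < K by rewrite ltr_wpDl// addr_ge0 ?vnorm_ge0.
have eK : 0 < e / K by rewrite divr_gt0.
apply: (@ultra_cst U); near=> n.
have h0 : 0 <= rdot (a n) (b n) by near: n.
have h1 : vnorm (a n - x) < e / K by near: n; exact: ha.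
have h2 : vnorm (b n - y) < e / K by near: n; exact: hb.
have h3 : vnorm (b n) <= vnorm y + 1 by near: n; exact: ulim_bounded.
have E : rdot (a n) (b n) = rdot (a n - x) (b n) + rdot x (b n - y) + rdot x y.
  by rewrite rdotDl rdotDr rdotNl rdotNr; ring.
have l1 : rdot (a n - x) (b n) <= e / K * (vnorm y + 1).
  by rewrite (le_trans (rdot_le _ _))// ler_pM ?vnorm_ge0// ltW.
have l2 : rdot x (b n - y) <= vnorm x * (e / K).
  by rewrite (le_trans (rdot_le _ _))// ler_wpM2l ?vnorm_ge0// ltW.
have eE : e = e / K * K by rewrite divfK// lt0r_neq0.
rewrite eE; have := ltW eK; move: h0; rewrite E /K; lra.
Unshelve. all: by end_near.
Qed.

Lemma separation_far O q (m : R) : is_convex O -> 0 < m -> (exists u, O u) ->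
  (forall x, O x -> m <= vnorm (x - q)) ->
  exists2 v, vnorm v = 1 & forall x, O x -> 0 <= rdot (x - q) v.
Proof.
move=> cO m0 [u Ou] far.
have [U [UU Uoo]] := free_ultrafilter.
pose D := [set vnorm (x - q) | x in O].
have hD : has_inf D.
  by split; [exists (vnorm (u - q)); exists u|exists m => _ [x Ox <-]; exact: far].
pose mm := inf D.
have mm0 : 0 < mm.
  by rewrite (lt_le_trans m0)//; apply: lb_le_inf => [|_ [x Ox <-]]; [exact: hD.1|exact: far].
have mmle x : O x -> mm <= vnorm (x - q) by move=> Ox; apply: ge_inf; [exact: hD.2|exists x].
have /choice[a aP] : forall n : nat, exists x, O x /\ vnorm (x - q) < mm + n.+1%:R^-1.
  move=> n; have [|_ [x Ox <-] h] := @inf_adherent R D n.+1%:R^-1 _ hD; last by exists x.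
  by rewrite invr_gt0 ltr0n.
have a_lim : forall e : R, 0 < e -> \forall n \near U, n.+1%:R^-1 < e.
  move=> e e0; apply: Uoo; exists (Num.bound e^-1) => // n /= hn.
  rewrite invf_plt ?posrE ?ltr0n// (lt_le_trans (archi_boundP _)) ?invr_ge0 ?(ltW e0)//.
  by rewrite ler_nat ltnW.
have [|b hb] := @ultra_vec R d U UU a (mm + 1 + vnorm q).
  apply: nearW => n; have := vnormD (a n - q) q; rewrite subrK.
  have := (aP n).2; have : n.+1%:R^-1 <= 1 :> R by rewrite invf_le1 ?ltr0n// ler1n.
  set t := _^-1; lra.
have bq : vnorm (b - q) = mm.
  apply/eqP; rewrite eq_le; apply/andP; split; apply/ler_addgt0Pr => e e0;
    have e2 : 0 < e / 2 by rewrite divr_gt0.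
    apply: (@ultra_cst U); apply: filterS2 (hb _ e2) (a_lim _ e2) => n h1 h2.
    have := vdistD (a n) b q; rewrite (vdistC b (a n)); have := (aP n).2.
    by move: h2; set t := _^-1; lra.
  apply: (@ultra_cst U); apply: filterS (hb _ e2) => n h1.
  have := vdistD b (a n) q; have := mmle _ (aP n).1; lra.
exists (mm^-1%:C *: (b - q)).
  by rewrite vnormZr bq gtr0_norm ?invr_gt0// mulVf// lt0r_neq0.
move=> x Ox; rewrite rdotZr mulr_ge0 ?invr_ge0 ?(ltW mm0)//.
(* The nearest point b lies in the closure of O. Moving from b towards x cannot approach q; this is
   the expansion of the squared distance, divided by s. *)
have obt s : 0 < s -> s <= 1 -> 0 <= 2 * rdot (x - b) (b - q) + s * vnorm (x - b) ^+ 2.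
  move=> s0 s1.
  have : mm <= vnorm (mix s b x - q).
    apply/ler_addgt0Pr => e e0; apply: (@ultra_cst U); apply: filterS (hb _ e0) => n h1.
    have h2 := mmle _ (cO _ _ (aP n).1 Ox s _); rewrite -/(mix s (a n) x) in h2.
    have := vdistD (mix s b x) (mix s (a n) x) q.
    have -> : mix s (a n) x - mix s b x = (1 - s)%:C *: (a n - b).
      by apply/rowP => i; rewrite !mxE; ring.
    rewrite vnormZr ger0_norm ?subr_ge0// => h3.
    have h4 : (1 - s) * vnorm (a n - b) <= vnorm (a n - b).
      by rewrite ler_piMl ?vnorm_ge0//; lra.
    have := h2 (_ : 0 <= s <= 1); rewrite s1 ltW// => /(_ isT); lra.
  rewrite -ler_sqr ?nnegrE ?vnorm_ge0 ?(ltW mm0)// -bq !vnorm_sq.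
  have -> : mix s b x - q = (b - q) + s%:C *: (x - b).
    by apply/rowP => i; rewrite !mxE; ring.
  rewrite !(rdotDl, rdotDr, rdotZl, rdotZr, rdotNl, rdotNr) !(rdotC b) !(rdotC q x).
  move=> H; rewrite -(pmulr_rge0 _ s0); lra.
have -> : x - q = (x - b) + (b - q) by rewrite addrA subrK.
rewrite rdotDl -(vnorm_sq (b - q)) addr_ge0 ?sqr_ge0//.
rewrite leNgt; apply/negP => neg.
set A := rdot _ _ in neg obt; set B := vnorm _ ^+ 2 in obt.
have B0 : 0 <= B by exact: sqr_ge0.
have D0 : 0 < B + 1 - A by lra.
(* For a negative A this s lies in (0, 1] and satisfies s B < - A, so the first order term wins. *)
have := obt (- A / (B + 1 - A)); rewrite divr_gt0 ?oppr_gt0// ler_pdivrMr// => /(_ isT).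
rewrite mul1r => /(_ _)/wrap[|]; first by lra.
rewrite leNgt => /negP; apply.
have : - A / (B + 1 - A) * B < - A.
  by rewrite mulrAC ltr_pdivrMr// ltr_pM2l ?oppr_gt0//; lra.
lra.
Qed.

(** As q may be a boundary point, it is first pushed away from u to [qn n]. If [qn n] were in the
    closure, then q, a mixture of it with u of weight 1 / (n + 2), would be in O. The unit normals
    at [qn n] have a limit, and openness makes the limit inequality strict. *)
Lemma separation_unit O q u : is_convex O -> is_open O -> O u -> ~ O q ->
  exists2 v, vnorm v = 1 & forall x, O x -> 0 < rdot (x - q) v.
Proof.
move=> cO oO Ou nq.
have [U [UU Uoo]] := free_ultrafilter.
have [r r0 Bu] := is_openP oO Ou.
pose qn (n : nat) : pt := q + n.+1%:R^-1%:C *: (q - u).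
have /choice[a aP] : forall n, exists v, vnorm v = 1 /\ forall x, O x -> 0 <= rdot (x - qn n) v.
  move=> n; have [[m [m0 far]]|nfar] := pselect (exists m : R, 0 < m /\ forall x, O x -> m <= vnorm (x - qn n)).
    by have [|v v1 hv] := separation_far cO m0 _ far; [exists u|exists v].
  have n2 : 0 < n.+2%:R^-1 :> R by rewrite invr_gt0 ltr0n.
  have n21 : n.+2%:R^-1 <= 1 :> R by rewrite invf_le1 ?ltr0n// ler1n.
  case: nq; have := @closure_mix O (qn n) u r _ cO r0 Bu _ n2 n21.
  have -> : mix n.+2%:R^-1 (qn n) u = q.
    have h1 : n.+1%:R != 0 :> C by rewrite pnatr_eq0.
    have h2 : n.+2%:R != 0 :> C by rewrite pnatr_eq0.
    have E : n.+2%:R = n.+1%:R + 1 :> C by rewrite -natr1.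
    have key (N a1 a2 : C) : N != 0 -> N + 1 != 0 ->
        (1 - (N + 1)^-1) * (a1 + N^-1 * (a1 - a2)) + (N + 1)^-1 * a2 = a1.
      by move=> N0 N1; field; rewrite N0 N1.
    apply/rowP => i; rewrite /mix /qn !mxE rmorphB rmorph1 !fmorphV !rmorph_nat E.
    by apply: key; rewrite -?E.
  apply=> e e0; apply/not_existsP => H; apply: nfar; exists e; split => // x Ox.
  by rewrite leNgt; apply/negP => h; apply: (H x); split => //; rewrite vdistC.
have [|v hv] := @ultra_vec R d U UU a 1; first by apply: nearW => n; rewrite (aP n).1.
have v1 : vnorm v = 1.
  apply/eqP; rewrite eq_le; apply/andP; split; apply/ler_addgt0Pr => e e0;
  apply: (@ultra_cst U); apply: filterS (hv _ e0) => n; have := (aP n).1.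
    by have := vnormB (a n) (a n - v); rewrite opprB addrC subrK; lra.
  by have := vnormD v (a n - v); rewrite addrC subrK; lra.
have hq : ulim (U := U) qn q.
  move=> e e0; apply: Uoo; exists (Num.bound ((vnorm (q - u)) / e)) => // n /= hn.
  rewrite /qn addrC addKr vnormZr ger0_norm ?invr_ge0 ?ler0n// mulrC ltr_pdivrMr ?ltr0n//.
  rewrite mulrC -ltr_pdivrMr// (lt_le_trans (archi_boundP _)) ?divr_ge0 ?vnorm_ge0 ?(ltW e0)//.
  by rewrite ler_nat ltnW.
have weak x : O x -> 0 <= rdot (x - q) v.
  move=> Ox; apply: (@rdot_limit_ge0 U UU (fun n => x - qn n) a) => //.
    move=> e e0; apply: filterS (hq _ e0) => n.
    rewrite -(vnormN (qn n - q)); move: (qn n) => y.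
    by rewrite (_ : - (y - q) = x - y - (x - q))//; apply/rowP => i; rewrite !mxE; ring.
  by apply: nearW => n; exact: (aP n).2.
exists v => // x Ox.
have [t t0 Bx] := is_openP oO Ox.
(* A point of O behind x along the normal, where the weak inequality reads rdot (x - q) v >= t /
   2. *)
have h := weak (x - (t / 2)%:C *: v).
have {h} : 0 <= rdot (x - (t / 2)%:C *: v - q) v.
  apply: h; apply: Bx; rewrite addrC addrA addNr add0r vnormN vnormZr v1 mulr1.
  by rewrite gtr0_norm ?divr_gt0// ltr_pdivrMr// ltr_pMr// ltr1n.
have -> : x - (t / 2)%:C *: v - q = (x - q) + (- (t / 2))%:C *: v.
  by apply/rowP => i; rewrite !mxE; ring.
rewrite [rdot (_ + _ *: _) _]rdotDl rdotZl -(vnorm_sq v) v1 expr1n mulr1 => h.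
have : 0 < t / 2 by rewrite divr_gt0.
lra.
Qed.

(** Makes a real half-space the preimage of a half-plane under a complex linear form, to which the
    estimates for discs apply. *)
Lemma Re_lf_conj u v : complex.Re (lf (\row_i conjc (v 0 i)) u) = rdot u v.
Proof.
apply: (big_ind2 (fun (a : C) b => complex.Re a = b)) => // [a' b' c e <- <-|i _].
  by rewrite cReD.
rewrite !mxE; case: (u 0 i) => a1 a2; case: (v 0 i) => c1 c2 /=.
by ring.
Qed.

Lemma separation O q : is_convex O -> is_open O -> ~ O q ->
  exists w : pt, forall x, O x -> 0 < complex.Re (lf w (x - q)).
Proof.
move=> cO oO nq.
have [[u Ou]|no] := pselect (exists u, O u); last by exists 0 => x Ox; case: no; exists x.
have [v _ hv] := separation_unit cO oO Ou nq.
by exists (\row_i conjc (v 0 i)) => x Ox; rewrite Re_lf_conj hv.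
Qed.

End Convex.
(** * Kobayashi and Euclidean distances in convex sets *)

Section Estimates.
Context {R : realType} {d : nat}.
Local Notation C := (R[i]).
Local Notation pt := 'rV[C]_d.
Implicit Types (O : set pt) (x y p q u v w : pt) (r s T : R).

Lemma half_plane_kob O w q x y T : is_convex O -> is_open O ->
  (forall z, O z -> 0 < complex.Re (lf w (z - q))) -> O x -> O y -> kob O x y < T ->
  cabs (lf w (y - x)) <= (expR (2 * T) - 1) * complex.Re (lf w (x - q)).
Proof.
move=> cO oO hw Ox Oy kT.
have [s sT cs] := kob_lt (chainable_convex cO oO) Ox Oy kT.
have E z : lf w (z - q) = lf w z + - lf w q by rewrite lfD lfN.
rewrite lfD lfN E; apply: (le_trans (half_plane_chain (c := - lf w q) _ Ox cs)) => [z /hw|].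
  by rewrite E.
apply: ler_wpM2r; first by rewrite -E ltW// hw.
by rewrite lerD2r ler_expR ler_pM2l// ltW.
Qed.

(* The Kobayashi metric is bounded below by that of a half-plane missing [q];
   on the complex line through [x] and [y] this controls Euclidean lengths. *)
Lemma kob_line_bound O x y (l : C) T : is_convex O -> is_open O -> O x -> O y ->
  kob O x y < T -> ~ O (x + l *: (y - x)) -> 1 <= (expR (2 * T) - 1) * cabs l.
Proof.
move=> cO oO Ox Oy kT nq; have [w hw] := separation cO oO nq.
have := half_plane_kob cO oO hw Ox Oy kT; have := hw x Ox.
rewrite opprD addrA addrN add0r lfN lfZ; set a := lf w (y - x) => h1 h2.
have T0 : 0 <= expR (2 * T) - 1.
  by have := expR_ge1Dx (2 * T); have := kob_ge0 O x y; lra.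
have a0 : 0 < cabs a.
  rewrite cabs_gt0; apply/eqP => a0; move: h1.
  by rewrite a0 mulr0 cReN /= oppr0 ltxx.
rewrite -(ler_pM2r a0) mul1r (le_trans h2)// -mulrA ler_wpM2l//.
by rewrite -cabsM -cabsN (le_trans _ (Re_le_cabs _))// ler_norm.
Qed.

Lemma kob_dir_bound O x y T : C_proper O -> is_convex O -> is_open O -> O x -> O y ->
  kob O x y < T -> y != x -> vnorm (y - x) <= (expR (2 * T) - 1) * bdist_dir O x (y - x).
Proof.
move=> pO cO oO Ox Oy kT yx.
have T0 : 0 < expR (2 * T) - 1.
  by have := expR_ge1Dx (2 * T); have := kob_ge0 O x y; lra.
rewrite -ler_pdivrMl// /bdist_dir; apply: lb_le_inf.
  (* Properness provides a point of the complex line outside O; otherwise the infimum would be the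
     default value 0. *)
  apply/set0P/eqP => E; apply: pO; exists x, (y - x); split; first by rewrite subr_eq0.
  move=> l; apply: contrapT => nq; have : set0 (vnorm (x + l *: (y - x) - x)); last by [].
  by rewrite -E; exists (x + l *: (y - x)) => //; split => //; exists l.
move=> _ [q [[l _ <-] nq] <-]; rewrite (addrC x) addrK vnormZ ler_pdivrMl// mulrA.
rewrite -[leLHS]mul1r ler_wpM2r ?vnorm_ge0//.
exact: kob_line_bound kT nq.
Qed.

(** Suppose q near p is missing. The half-plane at q controls u - p by exp(2T) - 1 times the height
    of p; hence u + exp(2T) (q - p), a point of the ball about u, would have nonpositive height. *)
Lemma ball_in_kob O u p r T : is_convex O -> is_open O -> 0 < r -> ball_in O u r -> O p ->
  kob O u p < T -> ball_in O p (expR (- (2 * T)) * r).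
Proof.
move=> cO oO r0 Bu Op kT q qp; apply: contrapT => nq.
have Ou := ball_in_center r0 Bu.
have [w hw] := separation cO oO nq.
have kT' : kob O p u < T by rewrite kobC.
have := half_plane_kob cO oO hw Op Ou kT'; set E := expR (2 * T) => h1.
have E0 : 0 < E := expR_gt0 _.
have : O (u + E%:C *: (q - p)).
  apply: Bu; rewrite addrC addKr vnormZr gtr0_norm//.
  by move: qp; rewrite expRN mulrC ltr_pdivlMr// mulrC.
move=> /hw.
have -> : u + E%:C *: (q - p) - q = (u - p) + (p - q) - E%:C *: (p - q).
  by apply/rowP => i; rewrite !mxE; ring.
rewrite lfD lfD lfN lfZ !cReD cReN cReMr => h2.
have := ler_norm (complex.Re (lf w (u - p))); have := Re_le_cabs (lf w (u - p)).
lra.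
Qed.

Lemma bdist_ge0 O p : 0 <= bdist O p.
Proof.
rewrite /bdist; set S := [set _ | _ in _].
have [S0|/set0P/negP/negPn/eqP ->] := pselect (S !=set0); last by rewrite inf0.
by apply: lb_le_inf => // _ [z _ <-]; exact: vnorm_ge0.
Qed.

Lemma bdist_ball O p : O p -> ball_in O p (bdist O p).
Proof.
move=> Op q qp; apply: contrapT => nq; move: qp; apply/negP; rewrite -leNgt.
by apply: ge_inf; [exists 0 => _ [z _ <-]; exact: vnorm_ge0|exists q].
Qed.

Lemma kob_ball O p y r : is_convex O -> is_open O -> ball_in O p r -> 0 < r ->
  vnorm (y - p) <= r / 2 -> kob O p y <= 1.
Proof.
move=> cO oO Bp r0 yr.
have yr' : vnorm (y - p) < r by rewrite (le_lt_trans yr)// ltr_pdivrMr// ltr_pMr// ltr1n.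
apply: (le_trans (kob_le (chain_ball Bp yr'))).
have a0 : 0 <= vnorm (y - p) / r by rewrite divr_ge0 ?vnorm_ge0 ?ltW.
have a2 : vnorm (y - p) / r <= 1 / 2 by rewrite ler_pdivrMr//; lra.
rewrite poincare_le cabs_real ger0_norm//; last by lra.
(* At modulus 1/2 the ratio (1 + x) / (1 - x) is 3, and exp 2 >= 3. *)
have := expR_ge1Dx (2 * 1 : R); set E := expR _ => e3; nra.
Qed.

(** The points [x i] go from u towards p. Each has a ball of radius k^i r, and k is chosen so that
    the next point is within half of it, hence at distance at most 1. After j steps half of the
    boundary distance of p covers the rest. *)
Lemma kob_le_bdist O u p r r' (j : nat) : is_convex O -> is_open O -> 0 < r -> r <= r' ->
  ball_in O u r -> O p -> vnorm (u - p) <= r' ->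
  2 * r' * (1 - r / (2 * r')) ^+ j <= bdist O p -> kob O u p <= j.+1%:R.
Proof.
move=> cO oO r0 rr Bu Op up; set k := 1 - _ => hj.
have r'0 : 0 < r' := lt_le_trans r0 rr.
have k0 : 0 < k.
  by rewrite /k subr_gt0 ltr_pdivrMr ?mulr_gt0// mul1r; lra.
have k1 : k <= 1 by rewrite /k lerBlDr lerDl divr_ge0 ?mulr_ge0 ?ltW.
have kj i : 0 < k ^+ i by rewrite exprn_gt0.
have kj1 i : k ^+ i <= 1 by rewrite exprn_ile1// ltW.
pose x i := mix (k ^+ i) p u.
have chO := chainable_convex cO oO.
have Ou := ball_in_center r0 Bu.
have Bx i : ball_in O (x i) (k ^+ i * r) by exact: ball_in_mix.
have Ox i : O (x i) by apply: ball_in_center (Bx i); rewrite mulr_gt0.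
have step i : kob O u (x i) <= i%:R.
  elim: i => [|i ih]; first by rewrite /x expr0 mix1 kob_xx.
  rewrite (le_trans (kobD chO Ou (Ox i) (Ox i.+1)))// -natr1 lerD//.
  apply: (kob_ball cO oO (Bx i)); first by rewrite mulr_gt0.
  rewrite /x mixB vnormZr -[_ - _]opprB normrN exprS ger0_norm; last first.
    by rewrite subr_ge0 ler_piMl// ltW.
  rewrite (le_trans (ler_wpM2l _ up)) ?subr_ge0 ?ler_piMl ?(ltW (kj i))//.
  by rewrite [leLHS](_ : _ = k ^+ i * r / 2)// /k; field; rewrite lt0r_neq0.
rewrite (le_trans (kobD chO Ou (Ox j) Op))// -natr1 lerD// kobC.
have d0 : 0 < bdist O p by rewrite (lt_le_trans _ hj)// !mulr_gt0.
apply: (kob_ball cO oO (bdist_ball Op) d0).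
rewrite /x -{2}(mix0 p u) mixB subr0 vnormZr gtr0_norm//.
rewrite (le_trans (ler_wpM2l (ltW (kj j)) up))//; lra.
Qed.

(** The contrapositive of [kob_le_bdist]: reaching p takes a number of unit steps only logarithmic
    in the inverse of its boundary distance. The constants depend only on r and r', hence serve all
    rescaled domains. *)
Lemma bdist_decay r r' : 0 < r -> r <= r' -> exists A a, [/\ 0 < A, 0 < a &
  forall O u p, is_convex O -> is_open O -> ball_in O u r -> O p -> vnorm (u - p) <= r' ->
    2 <= kob O u p -> bdist O p <= A * expR (- (a * kob O u p))].
Proof.
move=> r0 rr; have r'0 : 0 < r' := lt_le_trans r0 rr.
pose k := 1 - r / (2 * r').
have k0 : 0 < k.
  by rewrite /k subr_gt0 ltr_pdivrMr ?mulr_gt0// mul1r; lra.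
have k1 : k < 1 by rewrite /k ltrBlDr ltrDl divr_gt0 ?mulr_gt0.
exists (2 * r' * expR (- ln k * 3)), (- ln k); split.
- by rewrite mulr_gt0 ?expR_gt0// mulr_gt0.
- by rewrite oppr_gt0 -ln1 ltr_ln ?posrE.
move=> O u p cO oO Bu Op up; set g := kob O u p => g2.
have g0 : 0 <= g by lra.
(* The integer part of g minus 2, a natural number since g >= 2. The rounding loss of at most 3
   accounts for the 3 in the constant. *)
have [j jg gj] : exists2 j : nat, j.+1%:R < g & g < j%:R + 3.
  have := truncn_itv g0; set n := Num.truncn g => /andP[ng gn].
  have n2 : (2 <= n)%N by rewrite -ltnS -(ltr_nat R) (le_lt_trans g2).
  move: ng gn; case: n n2 => [|[|n]]// _ ng gn; exists n.
    by rewrite (lt_le_trans _ ng)// ltr_nat.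
  by rewrite -natrD addnC.
have : bdist O p < 2 * r' * k ^+ j.
  rewrite ltNge; apply/negP => /(kob_le_bdist cO oO r0 rr Bu Op up).
  by rewrite leNgt jg.
move=> /ltW/le_trans; apply; rewrite -[leRHS]mulrA; apply: ler_wpM2l; first by rewrite mulr_ge0// ltW.
rewrite -expRD -[k in leLHS]lnK ?posrE// -expRM_natl ler_expR.
have l0 : ln k < 0 by rewrite -ln1 ltr_ln ?posrE.
rewrite -mulNr opprK; nra.
Qed.

(** With truncated subtraction the exponent is |i - k|; the two one-sided series add up to at most
    (1 + q) / (1 - q). *)
Lemma sum_dist_geometric (q : R) n k : 0 < q -> q < 1 ->
  \sum_(i < n) q ^+ ((i - k) + (k - i)) <= 2 / (1 - q).
Proof.
move=> q0 q1; have d0 : 0 < 1 - q by rewrite subr_gt0.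
have dV : 0 < (1 - q)^-1 by rewrite invr_gt0.
have below j : (j <= k)%N ->
    \sum_(i < j) q ^+ ((i - k) + (k - i)) <= q ^+ (k - j) * q / (1 - q).
  elim: j => [_|j ih jk]; first by rewrite big_ord0 !mulr_ge0 ?exprn_ge0 ?ltW.
  rewrite big_ord_recr /=; apply: (le_trans (lerD (ih (ltnW jk)) (lexx _))).
  have -> : (j - k = 0)%N by apply/eqP; rewrite subn_eq0 ltnW.
  rewrite add0n subnS -{1 2}(prednK (_ : 0 < k - j)%N) ?subn_gt0//.
  move: (k - j).-1 => e; rewrite exprS.
  by rewrite [leLHS](_ : _ = q ^+ e * q / (1 - q))//; field; rewrite lt0r_neq0.
have above j : \sum_(i < k + j) q ^+ ((i - k) + (k - i)) <= (1 + q - q ^+ j) / (1 - q).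
  elim: j => [|j ih].
    rewrite addn0 (le_trans (below _ (leqnn _)))// subnn expr0 mul1r.
    by rewrite addrAC subrr add0r.
  rewrite addnS big_ord_recr /=; apply: (le_trans (lerD ih (lexx _))).
  rewrite addKn; have -> : (k - (k + j) = 0)%N by apply/eqP; rewrite subn_eq0 leq_addr.
  rewrite addn0 exprS.
  by rewrite [leLHS](_ : _ = (1 + q - q * q ^+ j) / (1 - q))//; field; rewrite lt0r_neq0.
have [nk|/ltnW kn] := leqP n k.
  rewrite (le_trans (below _ nk))// ler_wpM2r ?ltW//.
  have : q ^+ (k - n) <= 1 by rewrite exprn_ile1 ?ltW.
  have : 0 < q ^+ (k - n) by rewrite exprn_gt0.
  nra.
rewrite -(subnKC kn) (le_trans (above _))// ler_wpM2r ?ltW//.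
have : 0 < q ^+ (n - k) by rewrite exprn_gt0.
lra.
Qed.

(** A bootstrap: the steps are controlled only inside the ball of radius R0, but the steps already
    made sum to at most eta, so the path has not yet left it. *)
Lemma telescope_stay (p : nat -> pt) (c : nat -> R) (N : nat) (R0 eta : R) :
  (forall i, 0 <= c i) -> \sum_(i < N) c i <= eta -> vnorm (p 0%N) + eta < R0 ->
  (forall i, (i < N)%N -> vnorm (p i) < R0 -> vnorm (p i.+1 - p i) <= c i) ->
  vnorm (p N - p 0%N) <= eta.
Proof.
move=> c0 ceta pR step.
have le_eta k : (k <= N)%N -> \sum_(i < k) c i <= eta.
  move=> kN; apply: le_trans ceta; rewrite -(subnKC kN) big_split_ord /= lerDl.
  by rewrite sumr_ge0.
suff H k : (k <= N)%N -> vnorm (p k - p 0%N) <= \sum_(i < k) c i.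
  exact: le_trans (H N _) ceta.
elim: k => [_|k ih kN]; first by rewrite big_ord0 subrr vnorm0.
have {}ih := ih (ltnW kN).
rewrite big_ord_recr /= addrC (le_trans (vdistD (p k) _ _))// lerD//.
apply: step => //; rewrite (le_lt_trans _ pR)//.
have := vnormD (p k - p 0%N) (p 0%N); rewrite subrK.
have := le_eta k (ltnW kN); lra.
Qed.

(* Visibility estimate: a path staying at Kobayashi distance at least [D] from
   [u] is short in the Euclidean sense. At parameter distance [j] from the
   point nearest to [u] the distance to [u] is at least [D/2 + j/4] up to a
   constant, so the steps are dominated by a geometric series. *)
Lemma epath_displacement r r' K m : 0 < r -> r <= r' -> 0 < K -> 0 < m ->
  exists A a, [/\ 0 < A, 0 < a &
  forall O u R0 eps s tau D, C_proper O -> is_convex O -> is_open O -> ball_in O u r ->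
    (forall p, O p -> vnorm p < R0 -> vnorm (u - p) <= r') ->
    (forall p, O p -> vnorm p < R0 -> forall v, v != 0 ->
       bdist_dir O p v <= K * powR (bdist O p) (1 / m)) ->
    epath O eps s tau -> eps <= 1 -> 2 <= D ->
    (forall t, 0 <= t <= s -> D <= kob O u (tau t)) ->
    vnorm (tau 0) + A * expR (- (a * D)) < R0 ->
    vnorm (tau s - tau 0) <= A * expR (- (a * D))].
Proof.
move=> r0 rr K0 m0; have [A [a [A0 a0 decay]]] := bdist_decay r0 rr.
pose b := a / m; have b0 : 0 < b by rewrite divr_gt0.
(* A step has parameter length at most 1, hence Kobayashi length below T = 2. At distance g from u
   its Euclidean length will be at most B exp(- b g), the 1/m-th power turning the rate a into b. *)
pose B := (expR (2 * 2) - 1) * (K * powR A (1 / m)).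
have e0 : 0 < expR (2 * 2) - 1 :> R by have := expR_ge1Dx (2 * 2 : R); lra.
have B0 : 0 < B by rewrite !mulr_gt0// powR_gt0.
pose q := expR (- (b / 4)).
have q0 : 0 < q := expR_gt0 _.
have q1 : q < 1 by rewrite -[ltRHS]expR0 ltr_expR oppr_lt0 divr_gt0.
have d0 : 0 < 1 - q by rewrite subr_gt0.
exists (B * expR (b / 2) * (2 / (1 - q))), (b / 2); split.
- by rewrite mulr_gt0 ?divr_gt0// mulr_gt0 ?expR_gt0.
- by rewrite divr_gt0.
move=> O u R0 eps s tau D pO cO oO Bu hr' hm [s0 tO tk] eps1 D2 far.
set eta := _ * expR (- _) => start.
have chO := chainable_convex cO oO; have Ou := ball_in_center r0 Bu.
have [N [N0 Ns sN]] : exists N : nat, [/\ (0 < N)%N, N%:R - 1 <= s & s < N%:R].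
  exists (Num.truncn s).+1; have /andP[h1 h2] := truncn_itv s0.
  by split => //; rewrite -natr1 addrK.
pose t i : R := Num.min i%:R s.
have tI i : 0 <= t i <= s by rewrite le_min s0 ler0n ge_min lexx orbT.
have tle i : (i < N)%N -> t i = i%:R.
  move=> iN; apply/min_idPl; rewrite (le_trans _ Ns)// lerBrDr.
  by rewrite natr1 ler_nat.
have tN : t N = s by apply/min_idPr; exact: ltW.
have tmono i j : (i <= j)%N -> t i <= t j.
  by move=> ij; rewrite le_min !ge_min ler_nat ij lexx orbT.
have tdist i j : (i <= j)%N -> (j <= N)%N -> (j - i)%:R - 1 <= t j - t i.
  move=> ij; rewrite leq_eqVlt => /orP[/eqP jN|jN]; last first.
    by rewrite (tle _ jN) (tle _ (leq_ltn_trans ij jN)) natrB//; lra.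
  move: ij; rewrite jN leq_eqVlt => /orP[/eqP ->|iN]; first by rewrite subnn subrr; lra.
  rewrite tN (tle _ iN) natrB; last exact: ltnW.
  lra.
pose g i := kob O u (tau (t i)).
have gD i : D <= g i by exact: far.
have Ot i : O (tau (t i)) by exact: tO.
have [i0 _ i0P] := @arg_minP _ _ _ (ord0 : 'I_N.+1) xpredT (fun i => g i) isT.
(* Of the 2, one unit is the error eps and the other the shorter last step. *)
have gapart i j : (i <= j)%N -> (j <= N)%N -> (j - i)%:R - 2 <= g i + g j.
  move=> ij jN.
  have /andP[ti _] := tI i; have /andP[_ tj] := tI j.
  have /andP[h1 _] := tk _ _ ti (tmono _ _ ij) tj.
  have := kobD chO (Ot i) Ou (Ot j); rewrite (kobC O (tau (t i)) u) -/(g i) -/(g j).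
  have := tdist _ _ ij jN; lra.
(* The average of two lower bounds: D, and half of |i - i0| - 2, which follows from [gapart] because
   i0 minimises g. *)
have glow i : (i <= N)%N -> D / 2 + (((i - i0) + (i0 - i))%:R - 2) / 4 <= g i.
  move=> iN; have := i0P (Ordinal (iN : (i < N.+1)%N)) isT; rewrite /= => h.
  have i0N : (i0 <= N)%N by rewrite -ltnS.
  have := gD i; have [ii|/ltnW ii] := leqP i i0.
    have := gapart _ _ ii i0N; move/eqP: (ii) => ->.
    by rewrite add0n; lra.
  have := gapart _ _ ii iN; move/eqP: (ii) => ->.
  by rewrite addn0; lra.
(* B exp(- b g) with the lower bound of [glow] put for g; the quarter in it is the one in q. *)
pose c i := B * expR (b / 2 - b / 2 * D) * q ^+ ((i - i0) + (i0 - i)).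
have BE0 (x : R) : 0 <= B * expR x by apply: mulr_ge0; [exact: ltW|exact: expR_ge0].
have c0 i : 0 <= c i by apply: mulr_ge0 => //; rewrite exprn_ge0// ltW.
have csum : \sum_(i < N) c i <= eta.
  rewrite -mulr_sumr /eta; set S := \sum_(_ < _) _.
  have -> : B * expR (b / 2) * (2 / (1 - q)) * expR (- (b / 2 * D)) =
    B * expR (b / 2 - b / 2 * D) * (2 / (1 - q)) by rewrite expRD; ring.
  by apply: ler_wpM2l => //; exact: sum_dist_geometric.
have t00 : t 0%N = 0 by rewrite tle.
have step i : (i < N)%N -> vnorm (tau (t i)) < R0 -> vnorm (tau (t i.+1) - tau (t i)) <= c i.
  move=> iN iR.
  have /andP[ti tis] := tI i; have /andP[_ ti1] := tI i.+1.
  have /andP[_ kle] := tk _ _ ti (tmono _ _ (leqnSn i)) ti1.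
  have k2 : kob O (tau (t i)) (tau (t i.+1)) < 2.
    have : t i.+1 <= i.+1%:R by rewrite ge_min lexx.
    by move: kle; rewrite (tle _ iN) -natr1; lra.
  have [->|ne] := eqVneq (tau (t i.+1)) (tau (t i)); first by rewrite subrr vnorm0.
  apply: (le_trans (kob_dir_bound pO cO oO (Ot i) (Ot i.+1) k2 ne)).
  have vne : tau (t i.+1) - tau (t i) != 0 by rewrite subr_eq0.
  have gi2 : 2 <= kob O u (tau (t i)) := le_trans D2 (gD i).
  have bd := decay O u _ cO oO Bu (Ot i) (hr' _ (Ot i) iR) gi2.
  have m1 : 0 <= 1 / m by rewrite divr_ge0// ltW.
  have bd0 := bdist_ge0 O (tau (t i)).
  have : powR (bdist O (tau (t i))) (1 / m) <= powR A (1 / m) * expR (- (b * g i)).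
    apply: (le_trans (ge0_ler_powR m1 _ _ bd)); rewrite ?nnegrE//.
      by rewrite mulr_ge0 ?expR_ge0// ltW.
    rewrite (powRM _ (ltW A0) (expR_ge0 _)) -expRM; apply: ler_wpM2l; first exact: powR_ge0.
    by rewrite ler_expR [leLHS](_ : _ = - (b * g i))// /b /g; field; rewrite lt0r_neq0.
  move=> hp; have := hm _ (Ot i) iR _ vne => h1.
  apply: (@le_trans _ _ (B * expR (- (b * g i)))).
    have -> : B * expR (- (b * g i)) =
      (expR (2 * 2) - 1) * (K * (powR A (1 / m) * expR (- (b * g i)))) by rewrite /B; ring.
    apply: ler_wpM2l; first exact: ltW.
    by apply: (le_trans h1); apply: ler_wpM2l => //; exact: ltW.
  suff : expR (- (b * g i)) <= expR (b / 2 - b / 2 * D) * q ^+ ((i - i0) + (i0 - i)).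
    by move=> /(ler_wpM2l (ltW B0)); rewrite mulrA.
  rewrite /q -expRM_natl -expRD ler_expR.
  have := glow i (ltnW iN); set n := (_ + _)%N; nra.
have := @telescope_stay (fun i => tau (t i)) c N R0 eta c0 csum.
rewrite /= tN t00 => /(_ start); apply; exact: step.
Qed.

End Estimates.
(** * Convergence of Kobayashi distances *)

Section Transfer.
Context {R : realType} {d : nat}.
Local Notation C := (R[i]).
Local Notation pt := 'rV[C]_d.
Implicit Types (O : set pt) (x y p q u v w : pt) (r s T : R).

(** The error is a factor because the number of discs of a chain is not bounded and additive errors
    would accumulate. It is uniform because |t| stays below tanh T < 1. *)
Lemma poincare_shrink T (eta : R) : 0 <= T -> 0 < eta -> exists r, [/\ 0 < r, r < 1 &
  forall t : C, cabs t < 1 -> poincare0 t <= T ->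
    cabs (t / r%:C) < 1 /\ poincare0 (t / r%:C) <= (1 + eta) * poincare0 t].
Proof.
move=> T0 eta0; have a0 := tanh_ge0 T0; have a1 := tanh_lt1 T; set a := tanh T in a0 a1.
(* Solves 2 (1 - r) = eta (r - a) for r = 1 - k, the inequality on which the final estimate
   turns. *)
pose k := eta * (1 - a) / (2 + eta).
have k0 : 0 < k by rewrite divr_gt0 ?mulr_gt0//; lra.
have kE : k * (2 + eta) = eta * (1 - a) by rewrite divfK// lt0r_neq0//; lra.
have ka : k < 1 - a by nra.
have r0 : 0 < 1 - k by lra.
exists (1 - k); split; [lra|lra|] => t t1 tT.
have xa : cabs t <= a by rewrite tanh_le.
set r := 1 - k in r0 *; have x0 := cabs_ge0 t.
have cE : cabs (t / r%:C) = cabs t / r by rewrite cabsM cabsV cabs_real gtr0_norm.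
have xr : cabs t < r by rewrite /r; lra.
have c1 : cabs (t / r%:C) < 1 by rewrite cE ltr_pdivrMr// mul1r.
split => //; rewrite poincare_le// cE.
set P := poincare0 t; set x := cabs t in xa x0 xr cE *.
have EP : expR (2 * P) = (1 + x) / (1 - x) by rewrite expR_poincare.
have x1 : 0 < 1 - x by rewrite subr_gt0.
have xp : 0 < 1 + x by lra.
have P0 : 0 <= P by exact: poincare_ge0.
have xP : x <= 2 * P.
  have := expR_ge1Dx (- (2 * P)); rewrite expRN EP invf_div => h.
  have : (1 - x) / (1 + x) <= 1 - x by rewrite ler_pdivrMr//; nra.
  lra.
have E2 : 1 + eta * x <= expR (2 * (eta * P)).
  by rewrite (le_trans _ (expR_ge1Dx _))// lerD2l mulrCA ler_wpM2l// ltW.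
have rx : 0 <= r - x by lra.
have -> : expR (2 * ((1 + eta) * P)) = (1 + x) / (1 - x) * expR (2 * (eta * P)).
  by rewrite -EP -expRD; congr expR; ring.
have h2 : (r + x) * (1 - x) <= (1 + x) * (1 + eta * x) * (r - x).
  have : 2 * (1 - r) <= eta * (r - a) by rewrite /r; lra.
  have : eta * (r - a) <= eta * (r - x) by rewrite ler_wpM2l ?(ltW eta0)//; lra.
  have : 0 <= eta * (r - x) by rewrite mulr_ge0 // ltW.
  nra.
have h3 : (1 + x) * (1 + eta * x) * (r - x) <= (1 + x) * expR (2 * (eta * P)) * (r - x).
  by rewrite ler_wpM2r// ler_wpM2l// ltW.
rewrite -(ler_pM2r (mulr_gt0 x1 r0)).
have -> : (1 + x / r) * ((1 - x) * r) = (r + x) * (1 - x) by field; rewrite lt0r_neq0.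
rewrite [leRHS](_ : _ = (1 + x) * expR (2 * (eta * P)) * (r - x)); first exact: le_trans h3.
by field; rewrite !lt0r_neq0.
Qed.

(* A disc of [O] shrunk by the factor [r < 1] stays in a Kobayashi ball of [O],
   hence in [O'] as soon as [O'] contains a large ball of [O]. *)
Lemma kob_transfer T s (eta : R) : 0 < eta -> exists T', forall O O' b x y,
  chainable O -> O b -> O x -> O y -> (forall w, O w -> kob O b w <= T' -> O' w) ->
  kob O b x <= T -> kob O x y <= s -> kob O' x y <= s + eta.
Proof.
move=> eta0; have [s0|sneg] := leP 0 s; last first.
  by exists 0 => O O' b x y _ _ _ _ _ _ h; have := kob_ge0 O x y; lra.
(* Chosen so that (1 + e) (s + e) <= s + eta. *)
pose e := Num.min 1 (eta / (s + 2)).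
have s2 : 0 < s + 2 by lra.
have e0 : 0 < e by rewrite lt_min ltr01 divr_gt0.
have e1 : e <= 1 by rewrite ge_min lexx.
have ee : e * (s + 2) <= eta by rewrite -ler_pdivlMr// ge_min lexx orbT.
have sT : 0 <= s + 1 by lra.
have [r [r0 r1 hr]] := poincare_shrink sT e0.
(* Every disc of the chain starts within T + (s + 1) of b, and its part of radius r goes at most
   [poincare0 r] further. *)
exists (T + (s + 1) + poincare0 (r%:C : C)) => O O' b x y chO Ob Ox Oy sub hT hs.
have [sg sgle cs] := kob_chain chO Ox Oy e0.
have rC : cabs (r%:C : C) < 1 by rewrite cabs_real gtr0_norm.
have rn : r%:C != 0 :> C by rewrite -cabs_eq0 cabs_real normr_eq0 lt0r_neq0.
suff H x' y' sg' : chain O x' y' sg' -> O x' -> kob O b x' + sg' <= T + (s + 1) -> sg' <= s + 1 ->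
    exists2 s', s' <= (1 + e) * sg' & chain O' x' y' s'.
  have [|||s' s'le cs'] := H x y sg cs; [by []|lra|lra|].
  rewrite (le_trans (kob_le cs'))// (le_trans s'le)//.
  have : (1 + e) * sg <= (1 + e) * (s + e) by rewrite ler_wpM2l//; lra.
  nra.
elim=> {x' y' sg'} [x' _ _ _|x' y' t f sg' hf t1 f0 ch ih Ox' h1 h2].
  by exists 0; rewrite ?mulr0//; exact: chain0.
have sg0 := chain_ge0 ch; have P0 := poincare_ge0 t1.
have Of := (hf t t1).1.
have kft : kob O x' (f t) <= poincare0 t by rewrite -f0; apply: kob_le; exact: chain1.
have [||s' s'le cs'] := ih Of.
- have := kobD chO Ob Ox' Of; lra.
- lra.
have Ps : poincare0 t <= s + 1 by lra.
have [tr Pr] := hr t t1 Ps.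
exists (poincare0 (t / r%:C) + s'); first by rewrite mulrDr lerD.
have hg : holo_disc O' (f \o (fun z => r%:C * z)).
  have phi z : cabs z < 1 -> cabs (r%:C * z) < 1 /\ exists L, cder (fun z : C => r%:C * z) z L.
    move=> z1; split.
      by rewrite cabsM cabs_real gtr0_norm// (le_lt_trans _ z1)// ler_piMl ?cabs_ge0// ltW.
    by exists r%:C; apply: der_affine => h; rewrite mulrDr.
  move=> z z1; have [_ dg] := holo_comp phi hf z1; split => //.
  have rz := (phi z z1).1.
  have Ofz : O (f (r%:C * z)) := (hf _ rz).1.
  apply: sub => //; have := kobD chO Ob Ox' Ofz.
  have := kob_le (chain1 hf rz); rewrite f0.
  have : poincare0 (r%:C * z) <= poincare0 (r%:C : C).
    apply: poincare_mono => //; rewrite cabsM ler_piMr ?cabs_ge0//.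
    exact: ltW.
  rewrite /=; lra.
refine (@chainS _ _ O' x' y' (t / r%:C) (f \o (fun z => r%:C * z)) s' hg tr _ _).
  by rewrite /= mulr0.
by rewrite /= mulrC divfK.
Qed.

Lemma kob_small (e eta : R) : 0 < e -> 0 < eta -> exists2 del, 0 < del &
  forall O p y, ball_in O p e -> vnorm (y - p) < del -> kob O p y <= eta.
Proof.
move=> e0 eta0; have t0 : 0 < tanh eta.
  have : 0 < expR (2 * eta) - 1 by have := expR_ge1Dx (2 * eta); lra.
  by move=> h; rewrite /tanh divr_gt0//; lra.
exists (e * tanh eta) => [|O p y Bp yd]; first by rewrite mulr_gt0.
have ye : vnorm (y - p) < e.
  by rewrite (lt_trans yd)// gtr_pMr// tanh_lt1.
apply: (le_trans (kob_le (chain_ball Bp ye))).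
have h : cabs ((vnorm (y - p) / e)%:C : C) = vnorm (y - p) / e.
  by rewrite cabs_real ger0_norm// divr_ge0 ?vnorm_ge0 ?ltW.
rewrite -tanh_le h; last by rewrite ltr_pdivrMr// mul1r.
by rewrite ler_pdivrMr// mulrC ltW.
Qed.

End Transfer.

(** * Convergence of convex domains and uniform compactness of Kobayashi balls *)

Section LocalConvergence.
Context {R : realType} {d : nat} {U : set_system nat} {UU : UltraFilter U}.
Local Notation C := (R[i]).
Local Notation pt := 'rV[C]_d.
Local Notation ulim := (ulim (U := U)).
Implicit Types (O : set pt) (x y p q u v w : pt) (r s T : R).

(** Local Hausdorff convergence in the pointwise form in which it is used. A constant sequence of an
    open set satisfies it too, so the compactness lemmas also apply to the limit domain itself. *)
Definition uconv (On : nat -> set pt) O :=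
  (forall q, ~ closure_set O q -> exists2 e : R, 0 < e &
     \forall n \near U, forall x, On n x -> e <= vnorm (x - q)) /\
  (forall p, O p -> exists2 e : R, 0 < e & \forall n \near U, ball_in (On n) p e).

Lemma uconv_cst O : is_open O -> uconv (fun=> O) O.
Proof.
move=> oO; split => [q nq|p Op]; last first.
  by have [e e0 He] := is_openP oO Op; exists e => //; exact: nearW.
apply: contrapT => H; apply: nq => e e0; apply: contrapT => H'; apply: H.
exists e => //; apply: nearW => _ x Ox; rewrite leNgt; apply/negP => h.
by apply: H'; exists x; split => //; rewrite vdistC.
Qed.

(** The factor 2 is there because the infimum defining the distance need not be attained. *)
Lemma hausdorff_nbhd (X Y : set pt) (e : R) : 0 < e -> (hausdorff_dist X Y <= e%:E)%E ->
  in_nbhd (2 * e) X Y /\ in_nbhd (2 * e) Y X.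
Proof.
move=> e0 h; have : (hausdorff_dist X Y < (2 * e)%:E)%E.
  by rewrite (le_lt_trans h)// lte_fin; lra.
move=> /ereal_inf_lt[_ [e' [e'0 [h1 h2]] <-]]; rewrite lte_fin => e'e.
have H (A B : set pt) : in_nbhd e' A B -> in_nbhd (2 * e) A B.
  move=> hA z /hA[z' [Bz' zz']]; exists z'; split => //.
  exact: le_trans zz' (ltW e'e).
by split; exact: H.
Qed.

Lemma closure_sub O p : O p -> closure_set O p.
Proof. by move=> Op e e0; exists p; rewrite subrr vnorm0. Qed.

Lemma hausdorff_uconv (On : nat -> set pt) O : \oo `<=` U ->
  (forall n, is_convex (On n)) -> (forall n, is_open (On n)) -> is_open O ->
  local_hausdorff_cvg On O -> uconv On O.
Proof.
move=> Uoo cOn oOn oO hc; split => [q nq|p Op].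
  have [e [e0 He]] : exists e : R, 0 < e /\ forall y, O y -> e <= vnorm (q - y).
    apply: contrapT => H; apply: nq => e e0; apply: contrapT => H'; apply: H.
    exists e; split => // y Oy; rewrite leNgt; apply/negP => h.
    by apply: H'; exists y.
  have e8 : 0 < e / 8 by rewrite divr_gt0.
  have e4 : 0 < e / 4 by rewrite divr_gt0.
  have r0 : 0 < vnorm q + e by rewrite ltr_wpDl ?vnorm_ge0.
  exists (e / 4) => //; apply: Uoo; have [N HN] := hc _ r0 _ e8.
  exists N => // n /= Nn x Onx; rewrite leNgt; apply/negP => xq.
  have [/(_ x)] := hausdorff_nbhd e8 (HN n Nn).
  case.
    split; first exact: closure_sub.
    by rewrite /Defs.closed_ball /=; have := vnormD (x - q) q; rewrite subrK; lra.
  move=> y [[cy _] xy] _.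
  have [y' [Oy' yy']] := cy _ e4.
  have := He _ Oy'; have := vdistD x q y'; have := vdistD y x y'; rewrite (vdistC q x); lra.
have [e e0 Be] := is_openP oO Op.
pose r := e / 4; have r0 : 0 < r by rewrite divr_gt0.
have r8 : 0 < r / 8 by rewrite divr_gt0.
have R0 : 0 < vnorm p + e by rewrite ltr_wpDl ?vnorm_ge0.
exists r => //; apply: Uoo; have [N HN] := hc _ R0 _ r8.
exists N => // n /= Nn q qr; apply: contrapT => nq.
have [_ hb] := hausdorff_nbhd r8 (HN n Nn).
have approx z : vnorm (z - p) < e -> exists2 x, On n x & vnorm (x - z) < r.
  move=> ze; have [|z' [[cz _] zz]] := hb z.
    split; first by apply/closure_sub/Be.
    by rewrite /Defs.closed_ball /=; have := vnormD (z - p) p; rewrite subrK; lra.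
  have [x [Ox zx]] := cz _ r8; exists x => //.
  have := vdistD z' x z; rewrite (vdistC x z') (vdistC z' z); lra.
have [|u Ou _] := approx p; first by rewrite subrr vnorm0.
(* If [On n] missed q it would lie on one side of a hyperplane through q; but q - r v is in O, and
   the point of [On n] within r of it is on the other side. *)
have [v v1 hv] := separation_unit (cOn n) (oOn n) Ou nq.
have [|x Ox xz] := approx (q - r%:C *: v).
  have := vdistD q (q - r%:C *: v) p.
  have -> : q - r%:C *: v - q = - (r%:C *: v) by rewrite addrC addKr.
  have rE : r = e / 4 by [].
  by rewrite vnormN vnormZr v1 mulr1 gtr0_norm//; lra.
have := hv _ Ox.
have -> : x - q = (x - (q - r%:C *: v)) + (- r)%:C *: v.
  by apply/rowP => i; rewrite !mxE; ring.
rewrite rdotDl rdotZl -(vnorm_sq v) v1 expr1n mulr1.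
have := rdot_le (x - (q - r%:C *: v)) v; rewrite v1 mulr1; lra.
Qed.

Section Compactness.
Variables (On : nat -> set pt) (O : set pt) (un : nat -> pt) (u : pt).
Hypotheses (cOn : forall n, is_convex (On n)) (oOn : forall n, is_open (On n)).
Hypotheses (cO : is_convex O) (oO : is_open O) (pO : C_proper O).
Hypotheses (OnO : uconv On O) (Ou : O u) (unu : ulim un u) (Oun : forall n, On n (un n)).

(** Convergence says nothing about boundary points of O; pushing such a point away from u, however
    little, takes it off the closure, where [uconv] applies. *)
Lemma closure_far q e : O u -> ~ O q -> 0 < e -> ~ closure_set O (q + e%:C *: (q - u)).
Proof.
move=> _ nq e0 cq; apply: nq; have [r r0 Bu] := is_openP oO Ou.
have e1 : 0 < 1 + e by lra.
have := closure_mix cO r0 Bu cq (_ : 0 < e / (1 + e)) _; rewrite divr_gt0// => /(_ isT).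
have -> : mix (e / (1 + e)) (q + e%:C *: (q - u)) u = q.
  have eC : 1 + e%:C != 0 :> C.
    by rewrite -[1](rmorph1 (real_complex R)) -rmorphD -cabs_eq0 cabs_real normr_eq0 lt0r_neq0.
  have key (E a b : C) : 1 + E != 0 -> (1 - E / (1 + E)) * (a + E * (a - b)) + E / (1 + E) * b = a.
    by move=> E0; field.
  have sE : (e / (1 + e))%:C = e%:C / (1 + e%:C) :> C.
    by rewrite rmorphM fmorphV rmorphD rmorph1.
  have tE : (1 - e / (1 + e))%:C = 1 - e%:C / (1 + e%:C) :> C by rewrite -sE rmorphB rmorph1.
  by apply/rowP => i; rewrite !mxE tE sE key.
by apply; rewrite ler_pdivrMr//; lra.
Qed.

Lemma ball_in_un : exists2 e : R, 0 < e & \forall n \near U, ball_in (On n) (un n) e.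
Proof.
have [e e0 He] := OnO.2 _ Ou; have e2 : 0 < e / 2 by rewrite divr_gt0.
exists (e / 2) => //; apply: filterS2 He (unu e2) => n Bn un_u.
by apply: ball_in_shift Bn; lra.
Qed.

(** If the distances to [un n] were unbounded, the directions would have a limit v. The complex line
    u + C v leaves the closure of O, so the line through [un n] and [wn n] leaves [On n] at a
    bounded distance, a vanishing fraction of |wn - un|. This contradicts [kob_line_bound]. *)
Lemma kob_ball_bounded T (wn : nat -> pt) :
  (\forall n \near U, On n (wn n) /\ kob (On n) (un n) (wn n) <= T) ->
  exists m : R, \forall n \near U, vnorm (wn n) <= m.
Proof.
move=> Hw; apply: contrapT => unb.
have far (m : R) : \forall n \near U, m < vnorm (wn n - un n).
  have : \forall n \near U, ~ (vnorm (wn n) <= m + (vnorm u + 1)).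
    by apply: ultraN => H; apply: unb; exists (m + (vnorm u + 1)).
  apply: filterS2 (ulim_bounded unu) => n hn /negP; rewrite -ltNge.
  have := vnormD (wn n - un n) (un n); rewrite subrK; lra.
pose vn n := (vnorm (wn n - un n))^-1%:C *: (wn n - un n).
have vn1 : \forall n \near U, vnorm (vn n) = 1.
  apply: filterS (far 0) => n h.
  by rewrite vnormZr gtr0_norm ?invr_gt0// mulVf// lt0r_neq0.
have [|v hv] := @ultra_vec R d U UU vn 1; first by apply: filterS vn1 => n ->.
have v0 : v != 0.
  apply/eqP => v0; have h1 : (0 : R) < 1 / 2 by rewrite divr_gt0.
  apply: (@ultra_cst U); apply: filterS2 vn1 (hv _ h1) => n h.
  by rewrite v0 subr0 h; lra.
have [l nl] : exists l : C, ~ O (u + l *: v).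
  apply: contrapT => H; apply: pO; exists u, v; split => // l.
  by apply: contrapT => nl; apply: H; exists l.
have ncl : ~ closure_set O (u + (2 * l) *: v).
  have := closure_far Ou nl ltr01.
  rewrite (_ : u + l *: v + _ = u + (2 * l) *: v)//.
  by apply/rowP => i; rewrite !mxE rmorph1; ring.
have [e e0 He] := OnO.1 _ ncl.
have hq := ulimD (UU := UU) unu (ulimZ (UU := UU) (2 * l) hv).
pose A := (expR (2 * (T + 1)) - 1) * cabs (2 * l).
apply: (@ultra_cst U).
have far2 : \forall n \near U, A < vnorm (wn n - un n) /\ 0 < vnorm (wn n - un n).
  by apply: filterS2 (far A) (far 0) => n.
apply: filterS3 (filterI He (hq _ e0)) Hw far2 => n [Hn qn] [Own kT] [fA f0].
have kT1 : kob (On n) (un n) (wn n) < T + 1 by lra.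
have := @kob_line_bound R d (On n) (un n) (wn n)
  (2 * l * (vnorm (wn n - un n))^-1%:C) _ (@cOn n) (@oOn n) (Oun n) Own kT1.
rewrite -scalerA => /(_ _)/wrap[|].
  by move=> /Hn; rewrite leNgt => /negP; apply.
rewrite cabsM cabs_real mulrA ger0_norm ?invr_ge0 ?vnorm_ge0//.
by rewrite ler_pdivlMr// mul1r leNgt fA.
Qed.

(** The domains contain balls of a fixed radius about [wn n], hence about the limit w. Were w
    outside O, a slight push away from u would give a point inside these balls that the domains
    eventually avoid. *)
Lemma kob_ball_compact T (wn : nat -> pt) :
  (\forall n \near U, On n (wn n) /\ kob (On n) (un n) (wn n) <= T) ->
  exists2 w, O w & ulim wn w.
Proof.
move=> Hw; have [m hm] := kob_ball_bounded Hw.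
have [w hwn] := ultra_vec (UU := UU) hm; exists w => //.
have [e e0 He] := ball_in_un.
pose rho := expR (- (2 * (T + 1))) * e.
have rho0 : 0 < rho by rewrite mulr_gt0 ?expR_gt0.
have rho2 : 0 < rho / 2 by rewrite divr_gt0.
have Bw : \forall n \near U, ball_in (On n) w (rho / 2).
  apply: filterS3 He Hw (hwn _ rho2) => n Bn [Own kT] wnw.
  have kT1 : kob (On n) (un n) (wn n) < T + 1 by lra.
  apply: ball_in_shift (ball_in_kob (@cOn n) (@oOn n) e0 Bn Own kT1).
  by rewrite -/rho vdistC; lra.
apply: contrapT => nw.
(* Small enough for the pushed point to stay within rho / 2 of w. *)
pose s := rho / 4 / (vnorm (w - u) + 1).
have wu : 0 < vnorm (w - u) + 1 by rewrite ltr_wpDl ?vnorm_ge0.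
have s0 : 0 < s by rewrite !divr_gt0.
have [e' e'0 He'] := OnO.1 _ (closure_far Ou nw s0).
apply: (@ultra_cst U); apply: filterS2 Bw He' => n Bn Hn.
have : On n (w + s%:C *: (w - u)).
  apply: Bn; rewrite addrC addKr vnormZr gtr0_norm//.
  have : s * (vnorm (w - u) + 1) = rho / 4 by rewrite divfK// lt0r_neq0.
  lra.
by move=> /Hn; rewrite subrr vnorm0 leNgt e'0.
Qed.

(** Supplies the inclusion that [kob_transfer] asks for when passing from [On n] to O. *)
Lemma kob_ball_sub T : \forall n \near U, forall w, On n w -> kob (On n) (un n) w <= T -> O w.
Proof.
apply: contrapT => /ultraN bad.
have /choice[wn hwn] : forall n, exists w, (~ (forall w, On n w -> kob (On n) (un n) w <= T -> O w)) ->
    [/\ On n w, kob (On n) (un n) w <= T & ~ O w].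
  move=> n; have [h|h] := pselect (exists w, [/\ On n w, kob (On n) (un n) w <= T & ~ O w]).
    by case: h => w hw; exists w.
  exists 0 => H; case: H => w Ow kw; apply: contrapT => nOw; apply: h; exists w; split => //.
have Hw : \forall n \near U, [/\ On n (wn n), kob (On n) (un n) (wn n) <= T & ~ O (wn n)].
  by apply: filterS bad => n; exact: hwn.
have [|w Ow ww] := @kob_ball_compact T wn; first by apply: filterS Hw => n [].
have [e e0 Be] := is_openP oO Ow.
by apply: (@ultra_cst U); apply: filterS2 Hw (ww _ e0) => n [_ _ nO] /Be.
Qed.

End Compactness.
End LocalConvergence.

(** * Limits of almost-geodesics and of their endpoints *)

Section Limits.
Context {R : realType} {d : nat} {U : set_system nat} {UU : UltraFilter U}.
Local Notation C := (R[i]).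
Local Notation pt := 'rV[C]_d.
Local Notation ulim := (ulim (U := U)).
Variables (On : nat -> set pt) (O : set pt) (un : nat -> pt) (u : pt).
Hypotheses (cOn : forall n, is_convex (On n)) (oOn : forall n, is_open (On n)).
Hypotheses (cO : is_convex O) (oO : is_open O) (pO : C_proper O).
Hypotheses (OnO : uconv (U := U) On O) (Ou : O u) (unu : ulim un u) (Oun : forall n, On n (un n)).
Implicit Types (x y v w : pt).

Let chOn n : chainable (On n). Proof. exact: (chainable_convex (@cOn n) (@oOn n)). Qed.
Let chO : chainable O. Proof. exact: (chainable_convex cO oO). Qed.

Lemma kob_ulim_small (xn : nat -> pt) x (eta : R) : O x -> ulim xn x -> 0 < eta ->
  \forall n \near U, [/\ On n x, On n (xn n), O (xn n), kob (On n) x (xn n) <= eta & kob O x (xn n) <= eta].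
Proof.
move=> Ox hx eta0; have [e e0 He] := OnO.2 _ Ox; have [e' e'0 He'] := is_openP oO Ox.
pose r := Num.min e e'; have r0 : 0 < r by rewrite lt_min e0.
have [del del0 small] := @kob_small R d r eta r0 eta0.
have m0 : 0 < Num.min r del by rewrite lt_min r0.
apply: filterS2 He (hx _ m0) => n Bn; rewrite lt_min => /andP[xr xd].
have B1 : ball_in (On n) x r by apply: ball_in_le Bn; rewrite ge_min lexx.
have B2 : ball_in O x r by apply: ball_in_le He'; rewrite ge_min lexx orbT.
split; [exact: ball_in_center B1|exact: B1|exact: B2|exact: small|exact: small].
Qed.

(** The bound T confines the chains from [xn n] to a fixed Kobayashi ball about [un n], where shrunk
    discs of [On n] lie in O. *)
Lemma kob_liminf (xn yn : nat -> pt) x y (T s : R) : O x -> O y -> ulim xn x -> ulim yn y ->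
  (\forall n \near U, kob (On n) (un n) (xn n) <= T) ->
  (\forall n \near U, kob (On n) (xn n) (yn n) <= s) -> kob O x y <= s.
Proof.
move=> Ox Oy hx hy hT hs; apply/ler_addgt0Pr => e e0.
have e3 : 0 < e / 3 by rewrite divr_gt0.
have [T' HT'] := @kob_transfer R d T s (e / 3) e3.
have sub := kob_ball_sub (UU := UU) cOn oOn cO oO pO OnO Ou unu Oun T'.
apply: (@ultra_cst U).
apply: filterS3 (filterI (kob_ulim_small Ox hx e3) (kob_ulim_small Oy hy e3)) sub (filterI hT hs).
move=> n [[Onx Onxn Oxn kx1 kx2] [Ony Onyn Oyn ky1 ky2]] sb [hTn hsn].
have := HT' _ _ _ _ _ (@chOn n) (Oun n) Onxn Onyn sb hTn hsn.
have := kobD chO Ox Oxn Oy; have := kobD chO Oxn Oyn Oy; rewrite (kobC O (yn n) y); lra.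
Qed.

Lemma kob_limsup (xn yn : nat -> pt) x y (s : R) : O x -> O y -> ulim xn x -> ulim yn y ->
  (\forall n \near U, s <= kob (On n) (xn n) (yn n)) -> s <= kob O x y.
Proof.
move=> Ox Oy hx hy hs; apply/ler_addgt0Pr => e e0.
have e3 : 0 < e / 3 by rewrite divr_gt0.
have [T' HT'] := @kob_transfer R d (kob O u x) (kob O x y) (e / 3) e3.
have sub : \forall n \near U, forall w, O w -> kob O u w <= T' -> On n w.
  apply: contrapT => /ultraN bad.
  have /choice[wn hwn] : forall n, exists w, (~ (forall w, O w -> kob O u w <= T' -> On n w)) ->
      [/\ O w, kob O u w <= T' & ~ On n w].
    move=> n; have [[w hw]|h] := pselect (exists w, [/\ O w, kob O u w <= T' & ~ On n w]).
      by exists w.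
    by exists 0 => H; case: H => w Ow kw; apply: contrapT => nOw; apply: h; exists w.
  have Hw : \forall n \near U, [/\ O (wn n), kob O u (wn n) <= T' & ~ On n (wn n)].
    by apply: filterS bad => n; exact: hwn.
  (* Compactness for the constant sequence: missed points would tend to a point of O, about which
     [On n] contains a ball. *)
  have [|w Ow ww] := @kob_ball_compact R d U UU (fun=> O) O (fun=> u) u (fun=> cO) (fun=> oO)
    cO oO pO (uconv_cst oO) Ou (ulim_cst u) (fun=> Ou) T' wn.
    by apply: filterS Hw => n [].
  apply: (@ultra_cst U); apply: filterS2 Hw (kob_ulim_small Ow ww ltr01) => n [_ _ nO] [].
  by [].
apply: (@ultra_cst U).
apply: filterS3 (filterI (kob_ulim_small Ox hx e3) (kob_ulim_small Oy hy e3)) sub hs.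
move=> n [[Onx Onxn Oxn kx1 kx2] [Ony Onyn Oyn ky1 ky2]] sb hsn.
have := HT' _ _ _ _ _ chO Ou Ox Oy sb (lexx _) (lexx _).
have := kobD (@chOn n) Onxn Onx Onyn; have := kobD (@chOn n) Onx Ony Onyn.
rewrite (kobC (On n) (xn n) x); lra.
Qed.

(** The limit is taken separately at each time, since [sg n t] stays within |t| of [un n].
    Semicontinuity of the distance from both sides makes it isometric, so no equicontinuity
    enters. *)
Lemma limit_geodesic (sg : nat -> R -> pt) (eps : nat -> R) :
  (forall n, sg n 0 = un n) ->
  (forall T : R, \forall n \near U, (forall t, `|t| <= T -> On n (sg n t)) /\
     forall s t, `|s| <= T -> `|t| <= T ->
       `|s - t| - eps n <= kob (On n) (sg n s) (sg n t) <= `|s - t|) ->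
  (forall e : R, 0 < e -> \forall n \near U, eps n < e) ->
  exists2 s : R -> pt, geodesic O s & forall t, ulim (fun n => sg n t) (s t).
Proof.
move=> sg0 sgP eps0.
have /choice[s hs] : forall t, exists w, O w /\ ulim (fun n => sg n t) w.
  move=> t; have [|w Ow hw] := @kob_ball_compact R d U UU On O un u cOn oOn cO oO pO OnO Ou unu Oun
     `|t| (fun n => sg n t); last by exists w.
  apply: filterS (sgP `|t|) => n [h1 h2]; split; first exact: h1.
  by have := h2 0 t; rewrite normr0 normr_ge0 lexx sg0 sub0r normrN => /(_ isT isT)/andP[].
exists s => [|t]; last exact: (hs t).2.
split=> [t|a b]; first exact: (hs t).1.
pose T := Num.max `|a| `|b|.
have aT : `|a| <= T by rewrite le_max lexx.
have bT : `|b| <= T by rewrite le_max lexx orbT.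
apply/eqP; rewrite eq_le; apply/andP; split.
  apply: (kob_liminf (T := `|a|) (hs a).1 (hs b).1 (hs a).2 (hs b).2).
    apply: filterS (sgP T) => n [_ h2].
    have := h2 0 a; rewrite normr0 (le_trans _ aT)// aT sg0 sub0r normrN.
    by move=> /(_ isT isT)/andP[].
  by apply: filterS (sgP T) => n [_ /(_ a b aT bT)/andP[]].
apply/ler_addgt0Pr => e e0; rewrite -lerBlDr.
apply: (kob_limsup (hs a).1 (hs b).1 (hs a).2 (hs b).2).
by apply: filterS2 (sgP T) (eps0 _ e0) => n [_ /(_ a b aT bT)/andP[h _]] he; lra.
Qed.

Hypothesis pOn : forall n, C_proper (On n).
Variable m : R.
Hypothesis m0 : 0 < m.
Hypothesis mconv : forall r : R, 0 < r -> exists2 K, 0 < K &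
  \forall n \near U, forall p, On n p -> vnorm p < r -> forall v, v != 0 ->
    bdist_dir (On n) p v <= K * powR (bdist (On n) p) (1 / m).

Lemma ultra_displacement (r : R) : 0 < r -> exists A a, [/\ 0 < A, 0 < a &
  \forall n \near U, forall eps s tau D, epath (On n) eps s tau -> eps <= 1 -> 2 <= D ->
    (forall t, 0 <= t <= s -> D <= kob (On n) (un n) (tau t)) ->
    vnorm (tau 0) + A * expR (- (a * D)) < r ->
    vnorm (tau s - tau 0) <= A * expR (- (a * D))].
Proof.
move=> r0; have [e e0 He] := ball_in_un OnO Ou unu.
have [K K0 HK] := mconv r0.
pose r' := Num.max e (vnorm u + 1 + r).
have er' : e <= r' by rewrite le_max lexx.
have [A [a [A0 a0 HA]]] := @epath_displacement R d e r' K m e0 er' K0 m0.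
exists A, a; split => //.
apply: filterS3 He HK (ulim_bounded unu) => n Bn hm ub eps s tau D he e1 D2 far start.
apply: (HA (On n) (un n) r eps s tau D (@pOn n) (@cOn n) (@oOn n) Bn) => // p _ pr.
by rewrite le_max; apply/orP; right; have := vnormB (un n) p; lra.
Qed.

Lemma small_exp (A a e : R) : 0 < A -> 0 < a -> 0 < e ->
  exists D0 : R, forall D, D0 <= D -> A * expR (- (a * D)) <= e.
Proof.
move=> A0 a0 e0; exists (A / e / a) => D hD.
have : A / e <= expR (a * D).
  rewrite (le_trans _ (expR_ge1Dx _))//; move: hD; rewrite ler_pdivrMr//; nra.
by rewrite expRN ler_pdivrMr// mulrC ler_pdivrMr ?expR_gt0// mulrC.
Qed.

Definition far_path (eps s : nat -> R) (tau : nat -> R -> pt) :=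
  [/\ forall n, epath (On n) (eps n) (s n) (tau n), forall n, eps n <= 1 &
   forall D : R, \forall n \near U, forall t, 0 <= t <= s n -> D <= kob (On n) (un n) (tau n t)].

(* [p] and [q] have the same limit in the one-point compactification. *)
Definition coterminal (p q : nat -> pt) := forall r eta : R, 0 < r -> 0 < eta ->
  \forall n \near U, vnorm (p n) < r -> vnorm (q n - p n) <= eta.

Lemma far_path_coterminal eps s tau : far_path eps s tau ->
  coterminal (fun n => tau n 0) (fun n => tau n (s n)).
Proof.
move=> [he e1 far] r eta r0 eta0.
(* The extra 1 is room for the displacement, whence the minimum of 1 and eta below. *)
have r1 : 0 < r + 1 by lra.
have [A [a [A0 a0 HA]]] := ultra_displacement r1.
have m1 : 0 < Num.min 1 eta by rewrite lt_min ltr01.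
have [D0 HD0] := small_exp A0 a0 m1.
pose D := Num.max 2 D0.
have D2 : 2 <= D by rewrite le_max lexx.
have : A * expR (- (a * D)) <= Num.min 1 eta by apply: HD0; rewrite le_max lexx orbT.
rewrite le_min => /andP[s1 s2].
apply: filterS2 HA (far D) => n HAn farn pr.
by apply: le_trans s2; apply: HAn (he n) (e1 n) D2 farn _; lra.
Qed.

Lemma far_path_rev eps s tau : far_path eps s tau ->
  far_path eps s (fun n t => tau n (s n - t)).
Proof.
move=> [he e1 far]; split => // [n|D]; first exact: epath_rev.
apply: filterS (far D) => n h t /andP[t0 ts]; apply: h; lra.
Qed.

Lemma coterminal_trans p q p' : coterminal p q -> coterminal q p' -> coterminal p p'.
Proof.
move=> h1 h2 r eta r0 eta0.
have r1 : 0 < r + 1 by lra.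
have m1 : 0 < Num.min 1 (eta / 2) by rewrite lt_min ltr01 divr_gt0.
apply: filterS2 (h1 r _ r0 m1) (h2 _ _ r1 m1) => n k1 k2 pr.
have := k1 pr; rewrite le_min => /andP[q1 q2].
have qr : vnorm (q n) < r + 1.
  by have := vnormD (q n - p n) (p n); rewrite subrK; lra.
have := k2 qr; rewrite le_min => /andP[q3 q4].
have := vdistD (q n) (p' n) (p n); lra.
Qed.

Definition tends (p : nat -> pt) (l : option pt) := match l with
  | Some x => ulim p x
  | None => forall M : R, \forall n \near U, M < vnorm (p n)
  end.

(** [coterminal p q] constrains q only where p is bounded, so both directions are assumed: one for
    finite limits, each to exclude one mixed case. *)
Lemma tends_coterminal p q l l' : coterminal p q -> coterminal q p ->
  tends p l -> tends q l' -> l = l'.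
Proof.
have half (p' q' : nat -> pt) x : coterminal p' q' -> ulim p' x ->
    ~ (forall M : R, \forall n \near U, M < vnorm (q' n)).
  move=> h hx hM; apply: (@ultra_cst U).
  have r0 : 0 < vnorm x + 2 by rewrite ltr_wpDl ?vnorm_ge0.
  apply: filterS3 (h _ 1 r0 ltr01) (ulim_bounded hx) (hM (vnorm x + 3)) => n k1 k2 k3.
  have := k1 _; move=> /(_ _)/wrap[|]; first by lra.
  by have := vnormD (q' n - p' n) (p' n); rewrite subrK; lra.
move=> h1 h2; case: l => [x|]; case: l' => [y|] //= hx hy.
- congr Some; apply/eqP; rewrite -subr_eq0 -vnorm_eq0 eq_le vnorm_ge0 andbT.
  apply/ler_addgt0Pr => e e0; rewrite add0r; apply: (ulim_dist_le (UU := UU) hx hy).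
  have r0 : 0 < vnorm x + 2 by rewrite ltr_wpDl ?vnorm_ge0.
  apply: filterS2 (h1 _ _ r0 e0) (ulim_bounded hx) => n k1 k2.
  by rewrite vdistC; apply: k1; lra.
- by case: (half _ _ _ h1 hx hy).
by case: (half _ _ _ h2 hy hx).
Qed.

(** Beyond time T the path is at distance at least T - 1 from [un n], as errors are at most 1, and
    so it hardly moves. Thus its end is close to [sg n T], which is close to [s T]. *)
Lemma end_limit (eps b : nat -> R) (sg : nat -> R -> pt) (s : R -> pt) l :
  (forall n, epath (On n) (eps n) (b n) (sg n)) -> (forall n, eps n <= 1) ->
  (forall n, sg n 0 = un n) -> (forall T : R, \forall n \near U, T <= b n) ->
  (forall t, 0 <= t -> ulim (fun n => sg n t) (s t)) -> lim_pinfty s l ->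
  tends (fun n => sg n (b n)) l.
Proof.
move=> he e1 sg0 bT hs.
have tail T : 3 <= T -> \forall n \near U, epath (On n) (eps n) (b n - T) (fun c => sg n (T + c)) /\
    forall t, 0 <= t <= b n - T -> T - 1 <= kob (On n) (un n) (sg n (T + t)).
  move=> T3; apply: filterS (bT T) => n Tb; split.
    by apply: epath_sub (he n); lra.
  move=> t /andP[t0 tb]; have [_ _ /(_ 0 (T + t))] := he n; rewrite sg0 => h.
  have {}h : T + t - 0 - eps n <= kob (On n) (un n) (sg n (T + t)) <= T + t - 0.
    by apply: h; lra.
  by case/andP: h; have := e1 n; lra.
case: l => [x|] /= hl.
  move=> eta eta0.
  have r0 : 0 < vnorm x + 3 by rewrite ltr_wpDl ?vnorm_ge0.
  have [A [a [A0 a0 HA]]] := ultra_displacement r0.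
  have m1 : 0 < Num.min 1 (eta / 4) by rewrite lt_min ltr01 divr_gt0.
  have [D0 HD0] := small_exp A0 a0 m1.
  have [T0 HT0] := hl _ m1.
  pose T := Num.max 3 (Num.max (D0 + 1) T0).
  have T3 : 3 <= T by rewrite le_max lexx.
  have TD : D0 <= T - 1 by rewrite lerBrDr !le_max lexx orbT.
  have TT : T0 <= T by rewrite !le_max lexx !orbT.
  have := HD0 _ TD; rewrite le_min => /andP[s1 s2].
  have := HT0 _ TT; rewrite lt_min => /andP[s3 s4].
  have T0' : 0 <= T by lra.
  apply: filterS3 HA (tail T T3) (hs T T0' _ m1) => n HAn [hp hk]; rewrite lt_min => /andP[s5 s6].
  have := HAn _ _ _ (T - 1) hp (e1 n) _ hk _; rewrite /= addr0 (addrC T (b n - T)) subrK => h.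
  have s7 : vnorm (sg n T) < vnorm x + 2.
    have := vnormD (sg n T - s T) (s T); have := vnormD (s T - x) x; rewrite !subrK; lra.
  have {}h : vnorm (sg n (b n) - sg n T) <= A * expR (- (a * (T - 1))) by apply: h; lra.
  have := vdistD (sg n T) (sg n (b n)) x; have := vdistD (s T) (sg n T) x; lra.
(* For the limit at infinity the displacement estimate is run backwards: from an end bounded by M
   the reversed tail could not reach [sg n T], which is further out. *)
move=> M; apply: contrapT => /ultraN nM.
have [T1 HT1] := hl (M + 3).
have r0 : 0 < `|M| + 3 by rewrite ltr_wpDl.
have [A [a [A0 a0 HA]]] := ultra_displacement r0.
have [D0 HD0] := small_exp A0 a0 ltr01.
pose T := Num.max 3 (Num.max (D0 + 1) T1).
have T3 : 3 <= T by rewrite le_max lexx.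
have TD : D0 <= T - 1 by rewrite lerBrDr !le_max lexx orbT.
have TT : T1 <= T by rewrite !le_max lexx !orbT.
have s1 := HD0 _ TD; have s2 := HT1 _ TT.
have T0' : 0 <= T by lra.
apply: (@ultra_cst U).
apply: filterS3 (filterI HA nM) (tail T T3) (hs T T0' _ ltr01) => n [HAn /negP]; rewrite -leNgt => bM [hp hk] s5.
have := HAn _ _ _ (T - 1) (epath_rev hp) (e1 n) _ _ _.
rewrite /= subr0 subrr addr0 (addrC T (b n - T)) subrK => h.
have {}h : vnorm (sg n T - sg n (b n)) <= A * expR (- (a * (T - 1))).
  apply: h; first by lra.
    by move=> t /andP[t0 tb]; apply: hk; lra.
  by have := ler_norm M; lra.
have := vnormD (sg n T - sg n (b n)) (sg n (b n)); rewrite subrK.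
have := vnormD (s T - sg n T) (sg n T); rewrite subrK vdistC; lra.
Qed.

Lemma no_fat_triangles (eps s1 s2 s3 t0 : nat -> R) (sg tau tau' : nat -> R -> pt) :
  (forall n, epath (On n) (eps n) (s1 n) (sg n)) ->
  (forall n, 0 <= t0 n <= s1 n) -> (forall n, sg n (t0 n) = un n) ->
  far_path eps s2 tau -> far_path eps s3 tau' ->
  (forall n, [/\ sg n 0 = tau n 0, tau n (s2 n) = tau' n 0 & sg n (s1 n) = tau' n (s3 n)]) ->
  (forall e : R, 0 < e -> \forall n \near U, eps n < e) ->
  ~ (forall s, geodesic O s -> well_behaved s).
Proof.
move=> he t0I sgu far2 far3 ends eps0 wb.
have e1 : forall n, eps n <= 1 by case: far2.
have dist n t : 0 <= t <= s1 n -> kob (On n) (un n) (sg n t) <= `|t - t0 n|.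
  move=> /andP[h1 h2]; have /andP[h3 h4] := t0I n; have [_ _ tk] := he n; rewrite -sgu.
  have [tt|/ltW tt] := leP t (t0 n).
    by rewrite distrC ger0_norm ?subr_ge0// kobC; have /andP[] := tk _ _ h1 tt h4.
  by rewrite ger0_norm ?subr_ge0//; have /andP[] := tk _ _ h3 tt h2.
(* The vertices lie on the far sides, so [un n] is far from both ends of its own side and the
   parameter intervals exhaust the line. *)
have t0T (T : R) : \forall n \near U, T <= t0 n.
  have [h2 _ far] := far2; apply: filterS (far T) => n h.
  have s20 : 0 <= (0 : R) <= s2 n by rewrite lexx; have [] := h2 n.
  have /andP[a0 a1] := t0I n.
  have := dist n 0; rewrite lexx (le_trans a0 a1) sub0r normrN ger0_norm// => /(_ isT).
  by have [-> _ _] := ends n; have := h 0 s20; lra.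
have t1T (T : R) : \forall n \near U, T <= s1 n - t0 n.
  have [h2 _ far] := far3; apply: filterS (far T) => n h.
  have s30 : 0 <= s3 n <= s3 n by rewrite lexx andbT; have [] := h2 n.
  have /andP[a0 a1] := t0I n.
  have := dist n (s1 n); rewrite lexx (le_trans a0 a1) ger0_norm ?subr_ge0// => /(_ isT).
  by have [_ _ ->] := ends n; have := h _ s30; lra.
have [||//|s gs hs] := @limit_geodesic (fun n t => sg n (t0 n + t)) eps.
- by move=> n; rewrite addr0.
- move=> T; apply: filterS2 (t0T T) (t1T T) => n h1 h2; have [_ sO sk] := he n.
  have J t : `|t| <= T -> 0 <= t0 n + t <= s1 n by rewrite ler_norml => /andP[]; lra.
  split=> [t /J|a b /J/andP[a0 a1] /J/andP[b0 b1]]; first exact: sO.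
  have [ab|/ltW ab] := leP (t0 n + a) (t0 n + b).
    have -> : `|a - b| = t0 n + b - (t0 n + a) by rewrite distrC ger0_norm; [ring|lra].
    exact: sk.
  have -> : `|a - b| = t0 n + a - (t0 n + b) by rewrite ger0_norm; [ring|lra].
  by rewrite kobC; exact: sk.
have [lm [lp [hm [hp lmp]]]] := wb _ gs.
have fwd : tends (fun n => sg n (s1 n)) lp.
  have := @end_limit eps (fun n => s1 n - t0 n) (fun n c => sg n (t0 n + c)) s lp.
  rewrite (_ : (fun n => sg n (t0 n + _)) = (fun n => sg n (s1 n))); last first.
    by apply/funext => n; congr sg; ring.
  apply => // n; last by rewrite addr0.
  by have /andP[a0 a1] := t0I n; exact: epath_sub (he n).
have bwd : tends (fun n => sg n 0) lm.
  have := @end_limit eps t0 (fun n c => sg n (t0 n - c)) (fun t => s (- t)) lm.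
  rewrite (_ : (fun n => sg n (t0 n - _)) = (fun n => sg n 0)); last first.
    by apply/funext => n; rewrite subrr.
  apply => // n; last by rewrite subr0.
  have /andP[a0 a1] := t0I n; have := epath_rev (epath_sub (lexx 0) a0 a1 (he n)).
  by rewrite subr0 (_ : (fun a => sg n _) = (fun c => sg n (t0 n - c)))//; apply/funext => c; rewrite add0r.
(* The two ends are compared by going around the triangle along the two far sides, once in each
   direction. *)
apply: lmp; apply: tends_coterminal bwd fwd.
  have := coterminal_trans (far_path_coterminal far2).
  move=> /(_ (fun n => sg n (s1 n))); rewrite (_ : (fun n => tau n 0) = (fun n => sg n 0)); last first.
    by apply/funext => n; have [] := ends n.
  apply; rewrite (_ : (fun n => tau n (s2 n)) = (fun n => tau' n 0)); last first.
    by apply/funext => n; have [] := ends n.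
  rewrite (_ : (fun n => sg n (s1 n)) = (fun n => tau' n (s3 n))); last first.
    by apply/funext => n; have [] := ends n.
  exact: far_path_coterminal far3.
have := coterminal_trans (far_path_coterminal (far_path_rev far3)).
move=> /(_ (fun n => sg n 0)).
rewrite (_ : (fun n => tau' n (s3 n - 0)) = (fun n => sg n (s1 n))); last first.
  by apply/funext => n; rewrite subr0; have [] := ends n.
apply; rewrite (_ : (fun n => tau' n (s3 n - s3 n)) = (fun n => tau n (s2 n - 0))); last first.
  by apply/funext => n; rewrite subrr subr0; have [] := ends n.
rewrite (_ : (fun n => sg n 0) = (fun n => tau n (s2 n - s2 n))); last first.
  by apply/funext => n; rewrite subrr; have [] := ends n.
exact: far_path_coterminal (far_path_rev far2).
Qed.

End Limits.
(** * Slim triangles *)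

Section Slim.
Context {R : realType} {d : nat}.
Local Notation C := (R[i]).
Local Notation pt := 'rV[C]_d.
Implicit Types (O : set pt) (x y z w p q u : pt).

Definition slim O (eps del : R) := forall (s1 s2 s3 : R) (sg tau tau' : R -> pt),
  epath O eps s1 sg -> epath O eps s2 tau -> epath O eps s3 tau' ->
  sg 0 = tau 0 -> tau s2 = tau' 0 -> sg s1 = tau' s3 ->
  forall t, 0 <= t <= s1 ->
    (exists2 t', 0 <= t' <= s2 & kob O (sg t) (tau t') <= del) \/
    (exists2 t', 0 <= t' <= s3 & kob O (sg t) (tau' t') <= del).

Lemma epath_split O eps s tau t : epath O eps s tau -> 0 <= t <= s ->
  kob O (tau 0) (tau t) + kob O (tau t) (tau s) <= kob O (tau 0) (tau s) + eps.
Proof.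
move=> [s0 tO tk] /andP[t0 ts].
have /andP[_ h1] := tk _ _ (lexx 0) t0 ts.
have /andP[_ h2] := tk _ _ t0 ts (lexx s).
have /andP[h3 _] := tk _ _ (lexx 0) s0 (lexx s).
lra.
Qed.

(* The first unit step along [sg] that leaves the [del]-neighbourhood of [tau]
   ends in that of [tau']. *)
Lemma slim_center O eps del s1 s2 s3 sg tau tau' : 0 <= del -> slim O eps del ->
  epath O eps s1 sg -> epath O eps s2 tau -> epath O eps s3 tau' ->
  sg 0 = tau 0 -> tau s2 = tau' 0 -> sg s1 = tau' s3 -> chainable O ->
  exists t t2 t3, [/\ 0 <= t <= s1, 0 <= t2 <= s2, 0 <= t3 <= s3,
    kob O (sg t) (tau t2) <= del & kob O (sg t) (tau' t3) <= del + 1].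
Proof.
move=> del0 sl h1 h2 h3 e1 e2 e3 chO.
have [s10 O1 k1] := h1; have [s20 O2 _] := h2; have [s30 O3 _] := h3.
pose t (i : nat) : R := Num.min i%:R s1.
have tI i : 0 <= t i <= s1 by rewrite le_min s10 ler0n ge_min lexx orbT.
pose P i := exists2 t', 0 <= t' <= s2 & kob O (sg (t i)) (tau t') <= del.
have P0 : P 0%N.
  exists 0; first by rewrite lexx s20.
  by rewrite /t (min_idPl s10) e1 kob_xx.
have [|] := pselect (forall i, P i).
  move=> /(_ (Num.bound s1))[t2 t2I kt2]; exists s1, t2, s3.
  have tE : t (Num.bound s1) = s1 by apply/min_idPr; rewrite ltW// archi_boundP.
  rewrite tE in kt2; rewrite !lexx s10 s30 e3 kob_xx -e3; split => //.
  by rewrite addr_ge0.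
move=> nP; have [i [Pi nPi]] : exists i, P i /\ ~ P i.+1.
  apply: contrapT => H; apply: nP; elim=> [//|i ih].
  by apply: contrapT => h; apply: H; exists i.
have [t2 t2I kt2] := Pi.
have [//|[t3 t3I kt3]] := sl _ _ _ _ _ _ h1 h2 h3 e1 e2 e3 _ (tI i.+1).
exists (t i), t2, t3; split => //.
have /andP[ti _] := tI i; have /andP[_ ti1] := tI i.+1.
have tt : t i <= t i.+1 by rewrite le_min !ge_min ler_nat leqnSn lexx orbT.
have t1 : t i.+1 - t i <= 1.
  rewrite lerBlDr /t /Num.min -natr1; do 2 case: ifP => //; lra.
have /andP[_ kk] := k1 _ _ ti tt ti1.
have := kobD chO (O1 _ (tI i)) (O1 _ (tI i.+1)) (O3 _ t3I); lra.
Qed.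

(** A centre p of the triangle x, w, z taken on the side from x to z is at distance at most (x|z)_w
    + 2 del + 2 from w. Slimness of x, y, z puts p near one of the other sides, and a point near an
    almost-geodesic from a to b is at distance at least about (a|b)_w from w. *)
Lemma slim_hyperbolic O eps del : chainable O -> 0 < eps -> eps <= 1 -> 0 <= del ->
  slim O eps del -> gromov_hyperbolic O.
Proof.
move=> chO eps0 eps1 del0 sl; exists (3 * del + 4); split; first by lra.
move=> x y z w Ox Oy Oz Ow.
have [s1 [sg [h1 sg0 sgs]]] := epath_exists chO Ox Oz eps0.
have [s2 [al [h2 al0 als]]] := epath_exists chO Ox Ow eps0.
have [s3 [be [h3 be0 bes]]] := epath_exists chO Ow Oz eps0.
have [s4 [ga [h4 ga0 gas]]] := epath_exists chO Ox Oy eps0.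
have [s5 [ze [h5 ze0 zes]]] := epath_exists chO Oy Oz eps0.
have [||| t [t2 [t3 [tI t2I t3I k2 k3]]]] := slim_center del0 sl h1 h2 h3 _ _ _ chO.
- by rewrite sg0 al0.
- by rewrite als be0.
- by rewrite sgs bes.
set p := sg t in k2 k3.
have Op : O p by have [_ h _] := h1; exact: h.
have O2 : O (al t2) by have [_ h _] := h2; exact: h.
have O3 : O (be t3) by have [_ h _] := h3; exact: h.
have pw : kob O p w <= gromov_prod O w x z + 2 * del + 2.
  have a1 := epath_split h2 t2I; rewrite al0 als in a1.
  have a2 := epath_split h3 t3I; rewrite be0 bes in a2.
  have b1 := kobD chO Ox O2 Op; have b2 := kobD chO Op O2 Ow.
  have b3 := kobD chO Op O3 Oz; have b4 := kobD chO Op O3 Ow.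
  have b5 := kobD chO Ox Op Oz.
  rewrite (kobC O (al t2) p) in b1; rewrite (kobC O (be t3) w) in b4.
  rewrite /gromov_prod (kobC O z w); lra.
have side (a b : pt) (s : R) (f : R -> pt) q : O a -> O b -> epath O eps s f -> f 0 = a -> f s = b ->
    (exists2 t', 0 <= t' <= s & kob O p (f t') <= del) ->
    gromov_prod O w a b <= gromov_prod O w x z + (3 * del + 4).
  move=> Oa Ob hf f0 fs [t' t'I kt].
  have Of : O (f t') by have [_ h _] := hf; exact: h.
  have a1 := epath_split hf t'I; rewrite f0 fs in a1.
  have b1 := kobD chO Oa Of Ow; have b2 := kobD chO Ob Of Ow; have b3 := kobD chO Of Op Ow.
  rewrite (kobC O b (f t')) in b2; rewrite (kobC O (f t') p) in b3.
  rewrite [gromov_prod O w a b]/gromov_prod; lra.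
rewrite lerBlDr ge_min; apply/orP.
have [|||c|c] := sl _ _ _ _ _ _ h1 h4 h5 _ _ _ _ tI.
- by rewrite sg0 ga0.
- by rewrite gas ze0.
- by rewrite sgs zes.
- by left; exact: side p Ox Oy h4 ga0 gas c.
by right; exact: side p Oy Oz h5 ze0 zes c.
Qed.

Lemma epath_aff O eps s tau (M : 'M[C]_d) (v : pt) : M \in unitmx -> epath O eps s tau ->
  epath (aff M v @` O) eps s (fun t => aff M v (tau t)).
Proof.
move=> uM [s0 tO tk]; split => // [t /tO Ot|a b a0 ab bs]; first by exists (tau t).
by rewrite kob_aff//; exact: tk.
Qed.

Lemma extraction_ge (nk : nat -> nat) : (forall k, (nk k < nk k.+1)%N) -> forall k, (k <= nk k)%N.
Proof. by move=> h; elim=> // k ih; exact: leq_ltn_trans (h k). Qed.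

(** All data sit in a single tuple so that one use of choice gives the whole sequence of
    triangles. *)
Lemma not_slim O eps del : ~ slim O eps del ->
  exists D : (R * R * R * R) * ((R -> pt) * (R -> pt) * (R -> pt)),
  let: ((s1, s2, s3, t), (sg, tau, tau')) := D in
  [/\ epath O eps s1 sg, epath O eps s2 tau & epath O eps s3 tau'] /\
  [/\ sg 0 = tau 0, tau s2 = tau' 0 & sg s1 = tau' s3] /\
  [/\ 0 <= t <= s1, forall t', 0 <= t' <= s2 -> del <= kob O (sg t) (tau t') &
      forall t', 0 <= t' <= s3 -> del <= kob O (sg t) (tau' t')].
Proof.
move=> ns; apply: contrapT => H; apply: ns => s1 s2 s3 sg tau tau' h1 h2 h3 e1 e2 e3 t tI.
apply: contrapT => /not_orP[n2 n3]; apply: H.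
exists ((s1, s2, s3, t), (sg, tau, tau')); split => //; split => //; split => // t' t'I.
  by rewrite leNgt; apply/negP => /ltW h; apply: n2; exists t'.
by rewrite leNgt; apply/negP => /ltW h; apply: n3; exists t'.
Qed.

End Slim.

(** * Rescaling a sequence of fat triangles *)

Theorem theorem1p12 (R : realType) (d : nat) (Om : set 'rV[R[i]]_d) :
  C_proper Om -> is_convex Om -> is_open Om ->
  (forall u : nat -> 'rV[R[i]]_d, (forall n, Om (u n)) ->
    exists (nk : nat -> nat) (M : nat -> 'M[R[i]]_d) (b : nat -> 'rV[R[i]]_d)
           (m : R) (Omh : set 'rV[R[i]]_d) (uinf : 'rV[R[i]]_d),
      (forall k, (nk k < nk k.+1)%N) /\
      (forall k, M k \in unitmx) /\
      0 < m /\
      C_proper Omh /\ is_convex Omh /\ is_open Omh /\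
      local_hausdorff_cvg (fun k => aff (M k) (b k) @` Om) Omh /\
      Omh uinf /\
      (forall e : R, 0 < e -> exists K, forall k, (K <= k)%N ->
         vnorm (aff (M k) (b k) (u (nk k)) - uinf) < e) /\
      locally_m_convex_seq (fun k => aff (M k) (b k) @` Om) m /\
      (forall s : R -> 'rV[R[i]]_d, geodesic Omh s -> well_behaved s)) ->
  gromov_hyperbolic Om.
Proof.
move=> pO cO oO hyp; apply: contrapT => nhyp.
have chO := chainable_convex cO oO.
(* Non-hyperbolicity refutes slimness for every error in (0, 1] and every constant. The n-th
   triangle refutes it for error 1 / (n + 1) and constant n. *)
pose ep (n : nat) : R := n.+1%:R^-1.
have ep0 n : 0 < ep n by rewrite invr_gt0 ltr0n.
have ep1 n : ep n <= 1 by rewrite invf_le1 ?ltr0n// ler1n.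
have /choice[D DP] : forall n, exists D, _ := fun n =>
  @not_slim R d Om (ep n) n%:R (fun sl => nhyp (slim_hyperbolic chO (ep0 n) (ep1 n) (ler0n R n) sl)).
pose s1 n := (D n).1.1.1.1; pose s2 n := (D n).1.1.1.2; pose s3 n := (D n).1.1.2.
pose t n := (D n).1.2; pose sg n := (D n).2.1.1; pose tau n := (D n).2.1.2; pose tau' n := (D n).2.2.
have {DP}DP n :
  [/\ epath Om (ep n) (s1 n) (sg n), epath Om (ep n) (s2 n) (tau n) & epath Om (ep n) (s3 n) (tau' n)] /\
  [/\ sg n 0 = tau n 0, tau n (s2 n) = tau' n 0 & sg n (s1 n) = tau' n (s3 n)] /\
  [/\ 0 <= t n <= s1 n, forall t', 0 <= t' <= s2 n -> n%:R <= kob Om (sg n (t n)) (tau n t') &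
      forall t', 0 <= t' <= s3 n -> n%:R <= kob Om (sg n (t n)) (tau' n t')].
  have := DP n; rewrite /s1 /s2 /s3 /t /sg /tau /tau'.
  by case: (D n) => [[[[? ?] ?] ?] [[? ?] ?]].
have Ou n : Om (sg n (t n)).
  by have [[[_ h _] _ _] [_ [tI _ _]]] := DP n; exact: h.
have [nk [M [b [m [Oh [uinf [nkS [uM [m0 [pOh [cOh [oOh [hc [Ouinf [ulimu [[OnP mconv] wb]]]]]]]]]]]]]]]] :=
  hyp _ Ou.
have [U [UU Uoo]] := free_ultrafilter.
pose On k := aff (M k) (b k) @` Om.
(* From k <= nk k the errors along the given subsequence still tend to 0 and the distances to
   infinity. *)
have nkge := extraction_ge nkS.
have cOn k : is_convex (On k) by have [_ []] := OnP k.
have oOn k : is_open (On k) by have [_ []] := OnP k.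
have pOn k : C_proper (On k) by have [] := OnP k.
have natU (r : R) : \forall k \near U, r <= (nk k)%:R.
  apply: Uoo; exists (Num.bound `|r|) => // k /= hk.
  rewrite (le_trans (ler_norm r))// ltW// (lt_le_trans (archi_boundP _))// ler_nat.
  exact: leq_trans (nkge k).
pose un k := aff (M k) (b k) (sg (nk k) (t (nk k))).
have far s tau0 : (forall n, epath Om (ep n) (s n) (tau0 n)) ->
    (forall n t', 0 <= t' <= s n -> n%:R <= kob Om (sg n (t n)) (tau0 n t')) ->
    far_path (U := U) On un (fun k => ep (nk k)) (fun k => s (nk k))
      (fun k c => aff (M k) (b k) (tau0 (nk k) c)).
  move=> h1 h2; split => [k|k|r]; [exact: epath_aff|exact: ep1|].
  apply: filterS (natU r) => k rk t' t'I; rewrite /On /un kob_aff//.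
  exact: le_trans (h2 _ _ t'I).
apply: (@no_fat_triangles R d U UU On Oh un uinf cOn oOn cOh oOh pOh
  (hausdorff_uconv Uoo cOn oOn oOh hc) Ouinf _ _ pOn m m0 _
  (fun k => ep (nk k)) (fun k => s1 (nk k)) (fun k => s2 (nk k)) (fun k => s3 (nk k))
  (fun k => t (nk k)) (fun k c => aff (M k) (b k) (sg (nk k) c))
  (fun k c => aff (M k) (b k) (tau (nk k) c)) (fun k c => aff (M k) (b k) (tau' (nk k) c))) => //.
- move=> e e0; have [K HK] := ulimu e e0.
  by apply: Uoo; exists K => // k /= Kk; exact: HK.
- by move=> k; exists (sg (nk k) (t (nk k))).
- move=> r r0; have [N [K [K0 HK]]] := mconv r r0; exists K => //.
  by apply: Uoo; exists N.+1 => // k /= Nk p Op pr v v0; exact: HK.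
- by move=> k; have [[h _ _] _] := DP (nk k); exact: epath_aff.
- by move=> k; have [_ [_ []]] := DP (nk k).
- by apply: far => n; have [[_ h _] [_ [_ h' _]]] := DP n.
- by apply: far => n; have [[_ _ h] [_ [_ _ h']]] := DP n.
- by move=> k; have [_ [[-> -> ->] _]] := DP (nk k).
move=> e e0; apply: filterS (natU e^-1) => k hk.
rewrite invf_plt ?posrE ?ltr0n//; apply: le_lt_trans hk _.
by rewrite ltr_nat.
Qed.
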